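(* Let $p,q\in[1,\infty]$, $\alpha\in\mathbb{R}$, and let $\mathcal{X}$ be either $\mathbb{R}^n$ or a cube $Q_0$ of $\mathbb{R}^n$. All suprema below are over all collections $\{Q_i\}_i$ of cubes contained in $\mathcal{X}$ with pairwise disjoint interiors. (I) The following three statements are mutually equivalent: (i) $f\in\widetilde{JN}_{(p,q,0)_\alpha}(\mathcal{X})$; (ii) $f\in JN_{(p,q,0)_\alpha}(\mathcal{X})$ and $f^-\in RM_{p,1,\alpha}(\mathcal{X})$; (iii) $f\in L^q_{\mathrm{loc}}(\mathcal{X})$ and $$\mathrm{B}(f):=\sup\left\{\sum_i|Q_i|^{1-p\alpha}\inf_{c\in[0,\infty)}\|f-c\|^p_{L^q(Q_i,|Q_i|^{-1}dx)}\right\}^{1/p}<\infty.$$ Moreover, for $f\in L^q_{\mathrm{loc}}(\mathcal{X})$, the quantities $\|f\|_{\widetilde{JN}_{(p,q,0)_\alpha}(\mathcal{X})}$, $\|f\|_{JN_{(p,q,0)_\alpha}(\mathcal{X})}+\|f^-\|_{RM_{p,1,\alpha}(\mathcal{X})}$ and $\mathrm{B}(f)$ are equivalent with positive equivalence constants independent of $f$. (II) The following two statements are mutually equivalent: (iv) $f\in L^q_{\mathrm{loc}}(\mathcal{X})$ and $$\mathrm{A}(f):=\sup\left\{\sum_i|Q_i|\left[|Q_i|^{-\alpha}\|f-\mathcal{M}_{Q_i}(f)\|_{L^q(Q_i,|Q_i|^{-1}dx)}\right]^p\right\}^{1/p}<\infty;$$ (v) $f\in L^q_{\mathrm{loc}}(\mathcal{X})$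 and $$\mathrm{D}(f):=\sup\left\{\sum_i|Q_i|\left[|Q_i|^{-\alpha}\|[f,\mathcal{M}](\mathbf 1_{Q_i})\|_{L^q(Q_i,|Q_i|^{-1}dx)}\right]^p\right\}^{1/p}<\infty.$$ Moreover, for $f\in L^q_{\mathrm{loc}}(\mathcal{X})$, $\mathrm{A}(f)$ and $\mathrm{D}(f)$ are equivalent with positive equivalence constants independent of $f$. (III) If $q<p$ and $\alpha\ge0$, then all five statements (i)–(v) are mutually equivalent, and all the corresponding quantities are equivalent, for $f\in L^q_{\mathrm{loc}}(\mathcal{X})$, with positive equivalence constants independent of $f$.
   Context: A cube in $\mathbb{R}^n$ has finite positive edge length and edges parallel to the coordinate axes; it need not be open or closed. $\mathcal{X}$ denotes either $\mathbb{R}^n$ or a fixed cube $Q_0$ of $\mathbb{R}^n$. Functions are real-valued and $f^-:=-\min\{f,0\}$. $\fint_Q f:=\frac1{|Q|}\int_Q f=:f_Q$, $|f|_Q:=\fint_Q|f|$, and $\|g\|_{L^q(Q,|Q|^{-1}dx)}:=[\fint_Q|g|^q]^{1/q}$ (the essential supremum of $|g|$ on $Q$ if $q=\infty$). $L^q_{\mathrm{loc}}(\mathcal{X})$ is the set of measurable $f$ on $\mathcal{X}$ with $f\mathbf 1_E\in L^q(\mathcal{X})$ for every bounded $E\subset\mathcal{X}$. Maximal functions: for a cube $Q$ and $x\in Q$, $\mathcal{M}_Q(f)(x):=\sup\fint_{Q_*}|f|$ over all cubes $Q_*$ with $x\in Q_*\subset Q$. The Hardy–Littlewood maximal operator on $\mathcal{X}$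 is $\mathcal{M}(f)(x):=\sup\fint_{Q_*}|f|$ over all cubes $Q_*$ with $x\in Q_*\subset\mathcal{X}$. The commutator is $[b,\mathcal{M}](f)(x):=b(x)\mathcal{M}(f)(x)-\mathcal{M}(bf)(x)$. For $g=(g_Q)_Q$ a family of nonnegative numbers (possibly $\infty$) indexed by cubes $Q\subset\mathcal{X}$, set $N_{p,\alpha}(g):=\sup\{\sum_i|Q_i|[|Q_i|^{-\alpha}g_{Q_i}]^p\}^{1/p}$ if $p\in[1,\infty)$, the supremum over all collections of cubes contained in $\mathcal{X}$ with pairwise disjoint interiors, and $N_{\infty,\alpha}(g):=\sup_{Q\subset\mathcal{X}}|Q|^{-\alpha}g_Q$. For $f\in L^q_{\mathrm{loc}}(\mathcal{X})$: - $\|f\|_{JN_{(p,q,0)_\alpha}(\mathcal{X})}:=N_{p,\alpha}(g)$ with $g_Q=\|f-f_Q\|_{L^q(Q,|Q|^{-1}dx)}$; - $\|f\|_{\widetilde{JN}_{(p,q,0)_\alpha}(\mathcal{X})}:=N_{p,\alpha}(g)$ with $g_Q=\|f-|f|_Q\|_{L^q(Q,|Q|^{-1}dx)}$; - $\|f\|_{RM_{p,1,\alpha}(\mathcal{X})}:=N_{p,\alpha}(g)$ with $g_Q=\fint_Q|f|$ (for $f\in L^1_{\mathrm{loc}}(\mathcal{X})$). Each space consists of those functions in $L^q_{\mathrm{loc}}(\mathcal{X})$ (resp. $L^1_{\mathrm{loc}}(\mathcal{X})$ for $RM_{p,1,\alpha}$) for which the corresponding quantity is finite. When $p=\infty$,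 the expressions $\mathrm{A}(f),\mathrm{B}(f),\mathrm{D}(f)$ are likewise understood as suprema over single cubes, i.e. as $N_{\infty,\alpha}(g)$ with $g_Q=\|f-\mathcal{M}_Q(f)\|_{L^q(Q,|Q|^{-1}dx)}$, $g_Q=\inf_{c\ge0}\|f-c\|_{L^q(Q,|Q|^{-1}dx)}$, $g_Q=\|[f,\mathcal{M}](\mathbf 1_Q)\|_{L^q(Q,|Q|^{-1}dx)}$, respectively. *)

(* Defs.v *)
From HB Require Import structures.
From mathcomp Require Import all_boot all_order all_algebra.
From mathcomp Require Import all_classical all_reals all_analysis.

Set Implicit Arguments.
Unset Strict Implicit.
Unset Printing Implicit Defensive.

Import Order.TTheory GRing.Theory Num.Theory.
Import numFieldNormedType.Exports.

Local Open Scope classical_set_scope.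
Local Open Scope ring_scope.
Local Open Scope ereal_scope.

(* Lebesgue measure on the space 'rV[R]_n.+1 (dimension n + 1 >= 1), obtained
   by Caratheodory's construction from coverings by countably many boxes; its
   measurable sets are all the Lebesgue measurable sets. *)
Section lebesgue_outer_measure.
Context {R : realType} {n : nat}.
Local Notation T := ('rV[R]_n.+1).
Implicit Types (a b : T) (A : set T).

(* The box is empty, of volume 0, when a 0 i > b 0 i for some i. *)
Definition box a b : set T :=
  [set x | forall i, (a ord0 i <= x ord0 i <= b ord0 i)%R].

Definition box_volume a b : R :=
  (\prod_i Num.max 0 (b ord0 i - a ord0 i))%R.

Definition lebesgue_outer A : \bar R :=
  ereal_inf [set \sum_(k <oo) (box_volume (s k).1 (s k).2)%:E
            | s in [set s : nat -> T * T |
                     A `<=` \bigcup_k box (s k).1 (s k).2]].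

Lemma box_volume_ge0 a b : (0 <= box_volume a b)%R.
Proof. by apply: prodr_ge0 => i _; rewrite le_max lexx. Qed.

Lemma lebesgue_outer_ge0 A : 0 <= lebesgue_outer A.
Proof.
apply: le_ereal_inf_tmp => _ [s _ <-]; apply: nneseries_ge0 => k _ _.
by rewrite lee_fin box_volume_ge0.
Qed.

Lemma le_lebesgue_outer : {homo lebesgue_outer : A B / A `<=` B >-> A <= B}.
Proof.
move=> A B AB; apply/ereal_inf_le_tmp => x [s Bs <-].
by exists s => //; exact: subset_trans Bs.
Qed.

Lemma lebesgue_outer0 : lebesgue_outer set0 = 0.
Proof.
apply/eqP; rewrite eq_le lebesgue_outer_ge0 andbT.
apply: ereal_inf_lbound; exists (fun=> (0%R, 0%R)) => //=.
rewrite eseries0// => k _ _.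
by rewrite /box_volume big_ord_recl mxE subrr maxxx mul0r.
Qed.

Lemma lebesgue_outer_sigma_subadditive : sigma_subadditive lebesgue_outer.
Proof.
move=> A; have [[i ioo]|] := pselect (exists i, lebesgue_outer (A i) = +oo).
  rewrite (eseries_pinfty _ _ ioo) ?leey// => k _.
  by rewrite -ltNye (lt_le_trans _ (lebesgue_outer_ge0 _)).
rewrite -forallNE => Aoo.
pose vol (ab : T * T) : \bar R := (box_volume ab.1 ab.2)%:E.
have vol_ge0 ab : 0 <= vol ab by rewrite lee_fin box_volume_ge0.
suff add2e (e : {posnum R}) : lebesgue_outer (\bigcup_k A k) <=
    \sum_(i <oo) lebesgue_outer (A i) + e%:num%:E.
  by apply/lee_addgt0Pr => _/posnumP[].
rewrite (le_trans _ (epsilon_trick _ _ _))//; last first.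
  by move=> k; exact: lebesgue_outer_ge0.
pose P k (s : nat -> T * T) := A k `<=` \bigcup_j box (s j).1 (s j).2 /\
  \sum_(j <oo) vol (s j) <= lebesgue_outer (A k) + (e%:num / (2 ^ k.+1)%:R)%:E.
have [G PG] : {G : nat -> nat -> T * T & forall k, P k (G k)}.
  apply: (@choice _ _ P) => k.
  have fA : lebesgue_outer (A k) \is a fin_num.
    by rewrite ge0_fin_numE ?lebesgue_outer_ge0// ltey; apply/eqP; exact: Aoo.
  have ek : (0 < e%:num / (2 ^ k.+1)%:R :> R)%R by [].
  have [_ [s As <-] sk] := lb_ereal_inf_adherent ek fA.
  by exists s; split => //; exact: ltW.
apply: (@le_trans _ _ (\esum_(i in setT) (vol \o uncurry G) i)).
  apply: ereal_inf_lbound => /=.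
  have /card_esym/ppcard_eqP[f] := card_nat2.
  exists (uncurry G \o f).
    move=> t [i _] /(PG i).1[j _ ijt].
    by exists (f^-1%FUN (i, j)) => //=; rewrite invK ?inE.
  rewrite -(esum_pred_image (vol \o uncurry G) _ xpredT) ?[fun=> _]set_true//.
    by rewrite image_eq.
  by move=> k _; exact: vol_ge0.
rewrite (_ : esum _ _ = \sum_(i <oo) \sum_(j <oo) vol (G i j)); last first.
  pose J : nat -> set (nat * nat) := fun i => [set (i, j) | j in setT].
  rewrite (_ : setT = \bigcup_k J k); last first.
    by rewrite predeqE => -[a b]; split => // _; exists a => //; exists b.
  rewrite esum_bigcupT /=; last 2 first.
    - apply/trivIsetP => i j _ _ ij.
      rewrite predeqE => -[u m] /=; split => //= -[] [_] _ [<-{u} _].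
      by move=> [m' _] [] /esym/eqP; rewrite (negbTE ij).
    - by move=> [u m]; exact: vol_ge0.
  rewrite -(image_id [set: nat]) -fun_true esum_pred_image//; last first.
    by move=> k _; apply: esum_ge0 => ? _; exact: vol_ge0.
  apply: eq_eseriesr => /= j _.
  rewrite -(esum_pred_image (vol \o uncurry G) (pair j) predT)//=; last first.
    by move=> ? ? _ _; exact: (@can_inj _ _ _ snd).
  by congr esum; rewrite predeqE => -[a b]; split; move=> [i _ <-]; exists i.
apply: lee_nneseries => [k _ _|k _]; last exact: (PG k).2.
by apply: nneseries_ge0 => ? _ _; exact: vol_ge0.
Qed.

HB.instance Definition _ := isOuterMeasure.Build R T lebesgue_outer
  lebesgue_outer0 lebesgue_outer_ge0 le_lebesgue_outer
  lebesgue_outer_sigma_subadditive.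

Definition Rn := caratheodory_type lebesgue_outer.
HB.instance Definition _ := NormedModule.copy Rn T.
HB.instance Definition _ := Measurable.on Rn.

Definition lebesgue_Rn : set Rn -> \bar R := lebesgue_outer.
HB.instance Definition _ := isMeasure.Build _ _ _ lebesgue_Rn
  (@caratheodory_measure0 _ _ lebesgue_outer)
  (@caratheodory_measure_ge0 _ _ lebesgue_outer)
  (@caratheodory_measure_sigma_additive _ _ lebesgue_outer).

End lebesgue_outer_measure.
Arguments Rn : clear implicits.

Section spaces.
Context {R : realType} {n : nat}.
Local Notation T := (Rn R n).
Local Notation mu := (@lebesgue_Rn R n).
Implicit Types (Q E X : set T) (f b : T -> R) (F : T -> \bar R).
Implicit Types (p q : \bar R) (alpha : R).

(* A product of n + 1 bounded intervals of the same length l > 0, each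
   endpoint of each interval being included or not. *)
Definition cube Q : Prop := exists (a : T) (l : R) (lb rb : 'I_n.+1 -> bool),
  (0 < l)%R /\
  Q = [set x | forall i, x ord0 i \in
         Interval (BSide (lb i) (a ord0 i)) (BSide (rb i) (a ord0 i + l)%R)].

Definition cubes X : set (set T) := [set Q | cube Q /\ Q `<=` X].

(* The volume |Q|, finite for a cube. *)
Definition vol Q : R := fine (mu Q).

Definition avg Q F : \bar R := ((vol Q)^-1)%:E * \int[mu]_(x in Q) F x.

Lemma vol_inv_ge0 Q : (0 <= (vol Q)^-1)%R.
Proof. by rewrite invr_ge0 fine_ge0. Qed.

(* The norm of L^q(Q, |Q|^{-1} dx): extending F by 0 outside Q changes neither
   the integral nor the essential supremum of `|F| over Q. *)
Definition avg_norm q Q F : \bar R :=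
  'N[mscale (NngNum (vol_inv_ge0 Q)) mu]_q[F \_ Q].

Definition Lq_loc q X : set (T -> R) :=
  [set f | measurable_fun X f /\
    forall E, measurable E -> bounded_set E -> E `<=` X ->
      'N[mu]_q[EFin \o (f \_ E)] < +oo].

(* The Hardy-Littlewood maximal operator on X; M_Q is [maximal Q]. *)
Definition maximal X f (x : T) : \bar R :=
  ereal_sup [set avg Q (fun y => `|f y|%:E) | Q in [set Q | cubes X Q /\ Q x]].

Definition commutator X b f (x : T) : \bar R :=
  (b x)%:E * maximal X f x - maximal X (b \* f)%R x.

(* Cubes with pairwise disjoint interiors are pairwise distinct, so that a
   collection of such cubes is the same as a set of cubes. *)
Definition collections X : set (set (set T)) :=
  [set S | S `<=` cubes X /\ trivIset S (fun Q => Q°)].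

Definition sup_collections X (h : set T -> \bar R) : \bar R :=
  ereal_sup [set \esum_(Q in S) h Q | S in collections X].

(* p is meant to range over [1, +oo]. *)
Definition Np p alpha X (g : set T -> \bar R) : \bar R :=
  match p with
  | r%:E => sup_collections X (fun Q =>
      (vol Q)%:E * ((vol Q `^ (- alpha))%:E * g Q) `^ r) `^ r^-1
  | _ => ereal_sup [set (vol Q `^ (- alpha))%:E * g Q | Q in cubes X]
  end.

Definition norm_JN p q alpha X f : \bar R :=
  Np p alpha X (fun Q => avg_norm q Q (fun x => (f x)%:E - avg Q (EFin \o f))).

Definition norm_JNt p q alpha X f : \bar R :=
  Np p alpha X (fun Q =>
    avg_norm q Q (fun x => (f x)%:E - avg Q (fun y => `|f y|%:E))).

Definition norm_RM p alpha X f : \bar R :=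
  Np p alpha X (fun Q => avg Q (fun y => `|f y|%:E)).

Definition JN p q alpha X : set (T -> R) :=
  [set f | Lq_loc q X f /\ norm_JN p q alpha X f < +oo].

Definition JNt p q alpha X : set (T -> R) :=
  [set f | Lq_loc q X f /\ norm_JNt p q alpha X f < +oo].

Definition RM p alpha X : set (T -> R) :=
  [set f | Lq_loc 1 X f /\ norm_RM p alpha X f < +oo].

Definition quantity_A p q alpha X f : \bar R :=
  Np p alpha X (fun Q => avg_norm q Q (fun x => (f x)%:E - maximal Q f x)).

Definition quantity_B p q alpha X f : \bar R :=
  match p with
  | r%:E => sup_collections X (fun Q => (vol Q `^ (1 - r * alpha))%:E *
      ereal_inf [set avg_norm q Q (fun x => (f x - c)%:E) `^ r
                | c in [set c : R | (0 <= c)%R]]) `^ r^-1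
  | _ => Np p alpha X (fun Q =>
      ereal_inf [set avg_norm q Q (fun x => (f x - c)%:E)
                | c in [set c : R | (0 <= c)%R]])
  end.

Definition quantity_D p q alpha X f : \bar R :=
  Np p alpha X (fun Q => avg_norm q Q (commutator X f \1_Q)).

Definition equivalent_on (L : set (T -> R)) (G H : (T -> R) -> \bar R) : Prop :=
  exists c C : R, [/\ (0 < c)%R, (0 < C)%R &
    forall f, L f -> c%:E * G f <= H f <= C%:E * G f].

End spaces.

(* Main.v *)
(* Part (I) holds cube by cube: f_Q and |f|_Q are within ||f - c|| of c >= 0, and
   |f|_Q - f_Q is twice the average of f^-.

   Part (II) is an identity: a cube meeting Q can be slid into Q without losing
   any of its intersection with Q, so that [f, M](1_Q) = f - M_Q f on Q.

   Part (III).  On Q one has |f|_Q <= M_Q f, so the positive part of |f|_Q - f,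
   whose average is at least half of that of |f - |f|_Q|, is at most |f - M_Q f|:
   thus A controls the (p,1) version of the tilde norm.  Conversely
   |f - M_Q f| <= |f - |f|_Q| + M_Q(|f| - |f|_Q).  Let k(Q) be the supremum of
   sum |P| osc_1(P)^p over collections in Q.  Iterating Calderon-Zygmund
   decompositions yields, for s < p and all t > 0,
     int_Q |h - h_Q|^s <= C (t^(p-s) k(Q) + t^(-s) |Q|),
   and the weak type estimate carries this over to int_Q M_Q(h - h_Q)^q for q < s.
   Optimising in t bounds the L^q averages by kappa(Q) = (k(Q) / |Q|)^(1/p), and
   since k is superadditive and alpha >= 0 the sum of |Q|^(1 - p alpha) kappa(Q)^p
   over a collection is at most the p-th power of the (p,1) norm.  When p = oo,
   any finite exponent above q takes the place of p in k. *)
Require Import Defs.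
From HB Require Import structures.
From mathcomp Require Import all_boot all_order all_algebra.
From mathcomp Require Import all_classical all_reals all_analysis.
From mathcomp Require Import measurable_realfun ess_sup_inf.
From mathcomp Require Import ring lra.

Set Implicit Arguments.
Unset Strict Implicit.
Unset Printing Implicit Defensive.

Import Order.TTheory GRing.Theory Num.Theory.
Import numFieldNormedType.Exports.

Local Open Scope classical_set_scope.
Local Open Scope ring_scope.
Local Open Scope ereal_scope.

(** * Volume of boxes *)

(** The maximal function is a supremum over uncountably many cubes, and its measurability is never
    established. The integral of a nonnegative function, a supremum over the simple functions below
    it, is still monotone, but subadditivity may fail. So [f - M_Q f] only enters pointwise
    comparisons with measurable functions: from below with the negative part of [f - |f|_Q], from
    above with a majorant built from countably many measurable supersets of level sets.

    Exponents are lost twice, which is where q < p is used: the John-Nirenberg inequality descends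
    from p to an intermediate s, the maximal inequality from s to q. The scale t stays free through
    both, so that one optimisation at the end suffices.

    Iterating Calderon-Zygmund decompositions leaves a remainder on the last generation of cubes.
    Truncating the oscillation at N bounds it by N^s |Q| / 2^j after j steps; j and then N go to
    infinity.

    Differentiation of integrals, on which the Calderon-Zygmund decomposition rests, takes the form
    of a covering argument on dyadic cells, carried out directly with the outer measure. *)

Section volume.
Context {R : realType} {n : nat}.
Local Notation T := (Rn R n).
Local Notation mu := (@lebesgue_Rn R n).
Local Notation lam := (@lebesgue_measure R).

(* Indicator of a box after the coordinates below j have been integrated: a cover
   inequality between products of indicators is integrated one coordinate at a
   time, which bounds the volume of a box by that of any cover by boxes. *)
Definition slab (j : nat) (v : 'I_n.+1 -> R) (A : 'I_n.+1 -> set R)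
    (x : 'I_n.+1 -> R) : R :=
  (\prod_(i < n.+1) (if (i < j)%N then v i else \1_(A i) (x i)))%R.

Lemma slab_ge0 j v A x : (forall i, 0 <= v i)%R -> (0 <= slab j v A x)%R.
Proof. by move=> v0; apply: prodr_ge0 => i _; case: ifP. Qed.

Lemma integral_slab j v (A : 'I_n.+1 -> set R) x : (j < n.+1)%N ->
  (forall i, 0 <= v i)%R ->
  (forall i, measurable (A i : set (measurableTypeR R))) ->
  (forall i, lam (A i) = (v i)%:E) ->
  \int[lam]_t (slab j v A (fun i => if i == j :> nat then t else x i))%:E =
  (slab j.+1 v A x)%:E.
Proof.
move=> jn v0 mA lA; set j' := Ordinal jn.
pose C : R := (\prod_(i < n.+1 | i != j') (if (i < j)%N then v i else \1_(A i) (x i)))%R.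
have C0 : (0 <= C)%R by apply: prodr_ge0 => i _; case: ifP.
transitivity (\int[lam]_t (C%:E * (\1_(A j') t)%:E)).
  apply: eq_integral => t _; rewrite -EFinM; congr EFin.
  rewrite /slab (bigD1 j')//= ltnn eqxx mulrC; congr (_ * _)%R.
  apply: eq_bigr => i ij; case: ifP => // _; case: ifP => // /eqP ij'.
  by move/eqP: ij; case; exact: val_inj.
rewrite (ge0_integralZl lam measurableT); last 3 first.
- exact/measurable_EFinP/measurable_indic.
- by move=> t _; rewrite lee_fin.
- by rewrite lee_fin.
have -> : \int[lam]_t (\1_(A j') t)%:E = (v j')%:E.
  by rewrite (integral_indic lam measurableT (mA j')) setIT; exact: lA.
rewrite -EFinM; congr EFin.
rewrite /slab [in RHS](bigD1 j')//= ltnSn mulrC; congr (_ * _)%R.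
apply: eq_bigr => i ij; congr (if _ then _ else _).
rewrite ltnS [RHS]leq_eqVlt; case: eqP => //= ij'.
by move/eqP: ij; case; exact: val_inj.
Qed.

(** At j = 0 the claim says that the boxes [B k] cover the box [A]; at j = n.+1 it compares the
    volumes. The step integrates both sides in coordinate j, exchanging series and integral. *)
Lemma slab_cover (A : 'I_n.+1 -> set R) v (B : nat -> 'I_n.+1 -> set R) u :
  (forall i, 0 <= v i)%R -> (forall k i, 0 <= u k i)%R ->
  (forall i, measurable (A i : set (measurableTypeR R))) ->
  (forall k i, measurable (B k i : set (measurableTypeR R))) ->
  (forall i, lam (A i) = (v i)%:E) ->
  (forall k i, lam (B k i) = (u k i)%:E) ->
  (forall x, (forall i, A i (x i)) -> exists k, forall i, B k i (x i)) ->
  (\prod_(i < n.+1) v i)%:E <= \sum_(k <oo) (\prod_(i < n.+1) u k i)%:E.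
Proof.
move=> v0 u0 mA mB lA lB AB.
suff claim j : (j <= n.+1)%N -> forall x : 'I_n.+1 -> R,
    (slab j v A x)%:E <= \sum_(k <oo) (slab j (u k) (B k) x)%:E.
  have := claim _ (leqnn _) (fun=> 0%R).
  have E w D : slab n.+1 w D (fun=> 0%R) = (\prod_(i < n.+1) w i)%R.
    by apply: eq_bigr => i _; rewrite ltn_ord.
  by rewrite E (eq_eseriesr (fun k _ => congr1 EFin (E (u k) (B k)))).
elim: j => [_ x|j IH jn x].
  have nn k : (0 <= slab 0 (u k) (B k) x)%R by exact: slab_ge0.
  have [xA|/existsNP[i xA]] := pselect (forall i, A i (x i)).
    have [k kB] := AB x xA.
    have -> : slab 0 v A x = 1%R.
      by apply: big1 => i _ /=; rewrite indicE mem_set.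
    apply: le_trans (nneseries_lim_ge k.+1 _); last by move=> *; rewrite lee_fin.
    rewrite big_mkord big_ord_recr /=.
    have -> : slab 0 (u k) (B k) x = 1%R.
      by apply: big1 => i _ /=; rewrite indicE mem_set.
    by rewrite leeDr// sume_ge0// => i _; rewrite lee_fin.
  have -> : slab 0 v A x = 0%R.
    apply/eqP; rewrite prodf_seq_eq0/=; apply/hasP; exists i => //=.
      by rewrite mem_index_enum.
    by rewrite indicE memNset.
  by apply: nneseries_ge0 => k _ _; rewrite lee_fin.
pose y (t : measurableTypeR R) (i : 'I_n.+1) := if i == j :> nat then t else x i.
have ms k : measurable_fun setT (fun t : measurableTypeR R => (slab j (u k) (B k) (y t))%:E).
  apply/measurable_EFinP; apply: measurable_prod => /= i _.
  case: (i < j)%N => //; rewrite /y; case: (i == j :> nat) => //.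
  apply: measurable_indic; exact: mB.
rewrite -(integral_slab x jn v0 mA lA).
rewrite -(eq_eseriesr (fun k _ => integral_slab x jn (u0 k) (mB k) (lB k))).
rewrite -integral_nneseries//; last by move=> *; rewrite lee_fin slab_ge0.
apply: ge0_le_integral => //=.
- by move=> t _; rewrite lee_fin slab_ge0.
- apply/measurable_EFinP; apply: measurable_prod => /= i _.
  by case: (i < j)%N => //; rewrite /y; case: (i == j :> nat) => //; apply: measurable_indic; exact: mA.
- by apply: ge0_emeasurable_sum => // *; rewrite lee_fin slab_ge0.
- by move=> t _; apply: (IH (ltnW jn)).
Qed.

Definition ibox (I : 'I_n.+1 -> interval R) : set T :=
  [set x | forall i, x ord0 i \in I i].

Lemma lam_itvcc (a b : R) : lam `[a, b]%classic = (Num.max 0 (b - a))%:E.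
Proof.
rewrite lebesgue_measure_itv/= lte_fin; case: ltP => ab.
  by rewrite max_r ?EFinB// subr_ge0 ltW.
by rewrite max_l// subr_le0.
Qed.

Lemma ibox_lower (I : 'I_n.+1 -> interval R) (v : 'I_n.+1 -> R) :
  (forall i, lam [set` I i] = (v i)%:E) ->
  (\prod_(i < n.+1) v i)%:E <= mu (ibox I).
Proof.
move=> lI; apply: le_ereal_inf_tmp => _ [s sI <-].
apply: (@slab_cover (fun i => [set` I i]) v
  (fun k i => `[(s k).1 ord0 i, (s k).2 ord0 i]%classic)
  (fun k i => Num.max 0 ((s k).2 ord0 i - (s k).1 ord0 i))%R) => //.
- by move=> i; rewrite -lee_fin -lI measure_ge0.
- by move=> k i; rewrite le_max lexx.
- by move=> k i; exact: lam_itvcc.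
- move=> x xI; have /sI[k _ kx] : ibox I (\row_i x i) by move=> i; rewrite mxE; exact: xI.
  by exists k => i; have := kx i; rewrite mxE /= in_itv.
Qed.

Lemma box_upper (a b : T) : mu (box a b) <= (box_volume a b)%:E.
Proof.
apply: ereal_inf_lbound; exists (fun k => if k is 0%N then (a, b) else (0%R, 0%R)).
  by move=> x xab; exists 0%N.
pose f k : \bar R := (match k with 0%N => box_volume a b | _ => 0%R end)%:E.
rewrite (eq_eseriesr (g := f)) => [|[|k] _//=].
  rewrite nneseries_recl// => [|[|k] _//]; last by rewrite lee_fin box_volume_ge0.
  by rewrite eseries0 ?adde0// => -[|k].
by congr EFin; rewrite /box_volume big_ord_recl /= mxE subrr maxxx mul0r.
Qed.

Lemma box_volumeD1 (a b : T) (i : 'I_n.+1) : box_volume a b =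
  (Num.max 0 (b ord0 i - a ord0 i) *
   \prod_(j < n.+1 | j != i) Num.max 0 (b ord0 j - a ord0 j))%R.
Proof. by rewrite /box_volume (bigD1 i). Qed.

(** Caratheodory's criterion for a half-space: the hyperplane x_i = c cuts each box of a cover into
    two closed boxes whose volumes add up to at most that of the box. Both keep the hyperplane, so
    whether H contains it is irrelevant. *)
Lemma measurable_coord (i : 'I_n.+1) (c : R) b :
  measurable [set x : T | x ord0 i \in Interval -oo%O (BSide b c)].
Proof.
set H := [set x | _].
suff : caratheodory_measurable (@lebesgue_outer R n) H by [].
apply: le_caratheodory_measurable => X.
apply: le_ereal_inf_tmp => _ [s sX <-].
pose s1 k : T * T := ((s k).1, \row_j if j == i then Num.min ((s k).2 ord0 j) c else (s k).2 ord0 j).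
pose s2 k : T * T := (\row_j if j == i then Num.max ((s k).1 ord0 j) c else (s k).1 ord0 j, (s k).2).
have nn (s' : nat -> T * T) k : 0 <= (box_volume (s' k).1 (s' k).2)%:E.
  by rewrite lee_fin box_volume_ge0.
apply: (@le_trans _ _ (\sum_(k <oo) (box_volume (s1 k).1 (s1 k).2)%:E
   + \sum_(k <oo) (box_volume (s2 k).1 (s2 k).2)%:E)).
  apply: leeD; apply: ereal_inf_lbound; [exists s1|exists s2] => //.
    move=> x [/sX[k _ kx] Hx]; exists k => //= j; have := kx j.
    rewrite mxE; case: eqP => // -> /andP[-> /=]; rewrite le_min => -> /=.
    by move: Hx; rewrite /H /= in_itv/=; case: (b) => //= /ltW.
  move=> x [/sX[k _ kx] Hx]; exists k => //= j; have := kx j.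
  rewrite mxE; case: eqP => // -> /andP[+ -> /=]; rewrite ge_max => -> /=.
  move: Hx; rewrite /H /= in_itv/=; case: (b) => //= /negP.
    by rewrite -leNgt andbT.
  by rewrite -ltNge andbT => /ltW.
rewrite -nneseriesD// lee_nneseries// => [k _|k _]; first by rewrite adde_ge0.
rewrite -EFinD lee_fin 3!(box_volumeD1 _ _ i) /= !mxE !eqxx.
have P1 : (\prod_(j < n.+1 | j != i) Num.max 0 ((s1 k).2 ord0 j - (s1 k).1 ord0 j) =
   \prod_(j < n.+1 | j != i) Num.max 0 ((s k).2 ord0 j - (s k).1 ord0 j))%R.
  by apply: eq_bigr => j ji; rewrite !mxE (negbTE ji).
have P2 : (\prod_(j < n.+1 | j != i) Num.max 0 ((s2 k).2 ord0 j - (s2 k).1 ord0 j) =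
   \prod_(j < n.+1 | j != i) Num.max 0 ((s k).2 ord0 j - (s k).1 ord0 j))%R.
  by apply: eq_bigr => j ji; rewrite !mxE (negbTE ji).
rewrite /= in P1 P2; rewrite P1 P2 -mulrDl ler_wpM2r//.
  by apply: prodr_ge0 => j _; rewrite le_max lexx.
move: ((s k).1 ord0 i) ((s k).2 ord0 i) => u w.
rewrite {P1 P2 s1 s2 nn s sX}; rewrite !maxEle !minEle.
by repeat (case: ifPn; rewrite -?ltNge => ?); lra.
Qed.

Lemma measurable_ibox I : measurable (ibox I).
Proof.
have -> : ibox I = \bigcap_(i in setT) [set x : T | x ord0 i \in I i].
  by apply/seteqP; split=> [x h i _|x h i]; exact: h.
apply: fin_bigcap_measurable => // i _; case: (I i) => l r.
have -> : [set x : T | x ord0 i \in Interval l r] =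
  [set x : T | x ord0 i \in Interval l +oo%O] `&`
  [set x : T | x ord0 i \in Interval -oo%O r].
  by apply/seteqP; split=> x; rewrite /= !itv_boundlr/= andbT => /andP.
have mr b : measurable [set x : T | x ord0 i \in Interval -oo%O b].
  case: b => [b c|[]]; first exact: measurable_coord.
    by rewrite (_ : [set x | _] = set0)//; apply/seteqP; split=> x //=; rewrite itv_boundlr.
  rewrite (_ : [set x | _] = setT)//; apply/seteqP; split=> x //= _.
apply: measurableI => //.
rewrite (_ : [set x | _] = ~` [set x : T | x ord0 i \in Interval -oo%O l]).
  exact: measurableC.
apply/seteqP; split=> x /=; rewrite !itv_boundlr/= ?andbT.
  move=> h h'; by have := le_trans h' h; rewrite bnd_simp ltxx.
move=> /negP; rewrite -ltNge; case: l => //= b c.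
by case: b; rewrite !bnd_simp.
Qed.

End volume.

(** Neither function has to be measurable: the simple functions below [F] are below [G]. This is
    what makes averages of maximal functions comparable. *)
Lemma le_integral_nneg d (U : measurableType d) (R : realType)
    (m : {measure set U -> \bar R}) (D : set U) (F G : U -> \bar R) :
  (forall x, D x -> 0 <= F x) -> (forall x, D x -> F x <= G x) ->
  \int[m]_(x in D) F x <= \int[m]_(x in D) G x.
Proof.
move=> F0 FG; rewrite !(integral_mkcond D).
have FG' x : (F \_ D) x <= (G \_ D) x.
  by rewrite !patchE; case: ifPn => // /set_mem /FG.
have F0' x : 0 <= (F \_ D) x.
  by rewrite patchE; case: ifPn => // /set_mem /F0.
rewrite !ge0_integralTE//; last by move=> x; exact: le_trans (F0' x) (FG' x).
apply: ereal_sup_le => _ [h hF <-]; exists h => // x.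
exact: le_trans (hF x) (FG' x).
Qed.

(** * Cubes and their volume *)

Section cubes.
Context {R : realType} {n : nat}.
Local Notation T := (Rn R n).
Local Notation mu := (@lebesgue_Rn R n).
Implicit Types (Q P : set T) (f g : T -> R).

Definition cb (a : T) (l : R) (lb rb : 'I_n.+1 -> bool) : set T :=
  ibox (fun i => Interval (BSide (lb i) (a ord0 i)) (BSide (rb i) (a ord0 i + l)%R)).

Lemma mu_cb a l lb rb : (0 < l)%R -> mu (cb a l lb rb) = (l ^+ n.+1)%:E.
Proof.
move=> l0; apply/eqP; rewrite eq_le; apply/andP; split.
  apply: (@le_trans _ _ (mu (box a (a + const_mx l)%R))).
    apply: le_lebesgue_outer => x /= xab i; have := xab i.
    rewrite !mxE => /itvP /=; rewrite !itv_boundlr/= => H.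
    move: (xab i); rewrite itv_boundlr => /andP[h1 h2].
    apply/andP; split.
      by move: h1; case: (lb i); rewrite bnd_simp => // /ltW.
    by move: h2; case: (rb i); rewrite bnd_simp => // /ltW.
  apply: le_trans (box_upper _ _) _; rewrite lee_fin /box_volume.
  under eq_bigr do rewrite !mxE addrAC subrr add0r max_r ?ltW//.
  by rewrite prodr_const card_ord.
have := @ibox_lower R n (fun i => Interval (BSide (lb i) (a ord0 i))
  (BSide (rb i) (a ord0 i + l)%R)) (fun=> l).
rewrite prodr_const card_ord; apply => i.
rewrite lebesgue_measure_itv /=.
by rewrite lte_fin ltrDl l0 -EFinD addrAC subrr add0r.
Qed.

Lemma cube_cb a l lb rb : (0 < l)%R -> cube (cb a l lb rb).
Proof. by move=> l0; exists a, l, lb, rb. Qed.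

Lemma vol_cb a l lb rb : (0 < l)%R -> vol (cb a l lb rb) = (l ^+ n.+1)%R.
Proof. by move=> l0; rewrite /vol mu_cb. Qed.

Lemma cube_measurable Q : cube Q -> measurable Q.
Proof. by move=> [a [l [lb [rb [l0 ->]]]]]; exact: measurable_ibox. Qed.

Lemma cube_mu Q : cube Q -> mu Q = (vol Q)%:E.
Proof.
by move=> [a [l [lb [rb [l0 ->]]]]]; rewrite (mu_cb a lb rb l0) (vol_cb a lb rb l0).
Qed.

Lemma vol_gt0 Q : cube Q -> (0 < vol Q)%R.
Proof.
by move=> [a [l [lb [rb [l0 ->]]]]]; rewrite (vol_cb a lb rb l0) exprn_gt0.
Qed.

Lemma vol_ge0 Q : cube Q -> (0 <= vol Q)%R.
Proof. by move=> /vol_gt0/ltW. Qed.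

Lemma vol_le P Q : cube P -> cube Q -> P `<=` Q -> (vol P <= vol Q)%R.
Proof.
by move=> cP cQ PQ; rewrite -lee_fin -!cube_mu//; exact: le_lebesgue_outer.
Qed.

Lemma cube_bounded Q : cube Q -> bounded_set Q.
Proof.
move=> [a [l [lb [rb [l0 ->]]]]].
exists (\sum_i (`|a ord0 i| + l))%R; split; first exact: num_real.
move=> M hM x /= xQ; apply: le_trans (ltW hM).
rewrite [leLHS]mx_normrE; apply: bigmax_le => [|[i j] _ /=].
  by apply: sumr_ge0 => i _; rewrite addr_ge0// ltW.
rewrite (ord1 i) (bigD1 j)//= -[leLHS]addr0; apply: lerD; last first.
  by apply: sumr_ge0 => k _; rewrite addr_ge0// ltW.
move: (xQ j); rewrite itv_boundlr => /andP[h1 h2].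
have {h1} h1 : (a ord0 j <= x ord0 j)%R.
  by move: h1; case: (lb j); rewrite bnd_simp => // /ltW.
have {h2} h2 : (x ord0 j <= a ord0 j + l)%R.
  by move: h2; case: (rb j); rewrite bnd_simp => // /ltW.
by rewrite ler_norml; have := ler_norm (a ord0 j); have := ler_norm (- a ord0 j); rewrite normrN; lra.
Qed.

Definition ocb (a : T) (l : R) : set T := cb a l (fun=> false) (fun=> true).

Lemma ocb_open a l : open (ocb a l).
Proof.
rewrite openE => x xQ; rewrite /interior /=.
apply: (@filter_forall _ _ (fun i => [set y : T | y ord0 i \in `]a ord0 i, a ord0 i + l[%R]) (nbhs x)) => i.
have := xQ i; rewrite in_itv/= => xi.
have := @coord_continuous R 1 n.+1 ord0 i x.
move=> /(_ [set t : R | t \in `]a ord0 i, a ord0 i + l[%R]); apply.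
apply: open_nbhs_nbhs; split.
  exact: interval_open.
by rewrite /= in_itv.
Qed.

Lemma ocb_sub_interior a l lb rb : ocb a l `<=` (cb a l lb rb)°.
Proof.
have /interior_id <- := @ocb_open a l; apply: interiorS.
move=> x xQ i; have := xQ i; rewrite !itv_boundlr => /andP[h1 h2].
apply/andP; split.
  by move: h1; case: (lb i); rewrite !bnd_simp// => /ltW.
by move: h2; case: (rb i); rewrite !bnd_simp// => /ltW.
Qed.

(** Turns disjointness of interiors into disjointness of cubes without loss of volume, so that the
    boundary of a cube never has to be measured. *)
Lemma cube_core Q : cube Q -> exists P, [/\ cube P, P `<=` Q° & vol P = vol Q].
Proof.
move=> [a [l [lb [rb [l0 ->]]]]]; exists (ocb a l); split.
- exact: cube_cb.
- exact: ocb_sub_interior.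
- by rewrite (vol_cb a lb rb l0) vol_cb.
Qed.

Lemma cube_nonempty Q : cube Q -> Q !=set0.
Proof.
move=> /[dup] /vol_gt0 Q0 cQ; apply/set0P/eqP => Q00.
by move: Q0; rewrite /vol Q00 measure0 ltxx.
Qed.

Lemma cube_interior_nonempty Q : cube Q -> Q° !=set0.
Proof.
by move=> /cube_core[P [/cube_nonempty[x Px] PQ _]]; exists x; exact: PQ.
Qed.

End cubes.

(** * Averages and normalised norms *)

Section mean.
Context {R : realType} {n : nat}.
Local Notation T := (Rn R n).
Local Notation mu := (@lebesgue_Rn R n).
Implicit Types (f g : T -> R) (F G : T -> \bar R) (q : \bar R).
Variable Q : set T.
Hypothesis cQ : cube Q.
Local Notation nu := (mscale (NngNum (vol_inv_ge0 Q)) mu : {measure set T -> \bar R}).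

Let mQ : measurable Q := cube_measurable cQ.
Let muQ : (mu : {measure set T -> \bar R}) Q = (vol Q)%:E := cube_mu cQ.

Lemma avg_ge0 F : (forall x, Q x -> 0 <= F x) -> 0 <= avg Q F.
Proof. by move=> F0; rewrite mule_ge0 ?lee_fin ?vol_inv_ge0 ?integral_ge0. Qed.

Lemma avg_le F G : (forall x, Q x -> 0 <= F x) ->
  (forall x, Q x -> F x <= G x) -> avg Q F <= avg Q G.
Proof.
by move=> F0 FG; rewrite lee_wpmul2l ?lee_fin ?vol_inv_ge0// le_integral_nneg.
Qed.

Lemma eq_avg F G : (forall x, Q x -> F x = G x) -> avg Q F = avg Q G.
Proof.
by move=> FG; congr (_ * _); apply: eq_integral => x /set_mem; exact: FG.
Qed.

Lemma avg_cst c : avg Q (cst c) = c.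
Proof.
rewrite /avg integral_cst// muQ muleC -muleA -EFinM divff ?mule1//.
by rewrite gt_eqF// vol_gt0.
Qed.

Lemma integral_avg F : \int[mu]_(x in Q) F x = (vol Q)%:E * avg Q F.
Proof. by rewrite muleA -EFinM divff ?mul1e// gt_eqF// vol_gt0. Qed.

Lemma avg_mscale F : measurable_fun Q F -> (forall x, Q x -> 0 <= F x) ->
  avg Q F = \int[nu]_(x in Q) F x.
Proof. by move=> mF F0; rewrite ge0_integral_mscale. Qed.

Lemma nu_Q : nu Q = 1.
Proof.
transitivity (((vol Q)^-1)%:E * (mu : {measure set T -> \bar R}) Q); first by [].
by rewrite muQ -EFinM mulVf// gt_eqF// vol_gt0.
Qed.

Lemma nu_setT_gt0 : 0 < nu setT.
Proof.
apply: (@lt_le_trans _ _ (nu Q)); first by rewrite nu_Q.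
exact: le_measure (mem_set mQ) (mem_set measurableT) (@subsetT _ _).
Qed.

Lemma avg_norm_ge0 q F : 0 <= avg_norm q Q F.
Proof. exact: Lnorm_ge0. Qed.

Lemma avg_norm_le q F G : 1 <= q -> (forall x, Q x -> `|F x| <= `|G x|) ->
  avg_norm q Q F <= avg_norm q Q G.
Proof.
move=> q1 FG.
have FG' x : `|(F \_ Q) x| <= `|(G \_ Q) x|.
  by rewrite !patchE; case: ifPn => // /set_mem /FG.
rewrite /avg_norm unlock; case: q q1 => [r r1||//].
  have r0 : (0 <= r)%R by rewrite lee_fin in r1; exact: le_trans r1.
  apply: gt0_ler_poweR; rewrite ?invr_ge0 ?in_itv/= ?leey ?andbT//.
  - by apply: integral_ge0 => *; exact: poweR_ge0.
  - by apply: integral_ge0 => *; exact: poweR_ge0.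
  apply: le_integral_nneg => [x _|x _]; first exact: poweR_ge0.
  by apply: gt0_ler_poweR => //; rewrite in_itv/= leey abse_ge0.
by move=> _; case: ifP => // _; apply: le_ess_sup; exact: nearW.
Qed.

Lemma eq_avg_norm q F G : (forall x, Q x -> F x = G x) ->
  avg_norm q Q F = avg_norm q Q G.
Proof.
move=> FG; apply: eq_Lnorm => x.
by rewrite !patchE; case: ifPn => // /set_mem /FG.
Qed.

Lemma avg_norm_EFin q f :
  avg_norm q Q (EFin \o f) = 'N[nu]_q[EFin \o (f \_ Q)].
Proof.
by apply: eq_Lnorm => x /=; rewrite !patchE; case: ifPn.
Qed.

Lemma avg_normD q f g : 1 <= q -> measurable_fun Q f -> measurable_fun Q g ->
  avg_norm q Q (EFin \o (f \+ g)%R) <=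
  avg_norm q Q (EFin \o f) + avg_norm q Q (EFin \o g).
Proof.
move=> q1 mf mg; rewrite !avg_norm_EFin.
apply: le_trans (eminkowski _ _ _ q1); last 2 first.
- exact/(measurable_restrictT _ mQ).
- exact/(measurable_restrictT _ mQ).
rewrite le_eqVlt; apply/orP; left; apply/eqP; apply: eq_Lnorm => x /=.
by rewrite !patchE; case: ifPn => //; rewrite addr0.
Qed.

Lemma avg_normE (r : R) F : (0 < r)%R -> measurable_fun Q F ->
  avg_norm r%:E Q F = avg Q (fun x => `|F x| `^ r) `^ r^-1.
Proof.
move=> r0 mF; rewrite /avg_norm unlock; congr (_ `^ _).
have E : (fun x => `|(F \_ Q) x| `^ r) = (fun x => `|F x| `^ r) \_ Q.
  apply/funext => x; rewrite !patchE; case: ifPn => // _.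
  by rewrite abse0 poweR0r// gt_eqF.
rewrite E -integral_mkcond -avg_mscale//; last by move=> x _; exact: poweR_ge0.
apply: (@measurableT_comp _ _ _ _ _ _ (fun x => x `^ r)) => //.
  exact: measurable_poweR.
exact: measurableT_comp.
Qed.

Lemma avg_normX (r : R) F : (0 < r)%R -> measurable_fun Q F ->
  avg_norm r%:E Q F `^ r = avg Q (fun x => `|F x| `^ r).
Proof.
move=> r0 mF; rewrite avg_normE// -poweRrM mulVf ?gt_eqF// poweRe1//.
by apply: avg_ge0 => *; exact: poweR_ge0.
Qed.

Lemma avg_norm1 F : measurable_fun Q F -> avg_norm 1 Q F = avg Q (fun x => `|F x|).
Proof.
move=> mF; rewrite avg_normE// invr1 poweRe1.
  by apply: eq_avg => x _; rewrite poweRe1.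
by apply: avg_ge0 => *; exact: poweR_ge0.
Qed.

Lemma avg_norm_cst q c : 1 <= q -> avg_norm q Q (cst c%:E) <= `|c|%:E.
Proof.
case: q => [r r1|_|//].
  have r0 : (0 < r)%R by rewrite lee_fin in r1; exact: lt_le_trans r1.
  rewrite avg_normE// (eq_avg (G := cst (`|c%:E| `^ r))) => [|//].
  by rewrite avg_cst -poweRrM divff ?gt_eqF// poweRe1// abse_ge0.
rewrite /avg_norm unlock nu_setT_gt0; apply/ess_supP/nearW => x /=.
by rewrite patchE; case: ifPn => _ //=; rewrite normr0 lee_fin.
Qed.

(** Hoelder's inequality against the indicator of Q, whose normalised norm is at most 1. The cases q
    = 1 and q = +oo are apart, since the conjugate exponent [r / (r - 1)] requires 1 < r < +oo. *)
Lemma avg_le_norm q f : 1 <= q -> measurable_fun Q f ->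
  avg Q (fun x => `|f x|%:E) <= avg_norm q Q (EFin \o f).
Proof.
move=> q1 mf.
have mE : measurable_fun Q (EFin \o f) by exact/measurable_EFinP.
have mA : measurable_fun Q (fun x => `|f x|%:E).
  exact/measurable_EFinP/measurableT_comp.
case: q q1 => [r r1|_|//]; last first.
  rewrite avg_mscale//.
  rewrite /avg_norm unlock nu_setT_gt0; set M := ess_sup _ _.
  apply: (@le_trans _ _ (\int[nu]_(x in Q) cst M x)); last first.
    by rewrite integral_cst// nu_Q mule1.
  have M0 : 0 <= M by apply: ess_sup_gee => //; [exact: nu_setT_gt0|apply: nearW => x /=; exact: abse_ge0].
  apply: ae_ge0_le_integral => //.
  have := ess_sup_ge nu (abse \o ((EFin \o f) \_ Q)).
  by apply: filterS => x /= + Qx; rewrite patchE mem_set.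
move: r1; rewrite lee_fin le_eqVlt => /predU1P[<-|r1].
  by rewrite avg_norm1.
have r0 : (0 < r)%R by apply: lt_trans r1.
have r1' : (0 < r - 1)%R by rewrite subr_gt0.
have s0 : (0 < r / (r - 1))%R by rewrite divr_gt0.
rewrite -[leLHS](avg_norm1 mE) !avg_norm_EFin.
have m1 : measurable_fun setT (\1_Q : T -> R) by exact: measurable_indic.
have mfQ : measurable_fun setT (f \_ Q) by exact/(measurable_restrictT _ mQ).
have := @hoelder _ _ _ nu (f \_ Q) (\1_Q) r (r / (r - 1))%R mfQ m1 r0 s0.
have -> : (r^-1 + (r / (r - 1))^-1 = 1)%R.
  by rewrite invfM invrK; field; rewrite gt_eqF.
move=> /(_ erefl).
have -> : (EFin \o (f \_ Q \* \1_Q)%R) = EFin \o (f \_ Q).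
  apply/funext => x /=; rewrite patchE indicE.
  by case: ifPn => _; rewrite ?mulr1 ?mul0r.
move=> /le_trans; apply.
rewrite -[leRHS]mule1; apply: lee_wpmul2l; first exact: Lnorm_ge0.
apply: (@le_trans _ _ (avg_norm (r / (r - 1))%:E Q (cst 1%:E))).
  rewrite le_eqVlt; apply/orP; left; apply/eqP; apply: eq_Lnorm => x /=.
  by rewrite patchE indicE; case: ifPn.
apply: (le_trans (avg_norm_cst _ _)); last by rewrite normr1.
by rewrite lee_fin ler_pdivlMr// mul1r gerBl.
Qed.

(** Jensen's inequality for the r-th power, read off from the comparison of normalised norms. *)
Lemma powR_avg_le (r : R) f : (1 <= r)%R -> measurable_fun Q f ->
  avg Q (fun x => `|f x|%:E) `^ r <= avg Q (fun x => (`|f x| `^ r)%:E).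
Proof.
move=> r1 mf; have r0 : (0 < r)%R by apply: lt_le_trans r1.
rewrite -(avg_normX (F := EFin \o f))//; last exact/measurable_EFinP.
apply: gt0_ler_poweR; rewrite ?in_itv/= ?leey ?andbT ?avg_norm_ge0//.
- exact: ltW.
- by apply: avg_ge0 => *; rewrite lee_fin.
- exact: avg_le_norm.
Qed.

Section integrable.
Variable f : T -> R.
Hypothesis fi : mu.-integrable Q (EFin \o f).

Lemma integrable_measurable : measurable_fun Q f.
Proof. by have /measurable_int/measurable_EFinP := fi. Qed.

Lemma integrable_cst c : mu.-integrable Q (EFin \o (cst c : T -> R)).
Proof.
apply: measurable_bounded_integrable => //.
  by rewrite muQ ltry.
exists `|c|%R; split; first exact: num_real.
by move=> M cM x _ /=; exact: ltW.
Qed.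

Lemma avg_fin_num : avg Q (EFin \o f) \is a fin_num.
Proof. by rewrite fin_numM// integrable_fin_num. Qed.

Lemma avg_abs_fin_num : avg Q (fun x => `|f x|%:E) \is a fin_num.
Proof.
have /integrable_norm fi' := fi.
by rewrite fin_numM// (integrable_fin_num mQ fi').
Qed.

Lemma avgB_cst c : avg Q (EFin \o f) - c%:E = avg Q (fun x => (f x - c)%:E).
Proof.
rewrite -[c%:E]avg_cst /avg -muleBr//; last first.
  by rewrite fin_num_adde_defr// integrable_fin_num.
by rewrite -(integralB_EFin mQ fi (integrable_cst c)).
Qed.

Lemma integrableB_cst c : mu.-integrable Q (EFin \o (fun x => f x - c)%R).
Proof.
have := integrableB mQ fi (integrable_cst c).
by apply: eq_integrable.
Qed.

Lemma abse_avg : `|avg Q (EFin \o f)| <= avg Q (fun x => `|f x|%:E).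
Proof.
rewrite /avg abseM gee0_abs ?lee_fin ?vol_inv_ge0//.
rewrite lee_wpmul2l ?lee_fin ?vol_inv_ge0//.
by apply: (le_trans (le_abse_integral _ _ _)) => //; exact: measurable_int fi.
Qed.

End integrable.

Lemma abse_avgB_cst f c : mu.-integrable Q (EFin \o f) ->
  `|avg Q (EFin \o f) - c%:E| <= avg Q (fun x => `|f x - c|%:E).
Proof.
by move=> fi; rewrite avgB_cst//; apply: abse_avg; exact: integrableB_cst.
Qed.

End mean.

Lemma poweRD_le (R : realType) (a b : \bar R) (r : R) : 0 <= a -> 0 <= b ->
  (0 <= r)%R -> (a + b) `^ r <= (2 `^ r)%:E * (a `^ r + b `^ r).
Proof.
move=> a0 b0 r0.
have m0 : 0 <= maxe a b by rewrite le_max a0.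
have hab : a + b <= 2%:E * maxe a b.
  rewrite (_ : 2%:E = 1 + 1)// ge0_muleDl// !mul1e leeD// le_max lexx ?orbT//.
apply: (@le_trans _ _ ((2%:E * maxe a b) `^ r)).
  by apply: gt0_ler_poweR; rewrite // in_itv/= leey andbT ?adde_ge0// mule_ge0.
rewrite poweRM// poweR_EFin; apply: lee_wpmul2l; first by rewrite lee_fin powR_ge0.
by case: (leP a b) => _; rewrite ?leeDl ?leeDr// poweR_ge0.
Qed.

Lemma ge0_le_poweR (R : realType) (a b : \bar R) (r : R) : (0 <= r)%R ->
  0 <= a -> a <= b -> a `^ r <= b `^ r.
Proof.
move=> r0 a0 ab; apply: gt0_ler_poweR => //; rewrite in_itv/= leey andbT//.
exact: le_trans ab.
Qed.

Lemma esumZ_le (R : realType) (I : choiceType) (S : set I) (a : I -> \bar R) (c : R) :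
  (0 <= c)%R -> (forall i, 0 <= a i) ->
  \esum_(i in S) (c%:E * a i) <= c%:E * \esum_(i in S) a i.
Proof.
move=> c0 a0; apply: ge_ereal_sup => _ [A AS <-].
rewrite -ge0_mule_fsumr//; apply: lee_wpmul2l; first by rewrite lee_fin.
by apply: ereal_sup_ubound; exists A.
Qed.

(** * Suprema over collections of cubes *)

Section Np.
Context {R : realType} {n : nat}.
Local Notation T := (Rn R n).
Local Notation mu := (@lebesgue_Rn R n).
Implicit Types (Q X : set T) (f : T -> R) (g h : set T -> \bar R) (p : \bar R).

Lemma vol_nneg Q : (0 <= vol Q)%R.
Proof. exact: fine_ge0. Qed.

Definition weight (r alpha : R) g Q : \bar R :=
  (vol Q)%:E * ((vol Q `^ (- alpha))%:E * g Q) `^ r.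

Lemma weight_ge0 r alpha g Q : 0 <= weight r alpha g Q.
Proof. by rewrite mule_ge0 ?lee_fin ?vol_nneg ?poweR_ge0. Qed.

Lemma weight_le r alpha g h Q : (0 <= r)%R -> 0 <= g Q -> g Q <= h Q ->
  weight r alpha g Q <= weight r alpha h Q.
Proof.
move=> r0 g0 gh; apply: lee_wpmul2l; first by rewrite lee_fin vol_nneg.
apply: ge0_le_poweR => //; first by rewrite mule_ge0// lee_fin powR_ge0.
by apply: lee_wpmul2l; rewrite // lee_fin powR_ge0.
Qed.

Lemma weightD_le r alpha g h Q : (0 <= r)%R -> 0 <= g Q -> 0 <= h Q ->
  weight r alpha (fun P => g P + h P) Q <=
  (2 `^ r)%:E * (weight r alpha g Q + weight r alpha h Q).
Proof.
move=> r0 g0 h0; have w0 : 0 <= (vol Q `^ (- alpha))%:E by rewrite lee_fin powR_ge0.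
rewrite /weight -ge0_muleDr ?poweR_ge0// muleCA; apply: lee_wpmul2l.
  by rewrite lee_fin vol_nneg.
by rewrite [X in X `^ r]ge0_muleDr//; apply: poweRD_le; rewrite // mule_ge0.
Qed.

Lemma weightZ r alpha g Q (C : R) : (0 < r)%R -> (0 <= C)%R -> 0 <= g Q ->
  weight r alpha (fun P => C%:E * g P) Q = (C `^ r)%:E * weight r alpha g Q.
Proof.
move=> r0 C0 g0; have w0 : 0 <= (vol Q `^ (- alpha))%:E * g Q by rewrite mule_ge0// lee_fin powR_ge0.
by rewrite /weight muleCA (poweRM r _ w0) ?lee_fin// muleCA poweR_EFin.
Qed.

Lemma sup_collections_ge0 X h : (forall Q, 0 <= h Q) -> 0 <= sup_collections X h.
Proof.
move=> h0; apply: le_ereal_sup_tmp; exists (\esum_(Q in set0) h Q).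
  by exists set0 => //; split => // Q; rewrite trivIset_set0.
by rewrite esum_ge0.
Qed.

Lemma sup_collections_le X g h :
  (forall Q, cubes X Q -> g Q <= h Q) -> sup_collections X g <= sup_collections X h.
Proof.
move=> gh; apply: ge_ereal_sup => _ [S cS <-]; apply: le_ereal_sup_tmp.
exists (\esum_(Q in S) h Q); first by exists S.
by apply: le_esum => Q /cS.1; exact: gh.
Qed.

Lemma eq_sup_collections X g h :
  (forall Q, cubes X Q -> g Q = h Q) -> sup_collections X g = sup_collections X h.
Proof.
by move=> gh; apply/eqP; rewrite eq_le !sup_collections_le// => Q /gh ->.
Qed.

Lemma sup_collectionsZ X h (c : R) : (0 <= c)%R -> (forall Q, 0 <= h Q) ->
  sup_collections X (fun Q => c%:E * h Q) <= c%:E * sup_collections X h.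
Proof.
move=> c0 h0; apply: ge_ereal_sup => _ [S cS <-].
apply: le_trans (esumZ_le _ c0 h0) _; apply: lee_wpmul2l; first by rewrite lee_fin.
by apply: ereal_sup_ubound; exists S.
Qed.

Lemma sup_collectionsD X g h : (forall Q, 0 <= g Q) -> (forall Q, 0 <= h Q) ->
  sup_collections X (fun Q => g Q + h Q) <=
  sup_collections X g + sup_collections X h.
Proof.
move=> g0 h0; apply: ge_ereal_sup => _ [S cS <-].
by rewrite esumD//; apply: leeD; apply: ereal_sup_ubound; exists S.
Qed.

Lemma Np_fin (r alpha : R) X g :
  Np r%:E alpha X g = sup_collections X (weight r alpha g) `^ r^-1.
Proof. by []. Qed.

Lemma Np_ge0 p alpha X g : 1 <= p -> (forall Q, cubes X Q -> 0 <= g Q) ->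
  cubes X !=set0 -> 0 <= Np p alpha X g.
Proof.
case: p => [r _ _ _|_ g0 [Q XQ]|//]; first exact: poweR_ge0.
apply: le_ereal_sup_tmp; exists ((vol Q `^ (- alpha))%:E * g Q); first by exists Q.
by rewrite mule_ge0 ?g0// lee_fin powR_ge0.
Qed.

Lemma Np_le p alpha X g h : 1 <= p -> (forall Q, cubes X Q -> 0 <= g Q) ->
  (forall Q, cubes X Q -> g Q <= h Q) -> Np p alpha X g <= Np p alpha X h.
Proof.
case: p => [r r1 g0 gh|_ g0 gh|//].
  have r0 : (0 <= r)%R by rewrite lee_fin in r1; exact: le_trans r1.
  rewrite !Np_fin; apply: ge0_le_poweR; first by rewrite invr_ge0.
    by apply: sup_collections_ge0 => Q; exact: weight_ge0.
  by apply: sup_collections_le => Q XQ; apply: weight_le; rewrite ?g0 ?gh.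
apply: ge_ereal_sup => _ [Q XQ <-]; apply: le_ereal_sup_tmp.
exists ((vol Q `^ (- alpha))%:E * h Q); first by exists Q.
by apply: lee_wpmul2l; rewrite ?lee_fin ?powR_ge0 ?gh.
Qed.

Lemma eq_Np p alpha X g h : 
  (forall Q, cubes X Q -> g Q = h Q) -> Np p alpha X g = Np p alpha X h.
Proof.
move=> gh; have E : [set (vol Q `^ (- alpha))%:E * g Q | Q in cubes X] =
    [set (vol Q `^ (- alpha))%:E * h Q | Q in cubes X].
  by apply/seteqP; split=> _ [Q XQ <-]; exists Q; rewrite // gh.
case: p => [r| |]; rewrite /Np ?E//; congr (_ `^ _).
by apply: eq_sup_collections => Q /gh ->.
Qed.

Lemma NpZ p alpha X g (C : R) : 1 <= p -> (0 < C)%R ->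
  (forall Q, cubes X Q -> 0 <= g Q) ->
  Np p alpha X (fun Q => C%:E * g Q) <= C%:E * Np p alpha X g.
Proof.
move=> + C0; case: p => [r r1 g0|_ g0|//].
  have r0 : (0 < r)%R by rewrite lee_fin in r1; exact: lt_le_trans r1.
  rewrite !Np_fin.
  rewrite [X in _ <= X * _](_ : C%:E = (C `^ r)%:E `^ r^-1); last first.
    by rewrite poweR_EFin -powRrM divff ?gt_eqF// powRr1// ltW.
  rewrite -poweRM; last 2 first.
  - by rewrite lee_fin powR_ge0.
  - by apply: sup_collections_ge0 => Q; exact: weight_ge0.
  apply: ge0_le_poweR; first by rewrite invr_ge0 ltW.
    by apply: sup_collections_ge0 => Q; exact: weight_ge0.
  apply: le_trans (sup_collectionsZ _ _ _); last 2 first.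
  - by rewrite powR_ge0.
  - by move=> Q; exact: weight_ge0.
  by apply: sup_collections_le => Q XQ; rewrite weightZ ?g0// ltW.
apply: ge_ereal_sup => _ [Q XQ <-]; rewrite muleCA.
apply: lee_wpmul2l; first by rewrite lee_fin ltW.
by apply: ereal_sup_ubound; exists Q.
Qed.

Lemma Np_leZ p alpha X g h (C : R) : 1 <= p -> (0 < C)%R ->
  (forall Q, cubes X Q -> 0 <= g Q) -> (forall Q, cubes X Q -> 0 <= h Q) ->
  (forall Q, cubes X Q -> g Q <= C%:E * h Q) ->
  Np p alpha X g <= C%:E * Np p alpha X h.
Proof.
move=> p1 C0 g0 h0 gh; apply: le_trans (NpZ _ p1 C0 h0).
exact: Np_le.
Qed.

(** A crude form of Minkowski's inequality. The constant is 4 = 2 * 2: one factor comes from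
    splitting the r-th power inside the sums, the other from splitting the power 1/r outside, as
    2^(1/r) <= 2. *)
Lemma NpD p alpha X g h : 1 <= p -> cubes X !=set0 ->
  (forall Q, cubes X Q -> 0 <= g Q) -> (forall Q, cubes X Q -> 0 <= h Q) ->
  Np p alpha X (fun Q => g Q + h Q) <= 4%:E * (Np p alpha X g + Np p alpha X h).
Proof.
move=> p1 X0 g0 h0; have := Np_ge0 alpha p1 g0 X0; have := Np_ge0 alpha p1 h0 X0.
case: p p1 => [r r1 Nh0 Ng0|_ Nh0 Ng0|//].
  rewrite lee_fin in r1; have r0 : (0 < r)%R by exact: lt_le_trans r1.
  rewrite !Np_fin; set A := sup_collections X (weight r alpha g).
  set B := sup_collections X (weight r alpha h).
  have A0 : 0 <= A by apply: sup_collections_ge0 => Q; exact: weight_ge0.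
  have B0 : 0 <= B by apply: sup_collections_ge0 => Q; exact: weight_ge0.
  apply: (@le_trans _ _ (((2 `^ r)%:E * (A + B)) `^ r^-1)).
    apply: ge0_le_poweR; first by rewrite invr_ge0 ltW.
      by apply: sup_collections_ge0 => Q; exact: weight_ge0.
    apply: le_trans (_ : (2 `^ r)%:E * sup_collections X (fun Q =>
       weight r alpha g Q + weight r alpha h Q) <= _); last first.
      apply: lee_wpmul2l; first by rewrite lee_fin powR_ge0.
      by apply: sup_collectionsD => Q; exact: weight_ge0.
    apply: le_trans (sup_collectionsZ _ _ _); last 2 first.
    - by rewrite powR_ge0.
    - by move=> Q; rewrite adde_ge0 ?weight_ge0.
    by apply: sup_collections_le => Q XQ; apply: weightD_le; rewrite ?g0 ?h0 ?ltW.
  rewrite poweRM ?lee_fin ?powR_ge0 ?adde_ge0//.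
  rewrite poweR_EFin -powRrM divff ?gt_eqF// powRr1//.
  have -> : (4%:E = 2%:E * 2%:E :> \bar R) by rewrite -EFinM; congr EFin; ring.
  rewrite -muleA; apply: lee_wpmul2l => //.
  apply: le_trans (poweRD_le A0 B0 _) _; first by rewrite invr_ge0 ltW.
  apply: lee_wpmul2r; first by rewrite adde_ge0 ?poweR_ge0.
  rewrite lee_fin -[leRHS]powRr1//; apply: ler_powR; first by rewrite ler1n.
  by rewrite invf_le1.
apply: (@le_trans _ _ (Np +oo alpha X g + Np +oo alpha X h)).
  apply: ge_ereal_sup => _ [Q XQ <-].
  rewrite ge0_muleDr ?g0 ?h0//; apply: leeD; apply: ereal_sup_ubound; exists Q => //.
by rewrite -[leLHS]mul1e lee_wpmul2r ?adde_ge0// lee_fin ler1n.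
Qed.

Definition dominated (L : set (T -> R)) (G H : (T -> R) -> \bar R) :=
  exists2 C : R, (0 < C)%R & forall f, L f -> G f <= C%:E * H f.

Lemma dominated_refl L G : dominated L G G.
Proof. by exists 1%R => // f _; rewrite mul1e. Qed.

Lemma dominated_trans L G H K :
  dominated L G H -> dominated L H K -> dominated L G K.
Proof.
move=> [C C0 GH] [D D0 HK]; exists (C * D)%R; first by rewrite mulr_gt0.
move=> f Lf; apply: (le_trans (GH f Lf)); rewrite EFinM -muleA.
by apply: lee_wpmul2l; [rewrite lee_fin ltW|exact: HK].
Qed.

Lemma equivalent_dominated L G H :
  dominated L G H -> dominated L H G -> equivalent_on L G H.
Proof.
move=> [C C0 GH] [D D0 HG]; exists C^-1%R, D; split; rewrite ?invr_gt0// => f Lf.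
rewrite HG// andbT; apply: (@le_trans _ _ (C^-1%:E * (C%:E * H f))).
  by apply: lee_wpmul2l; [rewrite lee_fin invr_ge0 ltW|exact: GH].
by rewrite muleA -EFinM mulVf ?gt_eqF// mul1e.
Qed.

Lemma dominated_fin L G H f : dominated L G H -> L f -> H f < +oo -> G f < +oo.
Proof.
move=> [C C0 GH] Lf Hf; apply: (le_lt_trans (GH f Lf)).
by rewrite lte_mul_pinfty// lee_fin ltW.
Qed.

End Np.

Lemma measurable_abse_poweR d (U : measurableType d) (R : realType) (D : set U)
    (F : U -> \bar R) (r : R) :
  measurable_fun D F -> measurable_fun D (fun x => `|F x| `^ r).
Proof.
move=> mF; apply: (@measurableT_comp _ _ _ _ _ _ (fun x => x `^ r)).
  exact: measurable_poweR.
exact: measurableT_comp.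
Qed.

Lemma integral_mscale_poweR d (U : measurableType d) (R : realType)
    (m : {measure set U -> \bar R}) (k : {nonneg R}) (F : U -> \bar R) (r : R) :
  measurable_fun setT F ->
  \int[mscale k m]_x (`|F x| `^ r) = k%:num%:E * \int[m]_x (`|F x| `^ r).
Proof.
move=> mF; apply: ge0_integral_mscale => // [|x _]; last exact: poweR_ge0.
exact: measurable_abse_poweR.
Qed.

Lemma integral_abs_funrneg d (U : measurableType d) (R : realType)
    (m : {measure set U -> \bar R}) (D : set U) (f : U -> R) :
  measurable D -> m.-integrable D (EFin \o f) ->
  \int[m]_(x in D) `|f x|%:E =
  \int[m]_(x in D) (f x)%:E + 2%:E * \int[m]_(x in D) `|(f^\-)%R x|%:E.
Proof.
move=> mD fi; pose g x := `|(f^\-)%R x|%R.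
have gi : m.-integrable D (EFin \o g).
  by apply: integrable_norm; exact: integrable_funrneg.
have g2i : m.-integrable D (EFin \o (fun x => 2 * g x)%R).
  by have := integrableZl mD 2%R gi; apply: eq_integrable.
rewrite -(integralZl mD gi) -(integralD_EFin mD fi g2i).
apply: eq_integral => x _; rewrite /= -EFinD; congr EFin.
rewrite /g /funrneg [X in (2 * X)%R]ger0_norm ?le_max ?lexx ?orbT//.
case: (lerP 0 (f x)) => fx.
  rewrite ger0_norm// max_r ?oppr_le0//; ring.
rewrite ltr0_norm// max_l ?oppr_ge0 ?ltW//; ring.
Qed.

(** * Part (I) *)

Section local_integrability.
Context {R : realType} {n : nat}.
Local Notation T := (Rn R n).
Local Notation mu := (@lebesgue_Rn R n).
Implicit Types (Q X E : set T) (f : T -> R) (p q : \bar R).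

Lemma bounded_sub_cube E : bounded_set E -> exists2 Q, cube Q & E `<=` Q.
Proof.
move=> [M [_ hM]]; pose L : R := (`|M| + 1)%R.
have L0 : (0 < L)%R by rewrite ltr_pwDr.
exists (@cb R n (const_mx (- L)%R) (L + L)%R (fun=> true) (fun=> false)).
  by apply: cube_cb; rewrite addr_gt0.
move=> x Ex i; rewrite mxE in_itv/= addrA addNr add0r -ler_norml.
have ML : (M < L)%R by rewrite (le_lt_trans (ler_norm M))// ltrDl.
apply: le_trans (hM L ML x Ex); rewrite [leRHS]mx_normrE.
exact: (le_bigmax _ (fun i => `|x i.1 i.2|%R) (ord0, i)).
Qed.

Lemma measurable_X X : X = setT \/ cube X -> measurable X.
Proof. by case=> [->|/cube_measurable//]; exact: measurableT. Qed.

Lemma bounded_sub_cubes X E : X = setT \/ cube X -> bounded_set E -> E `<=` X ->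
  exists2 Q, cubes X Q & E `<=` Q.
Proof.
move=> [->|cX] bE EX; last by exists X; [split|].
by have [Q cQ EQ] := bounded_sub_cube bE; exists Q => //; split.
Qed.

Lemma cubes_nonempty X : X = setT \/ cube X -> cubes X !=set0.
Proof.
move=> hX; have b0 : bounded_set (set0 : set T) by exists 0%R; split; [exact: num_real|move=> ? ? ? []].
have [Q cQ _] := bounded_sub_cubes hX b0 (@sub0set _ _).
by exists Q.
Qed.

Lemma avg_norm_lty q Q f : 1 <= q -> cube Q -> measurable_fun Q f ->
  'N[mu]_q[EFin \o (f \_ Q)] < +oo -> avg_norm q Q (EFin \o f) < +oo.
Proof.
move=> q1 cQ mf; rewrite avg_norm_EFin.
have mQ := cube_measurable cQ.
have mf' : measurable_fun setT (f \_ Q) by exact/(measurable_restrictT _ mQ).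
rewrite unlock; case: q q1 => [r r1|_|//].
  have r0 : (0 < r)%R by rewrite lee_fin in r1; exact: lt_le_trans r1.
  rewrite (integral_mscale_poweR _ _ _ ((measurable_EFinP _ _).2 mf')).
  move=> /lty_poweRy Ioo; apply: poweR_lty; rewrite lte_mul_pinfty//.
  by apply: Ioo; rewrite invr_neq0// gt_eqF.
have mu0 : 0 < (mu : {measure set T -> \bar R}) setT.
  apply: (@lt_le_trans _ _ (mu Q)); first by rewrite cube_mu// lte_fin vol_gt0.
  exact: le_lebesgue_outer.
rewrite mu0 nu_setT_gt0//; apply: le_lt_trans; apply/ess_supP.
(* A null set of [mu] is also null for the rescaled measure, so the essential supremum does not
   increase. *)
have [N [mN N0 sN]] := ess_sup_ge mu (abse \o (EFin \o f \_ Q)).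
exists N; split => //.
transitivity (((vol Q)^-1)%:E * (mu : {measure set T -> \bar R}) N); first by [].
by rewrite N0 mule0.
Qed.

Lemma Lq_loc_integrable q X Q f : X = setT \/ cube X -> 1 <= q -> Lq_loc q X f -> cubes X Q ->
  mu.-integrable Q (EFin \o f).
Proof.
move=> hX q1 [mf Lf] [cQ QX].
have mQ := cube_measurable cQ.
have mfQ : measurable_fun Q f.
  exact: (measurable_funS (measurable_X hX) QX mf).
apply/integrableP; split; first exact/measurable_EFinP.
have := avg_norm_lty q1 cQ mfQ (Lf Q mQ (cube_bounded cQ) QX).
move=> /(le_lt_trans (avg_le_norm cQ q1 mfQ)) h.
have -> : \int[mu]_(x in Q) `|(EFin \o f) x| = (vol Q)%:E * avg Q (fun x => `|f x|%:E).
  by rewrite -integral_avg.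
by rewrite lte_mul_pinfty// lee_fin vol_ge0.
Qed.

Lemma integrable_L1_loc X f : X = setT \/ cube X -> measurable_fun X f ->
  (forall Q, cubes X Q -> mu.-integrable Q (EFin \o f)) -> Lq_loc 1 X f.
Proof.
move=> hX mf fi; split=> // E mE bE EX.
have [Q XQ EQ] := bounded_sub_cubes hX bE EX.
have /integrableP[_] := fi Q XQ; apply: le_lt_trans.
rewrite Lnorm1 [leRHS]integral_mkcond; apply: le_integral_nneg => // x _.
have [Ex|nEx] := pselect (E x).
  have -> : (EFin \o f \_ E) x = (f x)%:E by rewrite /= patchE mem_set.
  by have /mem_set Qx := EQ _ Ex; rewrite patchE Qx.
have -> : (EFin \o f \_ E) x = 0 by rewrite /= patchE memNset.
by rewrite abse0 patchE; case: ifP => // _; exact: abse_ge0.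
Qed.

End local_integrability.

Section per_cube.
Context {R : realType} {n : nat}.
Local Notation T := (Rn R n).
Local Notation mu := (@lebesgue_Rn R n).
Variables (q : \bar R) (Q : set T) (f : T -> R).
Hypotheses (q1 : 1 <= q) (cQ : cube Q) (fi : mu.-integrable Q (EFin \o f)).

Definition osc_JN q Q (f : T -> R) :=
  avg_norm q Q (fun x => (f x)%:E - avg Q (EFin \o f)).
Definition osc_JNt q Q (f : T -> R) :=
  avg_norm q Q (fun x => (f x)%:E - avg Q (fun y => `|f y|%:E)).
Definition osc_inf q Q (f : T -> R) := ereal_inf [set avg_norm q Q (fun x => (f x - c)%:E)
                | c in [set c : R | (0 <= c)%R]].
Definition avg_neg Q (f : T -> R) := avg Q (fun y => `|(f^\-)%R y|%:E).

Let mf : measurable_fun Q f := integrable_measurable fi.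

Lemma measurableB_cst (c : R) : measurable_fun Q (fun x => f x - c)%R.
Proof. exact: measurable_funB. Qed.

Lemma avg_norm_shift_le (a c : R) :
  `|c - a|%:E <= avg_norm q Q (fun x => (f x - c)%:E) ->
  avg_norm q Q (fun x => (f x - a)%:E) <= 2%:E * avg_norm q Q (fun x => (f x - c)%:E).
Proof.
move=> ca.
have -> : (fun x => (f x - a)%:E) = EFin \o ((fun x => f x - c) \+ cst (c - a))%R.
  by apply/funext => x /=; congr EFin; ring.
apply: le_trans (avg_normD cQ q1 (measurableB_cst c) _) _ => //.
rewrite (_ : 2%:E = 1 + 1)// ge0_muleDl// !mul1e leeD//.
exact: le_trans (avg_norm_cst cQ (c - a)%R q1) ca.
Qed.

Lemma osc_JN_le (c : R) :
  osc_JN q Q f <= 2%:E * avg_norm q Q (fun x => (f x - c)%:E).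
Proof.
rewrite /osc_JN.
have -> : avg Q (EFin \o f) = (fine (avg Q (EFin \o f)))%:E.
  by rewrite fineK// avg_fin_num.
apply: avg_norm_shift_le; rewrite distrC -abse_EFin EFinB.
rewrite fineK ?avg_fin_num//.
apply: le_trans (abse_avgB_cst cQ c fi) _.
exact: (avg_le_norm cQ q1 (measurableB_cst c)).
Qed.

(** Pointwise f^- <= |f - c| once c >= 0; this is how approximation by nonnegative constants
    controls the negative part. *)
Lemma avg_neg_le (c : R) : (0 <= c)%R ->
  avg_neg Q f <= avg_norm q Q (fun x => (f x - c)%:E).
Proof.
move=> c0; apply: le_trans (avg_le_norm cQ q1 (measurableB_cst c)).
apply: avg_le => // x _ /=; rewrite lee_fin /funrneg ger0_norm ?le_max ?lexx ?orbT//.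
rewrite ge_max normr_ge0 andbT -normrN.
by apply: le_trans (ler_norm _); rewrite lerN2 gerBl.
Qed.

Lemma osc_inf_le_JNt : osc_inf q Q f <= osc_JNt q Q f.
Proof.
apply: ereal_inf_lbound; exists (fine (avg Q (fun y => `|f y|%:E))).
  by apply: fine_ge0; apply: avg_ge0 => x _; rewrite lee_fin.
by apply: eq_avg_norm => x _; rewrite EFinB fineK// avg_abs_fin_num.
Qed.

Lemma osc_inf_ge0 : 0 <= osc_inf q Q f.
Proof. by apply: le_ereal_inf_tmp => _ [c _ <-]; exact: avg_norm_ge0. Qed.

Lemma le_osc_inf (C : R) (b : \bar R) : (0 < C)%R ->
  (forall c : R, (0 <= c)%R -> b <= C%:E * avg_norm q Q (fun x => (f x - c)%:E)) ->
  b <= C%:E * osc_inf q Q f.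
Proof.
move=> C0 h; rewrite muleC -lee_pdivrMr//; apply: le_ereal_inf_tmp => _ [c c0 <-].
by rewrite lee_pdivrMr// muleC h.
Qed.

Lemma osc_JNt_le_sum : osc_JNt q Q f <= osc_JN q Q f + 2%:E * avg_neg Q f.
Proof.
have a1 := avg_abs_fin_num cQ fi; have a2 := avg_fin_num cQ fi.
pose m := fine (avg Q (fun y => `|f y|%:E)); pose m' := fine (avg Q (EFin \o f)).
have -> : osc_JNt q Q f = avg_norm q Q (EFin \o ((fun x => f x - m') \+ cst (m' - m))%R).
  apply: eq_avg_norm => x _ /=; rewrite -(fineK a1) -EFinB; congr EFin; rewrite -/m; ring.
apply: le_trans (avg_normD cQ q1 (measurableB_cst _) _) _ => //.
apply: leeD.
  rewrite le_eqVlt; apply/orP; left; apply/eqP; apply: eq_avg_norm => x _ /=.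
  by rewrite EFinB fineK.
apply: le_trans (avg_norm_cst cQ _ q1) _.
rewrite distrC -abse_EFin EFinB !fineK//.
have E : avg Q (fun y => `|f y|%:E) = avg Q (EFin \o f) + 2%:E * avg_neg Q f.
  rewrite /avg_neg /avg (integral_abs_funrneg (cube_measurable cQ) fi) muleCA muleDr//.
  by rewrite fin_num_adde_defr// integrable_fin_num//; exact: cube_measurable.
rewrite E addeAC subee// add0e gee0_abs// mule_ge0//; exact: avg_ge0.
Qed.

End per_cube.

(** A power with positive exponent is an increasing bijection of [0, +oo], so it commutes with
    infima. Since [quantity_B] takes the infimum of p-th powers, this is what rewrites it as an
    [Np]. *)
Lemma ereal_inf_poweR (R : realType) (I : Type) (S : set I) (g : I -> \bar R) (r : R) :
  (0 < r)%R -> (forall i, 0 <= g i) ->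
  ereal_inf [set g i `^ r | i in S] = ereal_inf [set g i | i in S] `^ r.
Proof.
move=> r0 g0; have i0 : 0 <= ereal_inf [set g i | i in S].
  by apply: le_ereal_inf_tmp => _ [i _ <-].
have m0 : 0 <= ereal_inf [set g i `^ r | i in S].
  by apply: le_ereal_inf_tmp => _ [i _ <-]; exact: poweR_ge0.
have K (a : \bar R) (s : R) : 0 <= a -> s != 0%R -> (a `^ s^-1) `^ s = a.
  by move=> a0 s0; rewrite -poweRrM mulVf// poweRe1.
apply/eqP; rewrite eq_le; apply/andP; split.
  rewrite -[leLHS](K _ r) ?gt_eqF//; apply: ge0_le_poweR; [exact: ltW|exact: poweR_ge0|].
  apply: le_ereal_inf_tmp => _ [i Si <-].
  rewrite -[leRHS](K _ r^-1%R) ?invr_eq0 ?gt_eqF// invrK.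
  apply: ge0_le_poweR => //; first by rewrite invr_ge0 ltW.
  by apply: ereal_inf_lbound; exists i.
apply: le_ereal_inf_tmp => _ [i Si <-]; apply: ge0_le_poweR => //; first exact: ltW.
by apply: ereal_inf_lbound; exists i.
Qed.

Section partI.
Context {R : realType} {n : nat}.
Local Notation T := (Rn R n).
Local Notation mu := (@lebesgue_Rn R n).
Variables (p q : \bar R) (alpha : R) (X : set T).
Hypotheses (p1 : 1 <= p) (q1 : 1 <= q) (hX : X = setT \/ cube X).
Implicit Types (f : T -> R).
Local Notation L := (Lq_loc q X).

Let fint f Q : L f -> cubes X Q -> mu.-integrable Q (EFin \o f).
Proof. exact: Lq_loc_integrable. Qed.

Lemma quantity_B_Np f : quantity_B p q alpha X f = Np p alpha X (osc_inf q ^~ f).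
Proof.
case: p p1 => [r r1|//|//]; rewrite /quantity_B Np_fin; congr (_ `^ _).
rewrite lee_fin in r1; apply: eq_sup_collections => Q [cQ _].
have v0 := vol_gt0 cQ; rewrite ereal_inf_poweR; last 2 first.
- exact: lt_le_trans r1.
- by move=> c; exact: avg_norm_ge0.
rewrite /weight poweRM ?lee_fin ?powR_ge0 ?osc_inf_ge0//.
rewrite muleA; congr (_ * _); rewrite poweR_EFin -EFinM; congr EFin.
rewrite -[in RHS]powRrM powRD; last by rewrite (gt_eqF v0) implybT.
by rewrite powRr1 ?(ltW v0)// mulNr (mulrC r).
Qed.

Lemma norm_RM_Np f : norm_RM p alpha X (f^\-)%R = Np p alpha X (avg_neg ^~ f).
Proof. by []. Qed.

Lemma avg_neg_ge0 Q f : 0 <= avg_neg Q f.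
Proof. by apply: avg_ge0 => x _; rewrite lee_fin. Qed.

Let cX := cubes_nonempty hX.

Lemma norm_JNt_ge0 f : 0 <= norm_JNt p q alpha X f.
Proof. by apply: Np_ge0 => // Q _; exact: avg_norm_ge0. Qed.

Lemma norm_JN_ge0 f : 0 <= norm_JN p q alpha X f.
Proof. by apply: Np_ge0 => // Q _; exact: avg_norm_ge0. Qed.

Lemma norm_RM_ge0 f : 0 <= norm_RM p alpha X (f^\-)%R.
Proof. by apply: Np_ge0 => // Q _; exact: avg_neg_ge0. Qed.

Lemma dominated_B_JNt :
  dominated L (quantity_B p q alpha X) (norm_JNt p q alpha X).
Proof.
exists 1%R => // f Lf; rewrite mul1e quantity_B_Np.
apply: Np_le => // Q XQ; first exact: osc_inf_ge0.
by apply: osc_inf_le_JNt; [case: XQ|exact: fint].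
Qed.

Lemma dominated_JN_B : dominated L
  (fun f => norm_JN p q alpha X f + norm_RM p alpha X (f^\-)%R)
  (quantity_B p q alpha X).
Proof.
exists 3%R => // f Lf; rewrite quantity_B_Np norm_RM_Np.
(* The 2 pays for replacing c by f_Q, the 1 for the average of f^-. *)
have -> : 3%:E = 2%:E + 1 :> \bar R by rewrite -EFinD; congr EFin; ring.
have B0 : 0 <= Np p alpha X (osc_inf q ^~ f).
  by apply: Np_ge0 => // Q _; exact: osc_inf_ge0.
rewrite ge0_muleDl// mul1e; apply: leeD.
  apply: Np_leZ => //= Q XQ; [exact: avg_norm_ge0|exact: osc_inf_ge0|].
  apply: le_osc_inf => // c _; apply: osc_JN_le => //; first by case: XQ.
  exact: fint.
apply: Np_le => // Q XQ; first exact: avg_neg_ge0.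
have := @le_osc_inf _ _ q Q f 1 (avg_neg Q f) ltr01; rewrite mul1e; apply.
move=> c c0; rewrite mul1e; apply: avg_neg_le => //; first by case: XQ.
exact: fint.
Qed.

Lemma dominated_JNt_JN : dominated L (norm_JNt p q alpha X)
  (fun f => norm_JN p q alpha X f + norm_RM p alpha X (f^\-)%R).
Proof.
exists 8%R => // f Lf.
apply: (@le_trans _ _ (Np p alpha X (fun Q => osc_JN q Q f + 2%:E * avg_neg Q f))).
  apply: Np_le => // Q XQ; first exact: avg_norm_ge0.
  by apply: osc_JNt_le_sum => //; [case: XQ|exact: fint].
have n0 Q : 0 <= 2%:E * avg_neg Q f by rewrite mule_ge0 ?avg_neg_ge0.
apply: le_trans (NpD _ p1 cX _ _) _ => // [Q _|]; first exact: avg_norm_ge0.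
have -> : 8%:E = 4%:E * 2%:E :> \bar R by rewrite -EFinM; congr EFin; ring.
rewrite -muleA; apply: lee_wpmul2l => //.
rewrite ge0_muleDr ?norm_JN_ge0 ?norm_RM_ge0//; apply: leeD.
  by rewrite -[leLHS]mul1e lee_wpmul2r ?norm_JN_ge0// lee_fin ler1n.
by apply: NpZ => // Q _; exact: avg_neg_ge0.
Qed.

Lemma JN_RMP f : (JN p q alpha X f /\ RM p alpha X (f^\-)%R) <->
  L f /\ norm_JN p q alpha X f + norm_RM p alpha X (f^\-)%R < +oo.
Proof.
split=> [[[Lf JNf] [_ RMf]]|[Lf]]; first by split=> //; rewrite lte_add_pinfty.
have J0 := norm_JN_ge0 f; have M0 := norm_RM_ge0 f.
move=> h; split; split=> //.
- by apply: le_lt_trans h; rewrite leeDl.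
- apply: integrable_L1_loc => //.
    case: Lf => mf _; apply: (measurable_funrneg _); exact: mf.
  by move=> Q XQ; apply: integrable_funrneg; [case: XQ => /cube_measurable|exact: fint].
- by apply: le_lt_trans h; rewrite leeDr.
Qed.

End partI.

(** * Part (II) *)

Section geometry.
Context {R : realType} {n : nat}.
Local Notation T := (Rn R n).
Local Notation mu := (@lebesgue_Rn R n).
Local Notation I a l lb rb := (Interval (BSide lb a) (BSide rb (a + l)%R)).

(** An interval starting at or before c is moved to start at c, one ending at or after c + L is
    moved to end there, and any other is kept. A moved interval copies the endpoint it now shares
    with the target and is closed at the other end: no common point is lost, and l < L keeps that
    end inside. *)
Lemma itv_slide (a l c L : R) (lb rb lc rc : bool) : (l < L)%R ->
  exists v : R * bool * bool,
   (forall y, y \in I v.1.1 l v.1.2 v.2 -> y \in I c L lc rc) /\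
   (forall y, y \in I a l lb rb -> y \in I c L lc rc -> y \in I v.1.1 l v.1.2 v.2).
Proof.
move=> lL; have [ac|ca] := leP a c.
  exists (c, lc, false); split=> y; rewrite !in_itv/=.
    by move=> /andP[-> ycl]; case: rc => /=; lra.
  move=> /andP[_ yal] /andP[-> _] /=; case: rb yal => /= yal; lra.
have [alL|Lal] := ltP (a + l)%R (c + L)%R.
  exists (a, lb, rb); split=> y; rewrite !in_itv/= => /andP[ay yal]; last by rewrite ay yal.
  by move: ay yal; case: lb; case: rb; case: lc; case: rc => /= ? ?; apply/andP; split; lra.
exists ((c + L - l)%R, true, rc); split=> y; rewrite !in_itv/= subrK.
  by move=> /andP[ay ->]; rewrite andbT; case: lc => /=; lra.
move=> /andP[ay _] /andP[_ ->]; rewrite andbT.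
by case: lb ay => /= ay; lra.
Qed.

(** If the side of P is at least that of Q, then Q itself serves. Otherwise each coordinate is slid
    on its own, which preserves the common side length. *)
Lemma cube_slide (P Q : set T) : cube P -> cube Q -> exists P', [/\ cube P', P' `<=` Q,
  P `&` Q `<=` P' & (vol P' <= vol P)%R].
Proof.
move=> [a [l [lb [rb [l0 ->]]]]] [c [L [lc [rc [L0 ->]]]]].
have [Ll|lL] := leP L l.
  exists (cb c L lc rc); split; [exact: cube_cb|exact: subset_refl|by move=> x []|].
  rewrite (vol_cb c lc rc L0) (vol_cb a lb rb l0).
  by rewrite lerXn2r// nnegrE ltW.
have [v hv] := choice (fun i => itv_slide (a ord0 i) (c ord0 i) (lb i) (rb i) (lc i) (rc i) lL).
pose P' := cb (\row_i (v i).1.1 : T) l (fun i => (v i).1.2) (fun i => (v i).2).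
exists P'; split.
- exact: cube_cb.
- by move=> x xP i; apply: (hv i).1; have := xP i; rewrite mxE.
- by move=> x [xP xQ] i; rewrite mxE; apply: (hv i).2; [exact: xP|exact: xQ].
- by rewrite (vol_cb a lb rb l0) vol_cb.
Qed.

Lemma maximal_indic (X Q : set T) x : cubes X Q -> Q x -> maximal X \1_Q x = 1.
Proof.
move=> XQ Qx; apply/eqP; rewrite eq_le; apply/andP; split.
  apply: ge_ereal_sup => _ [P [[cP _] _] <-].
  rewrite -[leRHS](avg_cst cP); apply: avg_le => y _; rewrite lee_fin//.
  by rewrite indicE; case: (_ \in _); rewrite ?normr1 ?normr0.
apply: ereal_sup_ubound; exists Q => //; rewrite -[RHS](avg_cst XQ.1).
by apply: eq_avg => y Qy; rewrite indicE mem_set// normr1.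
Qed.

Lemma maximal_mul_indic (X Q : set T) (f : T -> R) x : cubes X Q -> Q x ->
  maximal X (f \* \1_Q)%R x = maximal Q f x.
Proof.
move=> [cQ QX] Qx; apply/eqP; rewrite eq_le; apply/andP; split.
  apply: ge_ereal_sup => _ [P [[cP PX] Px] <-].
  (* The average over P of [|f 1_Q|] only sees the part of P inside Q, and P' contains this part
     without being larger than P. *)
  have [P' [cP' P'Q PQ vP]] := cube_slide cP cQ.
  apply: le_ereal_sup_tmp; exists (avg P' (fun y => `|f y|%:E)).
    by exists P' => //; split; [split|exact: PQ].
  rewrite /avg.
  have -> : \int[mu]_(y in P) `|(f \* \1_Q)%R y|%:E = \int[mu]_(y in P `&` Q) `|f y|%:E.
    rewrite integral_mkcondr; apply: eq_integral => y _ /=.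
    by rewrite patchE indicE; case: (_ \in _); rewrite ?mulr1 ?mulr0 ?normr0.
  apply: lee_pmul.
  - by rewrite lee_fin vol_inv_ge0.
  - by apply: integral_ge0 => y _; rewrite lee_fin.
  - by rewrite lee_fin lef_pV2// posrE vol_gt0.
  rewrite integral_mkcond [leRHS]integral_mkcond; apply: le_integral_nneg => y _.
    by rewrite patchE; case: ifP => // _; rewrite lee_fin.
  rewrite !patchE; case: ifPn => [/set_mem/PQ/mem_set ->//|_].
  by case: ifP => // _; rewrite lee_fin.
apply: ge_ereal_sup => _ [P [[cP PQ] Px] <-]; apply: ereal_sup_ubound.
exists P; first by split=> //; split=> //; exact: subset_trans QX.
by apply: eq_avg => y Py /=; rewrite indicE mem_set ?mulr1//; exact: PQ.
Qed.

Lemma commutator_indic (X Q : set T) (f : T -> R) x : cubes X Q -> Q x ->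
  commutator X f \1_Q x = (f x)%:E - maximal Q f x.
Proof.
by move=> XQ Qx; rewrite /commutator maximal_indic// mule1 maximal_mul_indic.
Qed.

Lemma quantity_AD p q alpha (X : set T) :
  quantity_A p q alpha X = quantity_D p q alpha X.
Proof.
apply/funext => f; apply: eq_Np => Q XQ; apply: eq_avg_norm => x Qx.
by rewrite commutator_indic.
Qed.

End geometry.

(** * Calderon-Zygmund decomposition *)

Section cells.
Context {R : realType} {n : nat}.
Local Notation T := (Rn R n).
Local Notation mu := (@lebesgue_Rn R n).
Local Notation bits := {ffun 'I_n.+1 -> bool}.

(** Cubes as data rather than as sets, because subdivision is computed from the corner, the side and
    the status of the endpoints. *)
Record cdata := CData {
  corner : T; side : R; lbd : 'I_n.+1 -> bool; rbd : 'I_n.+1 -> bool }.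

Definition cset (d : cdata) : set T := cb (corner d) (side d) (lbd d) (rbd d).

(* The two halves of a side do not overlap: the midpoint belongs to one of them
   only, so that the children of a cube partition it exactly. *)
Definition child (d : cdata) (b : bits) : cdata :=
  CData (\row_i (corner d ord0 i + (if b i then side d / 2 else 0))%R : T) (side d / 2)%R
    (fun i => if b i then true else lbd d i) (fun i => if b i then rbd d i else true).

(** Dyadic subcubes, indexed by the successive choices of halves: the length of the word is the
    generation, and its prefixes are the dyadic ancestors. *)
Definition cell (d : cdata) (s : seq bits) : cdata := foldl child d s.

Lemma cube_cset d : (0 < side d)%R -> cube (cset d).
Proof. exact: cube_cb. Qed.

Lemma cubeE Q : cube Q -> exists2 d, (0 < side d)%R & Q = cset d.
Proof. by move=> [a [l [lb [rb [l0 ->]]]]]; exists (CData a l lb rb). Qed.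

Lemma mem_child d b x : (0 < side d)%R ->
  cset (child d b) x <->
  cset d x /\ forall i, b i = (corner d ord0 i + side d / 2 <= x ord0 i)%R.
Proof.
move=> l0; split=> [xb|[xd xb] i].
  suff H i : (x ord0 i \in Interval (BSide (lbd d i) (corner d ord0 i))
      (BSide (rbd d i) (corner d ord0 i + side d)%R)) /\
      b i = (corner d ord0 i + side d / 2 <= x ord0 i)%R.
    by split=> i; have [] := H i.
  have := xb i; rewrite !mxE /= !in_itv /=.
  case: (b i) => /= /andP[h1 h2].
    rewrite h1; split=> //; apply/andP; split; first by case: (lbd d i) => /=; lra.
    by move: h2; case: (rbd d i) => /= h2; lra.
  rewrite addr0 in h1 h2; rewrite h1/=; split.
    by case: (rbd d i) => /=; lra.
  by apply/esym/negbTE; rewrite -ltNge.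
have := xd i; have := xb i; rewrite !mxE /= !in_itv /=.
case: (b i) => /= /esym.
  move=> -> /andP[_ h]; rewrite /=.
  by move: h; case: (rbd d i) => /= h; lra.
move=> /negbT; rewrite -ltNge addr0 => h /andP[-> _] /=; lra.
Qed.

Lemma child_sub d b : (0 < side d)%R -> cset (child d b) `<=` cset d.
Proof. by move=> l0 x /(mem_child _ _ l0)[]. Qed.

Lemma cell_rcons d s b : cell d (rcons s b) = child (cell d s) b.
Proof. by rewrite /cell foldl_rcons. Qed.

Lemma side_cell d s : side (cell d s) = (side d / 2 ^+ size s)%R.
Proof.
elim/last_ind: s => [|s b IH]; first by rewrite expr0 divr1.
by rewrite cell_rcons size_rcons /= IH exprSr invfM mulrA.
Qed.

Lemma side_cell_gt0 d s : (0 < side d)%R -> (0 < side (cell d s))%R.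
Proof. by move=> l0; rewrite side_cell divr_gt0// exprn_gt0. Qed.

Lemma vol_cset d : (0 < side d)%R -> vol (cset d) = (side d ^+ n.+1)%R.
Proof. by move=> l0; rewrite vol_cb. Qed.

Lemma vol_cell_rcons d s b : (0 < side d)%R ->
  vol (cset (cell d s)) = (2 ^+ n.+1 * vol (cset (cell d (rcons s b))))%R.
Proof.
move=> l0; rewrite !vol_cset ?side_cell_gt0// cell_rcons /= -exprMn; congr (_ ^+ _)%R.
by rewrite mulrCA divff ?mulr1.
Qed.

Lemma cell_sub d s t : (0 < side d)%R -> cset (cell d (s ++ t)) `<=` cset (cell d s).
Proof.
move=> l0; elim/last_ind: t => [|t b IH]; first by rewrite cats0.
rewrite -rcons_cat cell_rcons; apply: subset_trans IH.
by apply: child_sub; exact: side_cell_gt0.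
Qed.

Lemma cell_sub0 d s : (0 < side d)%R -> cset (cell d s) `<=` cset d.
Proof. exact: (@cell_sub d [::] s). Qed.

Lemma cell_at d x k : (0 < side d)%R -> cset d x ->
  exists2 s, size s = k & cset (cell d s) x.
Proof.
move=> l0 xd; elim: k => [|k [s sk xs]]; first by exists [::].
pose b : bits := [ffun i => (corner (cell d s) ord0 i + side (cell d s) / 2 <= x ord0 i)%R].
exists (rcons s b); first by rewrite size_rcons sk.
rewrite cell_rcons; apply/mem_child; first exact: side_cell_gt0.
by split=> // i; rewrite ffunE.
Qed.

Lemma cell_inj d x s t : (0 < side d)%R -> size s = size t ->
  cset (cell d s) x -> cset (cell d t) x -> s = t.
Proof.
move=> l0; elim/last_ind: s t => [t|s b IH t].
  by move=> /esym/size0nil ->.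
elim/last_ind: t => [|t c _]; first by rewrite size_rcons.
rewrite !size_rcons => -[st]; rewrite !cell_rcons.
move=> /(mem_child _ _ (side_cell_gt0 _ l0))[xs xb].
move=> /(mem_child _ _ (side_cell_gt0 _ l0))[xt xc].
have E := IH t st xs xt; rewrite E in xb *; congr (rcons _ _).
by apply/ffunP => i; rewrite xb xc.
Qed.

Lemma cell_take d s k : (0 < side d)%R ->
  cset (cell d s) `<=` cset (cell d (take k s)).
Proof. by move=> l0; rewrite -{1}(cat_take_drop k s); exact: cell_sub. Qed.

Lemma cell_prefix d x s t : (0 < side d)%R -> (size s <= size t)%N ->
  cset (cell d s) x -> cset (cell d t) x -> s = take (size s) t.
Proof.
move=> l0 st xs xt; apply: (@cell_inj d x) => //.
  by rewrite size_takel.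
exact: cell_take xt.
Qed.

(** The maximal cells with property P, that is, words with P none of whose proper prefixes has P.
    Two cells that meet have comparable words, so maximal ones are disjoint. The encoding of words
    by integers makes the family a sequence; indices that encode no maximal word give the empty
    set. *)
Lemma stopping_cells d (P : seq bits -> Prop) : (0 < side d)%R ->
  exists F : nat -> set T,
  [/\ forall k, F k = set0 \/ exists s, [/\ P s,
        forall j, (j < size s)%N -> ~ P (take j s) & F k = cset (cell d s)],
      trivIset setT F &
      forall s x, P s -> cset (cell d s) x -> exists k, F k x].
Proof.
move=> l0; pose M s := P s /\ forall j, (j < size s)%N -> ~ P (take j s).
pose F k := if (pickle_inv k : option (seq bits)) is Some s then
  if `[< M s >] then cset (cell d s) else set0 else set0.
have FP k x : F k x -> exists s, [/\ pickle s = k, M s & cset (cell d s) x].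
  rewrite /F; case E : (pickle_inv k : option (seq bits)) => [s|//]; case: asboolP => // Ms xs.
  by exists s; split=> //; have := @pickle_invK (seq bits) k; rewrite E.
exists F; split.
- move=> k; rewrite /F; case E : (pickle_inv k : option (seq bits)) => [s|]; last by left.
  by case: asboolP => [[Ps Ms]|_]; [right; exists s|left].
- apply/trivIsetP => i j _ _ ij; apply/seteqP; split=> x //= -[].
  move=> /FP[s [si [Ps Ms] xs]] /FP[t [tj [Pt Mt] xt]].
  suff st : s = t by move/eqP: ij; apply; rewrite -si -tj st.
  wlog st : s t i j ij si tj Ps Ms xs Pt Mt xt / (size s <= size t)%N.
    move=> H; have [st|/ltnW ts] := leqP (size s) (size t); first exact: (H s t i j).
    by apply/esym; apply: (H t s j i) => //; rewrite eq_sym.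
  have E := cell_prefix l0 st xs xt.
  have [ss|ss] := eqVneq (size s) (size t); first by rewrite E ss take_size.
  have : (size s < size t)%N by rewrite ltn_neqAle ss.
  by move=> /Mt; rewrite -E.
- move=> s x Ps xs.
  have ex : exists k, `[< P (take k s) >] by exists (size s); apply/asboolP; rewrite take_size.
  case: (ex_minnP ex) => k /asboolP Pk kmin.
  have ks : (k <= size s)%N by apply: kmin; apply/asboolP; rewrite take_size.
  exists (pickle (take k s)); rewrite /F pickleK_inv; case: asboolP; last first.
    case; split=> // j; rewrite size_takel// => jk.
    rewrite take_takel ?(ltnW jk)// => /asboolP /kmin.
    by rewrite leqNgt jk.
  by move=> _; exact: cell_take xs.
Qed.

Lemma continuous_prod_seq (I : Type) (r : seq I) (f : I -> R -> R) (x : R) :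
  (forall i, {for x, continuous (f i)}) ->
  {for x, continuous (fun t => \prod_(i <- r) f i t)%R}.
Proof.
move=> cf; elim: r => [|i r IH].
  have -> : (fun t => \prod_(i <- [::]) f i t)%R = cst 1%R.
    by apply/funext => t; rewrite big_nil.
  exact: cst_continuous.
have -> : (fun t => \prod_(j <- i :: r) f j t)%R =
    (f i \* (fun t => \prod_(j <- r) f j t))%R.
  by apply/funext => t; rewrite big_cons.
by apply: continuousM; [exact: cf|exact: IH].
Qed.

Lemma box_enlarge (a b : T) (e : R) : (0 < e)%R -> exists2 t : R, (0 < t)%R &
  (box_volume (a - const_mx t)%R (b + const_mx t)%R <= box_volume a b + e)%R.
Proof.
move=> e0; pose f (i : 'I_n.+1) (t : R) : R := (Num.max 0 (b ord0 i - a ord0 i + (t + t)))%R.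
have cf i : {for 0%R, continuous (f i)}.
  pose g (t : R) : R := (b ord0 i - a ord0 i + (t + t))%R.
  have c0 : {for 0%R, continuous (cst 0%R : R -> R)} by exact: cst_continuous.
  have cg : {for 0%R, continuous g}.
    by apply: continuousD; [exact: cst_continuous|apply: continuousD].
  exact: (continuous_max c0 cg).
have c := @continuous_prod_seq _ (index_enum _) f 0%R cf.
have E t : (\prod_(i < n.+1) f i t)%R = box_volume (a - const_mx t)%R (b + const_mx t)%R.
  by apply: eq_bigr => i _; rewrite /f !mxE; congr Num.max; ring.
have E0 : (\prod_(i < n.+1) f i 0)%R = box_volume a b.
  by apply: eq_bigr => i _; rewrite /f addr0 addr0.
have /cvgrPdist_le/(_ e e0) := c.
move=> /nbhs_ballP[d /= d0 hd].
exists (d / 2)%R; first by rewrite divr_gt0.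
have := hd (d / 2)%R; rewrite /ball /= sub0r normrN gtr0_norm ?divr_gt0//.
have dd : (d / 2 < d)%R by lra.
by move=> /(_ dd); rewrite E0 E distrC => /ler_normlW; lra.
Qed.

Lemma mem_enlarge (a b x y : T) (t : R) : box a b x ->
  (forall i, `|y ord0 i - x ord0 i| <= t)%R ->
  box (a - const_mx t)%R (b + const_mx t)%R y.
Proof.
move=> xab xy i; have := xab i; have := xy i; rewrite !mxE ler_norml; lra.
Qed.

Lemma cset_dist d x y i : cset d x -> cset d y -> (`|y ord0 i - x ord0 i| <= side d)%R.
Proof.
move=> /(_ i) + /(_ i); rewrite !in_itv/= => /andP[h1 h2] /andP[h3 h4].
have {}h1 : (corner d ord0 i <= x ord0 i)%R by move: h1; case: (lbd d i) => //= /ltW.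
have {}h2 : (x ord0 i <= corner d ord0 i + side d)%R by move: h2; case: (rbd d i) => //= /ltW.
have {}h3 : (corner d ord0 i <= y ord0 i)%R by move: h3; case: (lbd d i) => //= /ltW.
have {}h4 : (y ord0 i <= corner d ord0 i + side d)%R by move: h4; case: (rbd d i) => //= /ltW.
by rewrite ler_norml; lra.
Qed.

Lemma small_cell d (t : R) : (0 < t)%R -> exists k, forall s, size s = k ->
  (side (cell d s) <= t)%R.
Proof.
move=> t0; exists (Num.truncn (`|side d| / t)).+1 => s sk.
rewrite side_cell sk; set k := Num.truncn _.
have h : (`|side d| / t < k.+1%:R)%R by exact: truncnS_gt.
apply: le_trans (ler_norm _) _; rewrite normrM normfV (@ger0_norm _ (2 ^+ _)%R) ?exprn_ge0//.
rewrite ler_pdivrMr ?exprn_gt0// mulrC -ler_pdivrMr//.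
apply: le_trans (ltW h) _; rewrite -natrX ler_nat ltnW//.
exact: ltn_expl.
Qed.

(** Plays the role of an open cover of nearly optimal volume: each point of E lies in some closed
    box [s k], hence at distance at least [t k] in every coordinate from leaving the enlarged box.
    The enlargement of the k-th box costs at most e / 2^(k+2). *)
Lemma outer_approx (E : set T) (e : R) : (mu E < +oo) -> (0 < e)%R ->
  exists (s : nat -> T * T) (t : nat -> R), [/\ forall k, (0 < t k)%R,
    E `<=` \bigcup_k box (s k).1 (s k).2 &
    \sum_(k <oo) (box_volume ((s k).1 - const_mx (t k)) ((s k).2 + const_mx (t k)))%R%:E
      <= mu E + e%:E].
Proof.
move=> Eoo e0; have e2 : (0 < e / 2)%R by rewrite divr_gt0.
have fE : mu E \is a fin_num by rewrite ge0_fin_numE// lebesgue_outer_ge0.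
have [_ [s Es <-] sE] := lb_ereal_inf_adherent e2 fE.
pose ek (k : nat) : R := ((e / 2) / (2 ^ k.+1)%:R)%R.
have ek0 k : (0 < ek k)%R by rewrite divr_gt0// ltr0n expn_gt0.
have [t ht] := choice (fun k => (exists2P _ _).1 (box_enlarge (s k).1 (s k).2 (ek0 k))).
exists s, t; split=> //; first by move=> k; have [] := ht k.
apply: (@le_trans _ _ (\sum_(k <oo) ((box_volume (s k).1 (s k).2)%:E + (ek k)%:E))).
  apply: lee_nneseries => [k _ _|k _]; first by rewrite lee_fin box_volume_ge0.
  by rewrite -EFinD lee_fin; have [] := ht k.
apply: le_trans (epsilon_trick _ _ _) _ => //.
- by move=> k; rewrite lee_fin box_volume_ge0.
- exact: ltW.
have -> : e%:E = (e / 2)%:E + (e / 2)%:E by rewrite -EFinD -splitr.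
by rewrite addeA leeD2r// ltW.
Qed.

Local Notation muM := (mu : {measure set T -> \bar R}).

(** Cover E by enlarged boxes of total volume at most |E| + e and let F be the maximal cells that
    meet E and lie inside one of them; small cells around the points of E qualify, so F covers E.
    Then (lam + eta) |E| is at most the integral of g over E, hence over the cells F, hence at most
    lam times their volume, that is, lam (|E| + e). Letting e tend to 0 leaves eta |E| <= 0. *)
Lemma cell_density_gap d (g : T -> R) (lam eta : R) (E : set T) :
  (0 < side d)%R -> measurable_fun (cset d) g -> (forall x, cset d x -> 0 <= g x)%R ->
  measurable E -> E `<=` cset d -> (0 <= lam)%R -> (0 < eta)%R ->
  (forall x, E x -> lam + eta <= g x)%R ->
  (forall s x, E x -> cset (cell d s) x ->
     \int[mu]_(y in cset (cell d s)) (g y)%:E <= (lam * vol (cset (cell d s)))%:E) ->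
  muM E = 0.
Proof.
move=> l0 mg g0 mE Ed lam0 eta0 Eg Ecell.
have mQ := cube_measurable (cube_cset l0).
have Eoo : mu E < +oo.
  apply: le_lt_trans (le_lebesgue_outer Ed) _.
  by rewrite [lebesgue_outer _](cube_mu (cube_cset l0)) ltry.
have fE : muM E \is a fin_num by rewrite ge0_fin_numE.
suff H e : (0 < e)%R -> (lam + eta)%:E * muM E <= lam%:E * (muM E + e%:E).
  apply/eqP; rewrite eq_le measure_ge0 andbT.
  rewrite -(fineK fE) lee_fin; set m := fine _.
  have m0 : (0 <= m)%R by apply: fine_ge0.
  have {}H e : (0 < e)%R -> (eta * m <= lam * e)%R.
    by move=> /H; rewrite -(fineK fE) -/m -EFinD -!EFinM lee_fin; lra.
  rewrite leNgt; apply/negP => mgt0.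
  have p1 : (0 < eta * m)%R by rewrite mulr_gt0.
  have p2 : (0 < lam + 1)%R by rewrite ltr_wpDl.
  (* Makes [lam * e] smaller than [eta * m]; the denominator has [lam + 1] because [lam] may
     vanish. *)
  pose e : R := (eta * m / (2 * (lam + 1)))%R.
  have e0 : (0 < e)%R by rewrite divr_gt0// mulr_gt0.
  have E2 : ((lam + 1) * e = eta * m / 2)%R by rewrite /e; field; rewrite gt_eqF.
  have := H e e0; lra.
move=> e0; have [s [t [t0 Es sE]]] := outer_approx Eoo e0.
pose B k := box ((s k).1 - const_mx (t k))%R ((s k).2 + const_mx (t k))%R.
pose P u := (exists k, cset (cell d u) `<=` B k) /\ (exists x, E x /\ cset (cell d u) x).
have [F [FP tF cF]] := stopping_cells P l0.
have mF k : measurable (F k).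
  case: (FP k) => [->|[u [_ _ ->]]]; first exact: measurable0.
  exact/cube_measurable/cube_cset/side_cell_gt0.
have FQ k : F k `<=` cset d.
  by case: (FP k) => [->//|[u [_ _ ->]]]; exact: cell_sub0.
have mU : measurable (\bigcup_k F k) by exact: bigcupT_measurable.
have UQ : \bigcup_k F k `<=` cset d by move=> x [k _]; exact: FQ.
have EU : E `<=` \bigcup_k F k.
  move=> x Ex; have [k _ xk] := Es x Ex; have [m hm] := small_cell d (t0 k).
  have [u um xu] := cell_at m l0 (Ed x Ex).
  have Pu : P u.
    split; last by exists x.
    exists k => y yu; apply: mem_enlarge xk _ => i.
    exact: le_trans (cset_dist i xu yu) (hm u um).
  by have [j xj] := cF u x Pu xu; exists j.
have mgE : measurable_fun (cset d) (EFin \o g) by exact/measurable_EFinP.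
have gF k : \int[mu]_(y in F k) (g y)%:E <= lam%:E * muM (F k).
  case: (FP k) => [->|[u [[_ [x [Ex xu]]] _ ->]]].
    by rewrite integral_set0 measure0 mule0.
  rewrite [X in _ * X](cube_mu (cube_cset (side_cell_gt0 _ l0))) -EFinM.
  exact: Ecell Ex xu.
apply: (@le_trans _ _ (\int[mu]_(y in E) (g y)%:E)).
  rewrite -integral_cst//; apply: le_integral_nneg => x Ex; rewrite lee_fin ?Eg//.
  by rewrite addr_ge0// ltW.
apply: (@le_trans _ _ (\int[mu]_(y in \bigcup_k F k) (g y)%:E)).
  apply: ge0_subset_integral => //.
    exact: measurable_funS mQ UQ mgE.
  by move=> x /UQ Qx; rewrite lee_fin g0.
rewrite ge0_integral_bigcup//; last 2 first.
- exact: measurable_funS mQ UQ mgE.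
- by move=> x /UQ Qx; rewrite lee_fin g0.
apply: (@le_trans _ _ (\sum_(k <oo) lam%:E * muM (F k))).
  apply: lee_nneseries => [k _ _|k _]; last exact: gF.
  by apply: integral_ge0 => x /FQ Qx; rewrite lee_fin g0.
rewrite nneseriesZl; last by move=> k _; exact: measure_ge0.
apply: lee_wpmul2l; first by rewrite lee_fin.
rewrite -measure_semi_bigcup//; last 1 first.
apply: le_trans sE.
apply: (@le_trans _ _ (mu (\bigcup_k B k))).
  apply: le_lebesgue_outer => x [k _].
  case: (FP k) => [->//|[u [[[j uj] _] _ ->]]] /uj Bx.
  by exists j.
apply: le_trans (lebesgue_outer_sigma_subadditive _) _.
by apply: lee_nneseries => [k _ _|k _]; [exact: lebesgue_outer_ge0|exact: box_upper].
Qed.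

Lemma cell_density d (g : T -> R) (lam : R) (E : set T) :
  (0 < side d)%R -> measurable_fun (cset d) g -> (forall x, cset d x -> 0 <= g x)%R ->
  measurable E -> E `<=` cset d -> (0 <= lam)%R ->
  (forall x, E x -> lam < g x)%R ->
  (forall s x, E x -> cset (cell d s) x ->
     \int[mu]_(y in cset (cell d s)) (g y)%:E <= (lam * vol (cset (cell d s)))%:E) ->
  muM E = 0.
Proof.
move=> l0 mg g0 mE Ed lam0 Eg Ecell.
have mQ := cube_measurable (cube_cset l0).
pose Ek k := E `&` [set x | lam + k.+1%:R^-1 <= g x]%R.
have mEk k : measurable (Ek k).
  have -> : Ek k = E `&` (cset d `&` g @^-1` `[(lam + k.+1%:R^-1)%R, +oo[%classic).
    apply/seteqP; split=> x [Ex h]; split=> //=.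
      by split; [exact: Ed|rewrite /= in_itv/= andbT].
    by case: h => _; rewrite /= in_itv/= andbT.
  by apply: measurableI => //; exact: mg.
have EkE k : Ek k `<=` E by move=> x [].
have Ek0 k : muM (Ek k) = 0.
  apply: (@cell_density_gap d g lam k.+1%:R^-1) => //.
  - exact: subset_trans Ed.
  - by move=> x [].
  - by move=> s x /EkE; exact: Ecell.
have EU : E `<=` \bigcup_k Ek k.
  move=> x Ex; have := Eg x Ex; rewrite -subr_gt0 => h.
  exists (Num.truncn (g x - lam)^-1) => //; split=> //=.
  rewrite addrC -lerBrDr -[leRHS]invrK lef_pV2 ?posrE ?invr_gt0//.
  by apply/ltW/truncnS_gt; rewrite invr_ge0 ltW.
apply/eqP; rewrite eq_le measure_ge0 andbT.
apply: le_trans (measure_sigma_subadditive _ _ _ EU) _ => //.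
by rewrite eseries0.
Qed.

(** The selected cubes are the maximal cells of average above lam. By hypothesis Q is not one of
    them, so each has a parent of average at most lam and of volume 2^(n+1) times its own: this
    gives the upper bound. A point outside them lies only in cells of average at most lam, so that
    [cell_density] applies to the set left over. *)
Lemma calderon_zygmund Q (g : T -> R) (lam : R) :
  cube Q -> measurable_fun Q g -> (forall x, Q x -> 0 <= g x)%R -> (0 <= lam)%R ->
  \int[mu]_(y in Q) (g y)%:E <= (lam * vol Q)%:E ->
  exists F : nat -> set T, [/\
    forall k, F k = set0 \/ [/\ cube (F k), F k `<=` Q,
      (lam * vol (F k))%:E < \int[mu]_(y in F k) (g y)%:E &
      \int[mu]_(y in F k) (g y)%:E <= (2 ^+ n.+1 * lam * vol (F k))%:E],
    trivIset setT F &
    muM (Q `&` [set x | lam < g x]%R `\` \bigcup_k F k) = 0].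
Proof.
move=> /cubeE[d l0 ->{Q}] mg g0 lam0 gQ.
have mQ := cube_measurable (cube_cset l0).
have mgE : measurable_fun (cset d) (EFin \o g) by exact/measurable_EFinP.
pose P s := (lam * vol (cset (cell d s)))%:E < \int[mu]_(y in cset (cell d s)) (g y)%:E.
have [F [FP tF cF]] := stopping_cells P l0.
have mF k : measurable (F k).
  case: (FP k) => [->|[u [_ _ ->]]]; first exact: measurable0.
  exact/cube_measurable/cube_cset/side_cell_gt0.
exists F; split=> //.
  move=> k; case: (FP k) => [->|[u [Pu Mu ->]]]; [by left|right].
  have lu := side_cell_gt0 u l0.
  split=> //; [exact: cube_cset|exact: cell_sub0|].
  case/lastP: u Pu Mu {lu} => [|u b] Pu Mu.
    by move: Pu; rewrite /P /= ltNge gQ.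
  have lu := side_cell_gt0 u l0.
  have := Mu (size u); rewrite size_rcons ltnSn => /(_ isT).
  rewrite -cats1 take_size_cat// => /negP; rewrite /P -leNgt cats1 => h.
  rewrite (mulrC _ lam) -mulrA -vol_cell_rcons//; apply: le_trans h.
  have mu1 : measurable (cset (cell d u)) by exact/cube_measurable/cube_cset.
  apply: ge0_subset_integral => //.
  - exact/cube_measurable/cube_cset/side_cell_gt0.
  - by apply: (measurable_funS mQ _ mgE); exact: cell_sub0.
  - by move=> x /(cell_sub0 l0) Qx; rewrite lee_fin g0.
  - by rewrite cell_rcons; exact: child_sub.
apply: (@cell_density d g lam) => //.
- apply: measurableD; last exact: bigcupT_measurable.
  have -> : cset d `&` [set x | (lam < g x)%R] = cset d `&` g @^-1` `]lam, +oo[%classic.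
    by apply/seteqP; split=> x [Qx] /= h; split=> //; move: h; rewrite in_itv/= andbT.
  exact: mg.
- by move=> x [[]].
- by move=> x [[]].
- move=> s x [_ nx] xs; rewrite leNgt; apply/negP => Ps; apply: nx.
  by have [k Fk] := cF s x Ps xs; exists k.
Qed.

End cells.

(** * John-Nirenberg inequality *)

Lemma lee_addr_sup (R : realType) (S : set (\bar R)) (x M : \bar R) :
  S !=set0 -> 0 <= x -> (forall y, S y -> 0 <= y) ->
  (forall y, S y -> x + y <= M) -> x + ereal_sup S <= M.
Proof.
move=> [y0 Sy0] x0 S0 H; have [->|Moo] := eqVneq M +oo; first exact: leey.
have xM : x <= M by apply: le_trans (H y0 Sy0); rewrite leeDl// S0.
have xfin : x \is a fin_num.
  by rewrite ge0_fin_numE//; apply: le_lt_trans xM _; rewrite ltey.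
rewrite addeC -leeBrDr//; apply: ge_ereal_sup => y Sy; rewrite leeBrDr// addeC.
exact: H.
Qed.

Lemma measurable_dist d (U : measurableType d) (R : realType) (D : set U)
    (h : U -> R) (c : R) : measurable_fun D h -> measurable_fun D (fun x => `|h x - c|%R).
Proof. by move=> mh; apply: measurableT_comp => //; exact: measurable_funB. Qed.

Lemma measurable_min_powR d (U : measurableType d) (R : realType) (D : set U)
    (h : U -> R) (N s : R) : measurable_fun D h ->
  measurable_fun D (fun x => Num.min (h x) N `^ s)%R.
Proof.
move=> mh; apply: (@measurableT_comp _ _ _ _ _ _ (fun x => x `^ s)%R).
  exact: measurable_powR.
exact: measurable_minr.
Qed.

Lemma ge0_integral_affine d (U : measurableType d) (R : realType)
    (m : {measure set U -> \bar R}) (D : set U) (v : U -> R) (c b : R) :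
  measurable D -> measurable_fun D v -> (forall x, 0 <= v x)%R ->
  (0 <= c)%R -> (0 <= b)%R ->
  \int[m]_(x in D) (c * (v x + b))%:E =
  c%:E * (\int[m]_(x in D) (v x)%:E + b%:E * m D).
Proof.
move=> mD mv v0 c0 b0; under eq_integral do rewrite EFinM EFinD.
have mvE : measurable_fun D (EFin \o v) by exact/measurable_EFinP.
rewrite ge0_integralZl//; last 2 first.
- by apply: emeasurable_funD.
- by move=> x _; rewrite adde_ge0 ?lee_fin.
rewrite (@ge0_integralD _ _ _ m D mD (EFin \o v) (cst b%:E))//.
- by rewrite integral_cst.
- by move=> x _; rewrite lee_fin.
Qed.

(** * Superadditivity of suprema over collections *)

Section superadditivity.
Context {R : realType} {n : nat}.
Local Notation T := (Rn R n).
Implicit Types (X Q P : set T) (h : set T -> \bar R).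

(** The collection [C] is the accumulator of the induction: any collection inside the head [F i] is
    merged into it before its supremum is taken, which is legitimate because the interiors in [C]
    avoid those of all [F i]. *)
Lemma sup_collections_seq (I : choiceType) (X : set T) (F : I -> set T) h (r : seq I)
    (C : set (set T)) :
  (forall Q, 0 <= h Q) -> uniq r -> (forall i, i \in r -> F i `<=` X) ->
  trivIset [set` r] (fun i => (F i)°) -> collections X C ->
  (forall P i, C P -> i \in r -> P° `&` (F i)° = set0) ->
  \esum_(P in C) h P + \sum_(i <- r) sup_collections (F i) h <= sup_collections X h.
Proof.
move=> h0; elim: r C => [|i r IH] C ur FX tF cC CF.
  by rewrite big_nil adde0; apply: ereal_sup_ubound; exists C.
move: ur => /= /andP[ir ur].
have s0 : 0 <= \sum_(j <- r) sup_collections (F j) h.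
  by apply: sume_ge0 => j _; exact: sup_collections_ge0.
rewrite big_cons addeCA addeC; apply: lee_addr_sup.
- by exists (\esum_(Q in set0) h Q); exists set0 => //; split=> // P P' [].
- by rewrite adde_ge0// esum_ge0.
- by move=> _ [S cS <-]; exact: esum_ge0.
move=> _ [S [SF tS] <-].
(* A cube in both would have its nonempty interior inside the interior of [F i], which [C] avoids;
   hence the sum over the union splits. *)
have SC P : S P -> C P -> False.
  move=> SP CP; have [x xP] := cube_interior_nonempty (SF P SP).1.
  have : (P° `&` (F i)°) x.
    by split=> //; apply: interiorS xP; exact: (SF P SP).2.
  by rewrite CF// mem_head.
have -> : \esum_(P in C) h P + \sum_(j <- r) sup_collections (F j) h + \esum_(Q in S) h Q =
   \esum_(P in C `|` S) h P + \sum_(j <- r) sup_collections (F j) h.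
  rewrite addeAC; congr (_ + _); rewrite (esumID C (C `|` S))//.
  by congr (_ + _); congr esum; apply/seteqP; split=> P;
    [move=> CP; split=> //; left|case|move=> SP; split; [right|move=> CP; exact: SC SP CP]|case=> -[]].
apply: IH => //.
- by move=> j jr; apply: FX; rewrite inE jr orbT.
- by apply: sub_trivIset tF => j /= jr; rewrite inE jr orbT.
- split=> [P [/cC.1//|/SF[cP PF]]|].
    by split=> //; apply: subset_trans PF _; apply: FX; rewrite mem_head.
  move=> P P' [CP|SP] [CP'|SP'].
  + exact: cC.2.
  + move=> [x [xP xP']]; exfalso.
    have : (P° `&` (F i)°) x.
      by split=> //; apply: interiorS xP'; exact: (SF P' SP').2.
    by rewrite CF// mem_head.
  + move=> [x [xP xP']]; exfalso.
    have : (P'° `&` (F i)°) x.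
      by split=> //; apply: interiorS xP; exact: (SF P SP).2.
    by rewrite CF// mem_head.
  + exact: tS.
- move=> P j [CP|SP] jr; first by rewrite CF// inE jr orbT.
  apply/seteqP; split=> // x [xP xj].
  have ij : i = j.
    apply: tF; rewrite /= ?mem_head ?inE ?jr ?orbT//.
    by exists x; split=> //; apply: interiorS xP; exact: (SF P SP).2.
  by move: ir; rewrite ij jr.
Qed.

Lemma sup_collections_super (I : choiceType) (K : set I) (X : set T) (F : I -> set T) h :
  (forall Q, 0 <= h Q) -> (forall i, K i -> F i `<=` X) ->
  trivIset K (fun i => (F i)°) ->
  \esum_(i in K) sup_collections (F i) h <= sup_collections X h.
Proof.
move=> h0 FX tF; apply: ge_ereal_sup => _ [A [finA AK] <-].
rewrite fsbig_finite//=.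
have c0 : collections X set0 by split=> // P P' [].
have := @sup_collections_seq I X F h (finmap.enum_fset (fset_set A)) set0 h0.
have inA i : i \in finmap.enum_fset (fset_set A) -> K i.
  by move=> iA; apply: AK; rewrite -[A](fset_setK finA).
rewrite esum_set0 add0e; apply => //.
- by move=> i iA; apply: FX; exact: inA.
- by apply: sub_trivIset tF => i /= iA; exact: inA.
Qed.

End superadditivity.

Section oscillation.
Context {R : realType} {n : nat}.
Local Notation T := (Rn R n).
Local Notation mu := (@lebesgue_Rn R n).
Implicit Types (Q P X : set T) (h : T -> R).

Definition mean Q h : R := fine (avg Q (EFin \o h)).
Definition osc1 Q h : \bar R := avg Q (fun x => `|h x - mean Q h|%:E).

Lemma meanE Q h : cube Q -> mu.-integrable Q (EFin \o h) ->
  (mean Q h)%:E = avg Q (EFin \o h).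
Proof. by move=> cQ hi; rewrite fineK// avg_fin_num. Qed.

Lemma mean_dist Q h c : cube Q -> mu.-integrable Q (EFin \o h) ->
  `|mean Q h - c|%:E <= avg Q (fun x => `|h x - c|%:E).
Proof.
move=> cQ hi; have := abse_avgB_cst cQ c hi.
by rewrite -meanE// -EFinB.
Qed.

Lemma osc1_ge0 Q h : 0 <= osc1 Q h.
Proof. by apply: avg_ge0 => x _; rewrite lee_fin. Qed.

Lemma osc1_fin Q h : cube Q -> mu.-integrable Q (EFin \o h) -> osc1 Q h \is a fin_num.
Proof. by move=> cQ hi; apply: avg_abs_fin_num => //; exact: integrableB_cst. Qed.

(** The k(Q) of the overview: the p-th power of the John-Nirenberg norm on Q with q = 1 and alpha =
    0. *)
Definition JNsum (p : R) Q h : \bar R :=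
  sup_collections Q (fun P => (vol P)%:E * osc1 P h `^ p).

Lemma JNsum_ge0 p Q h : 0 <= JNsum p Q h.
Proof.
apply: sup_collections_ge0 => P.
by rewrite mule_ge0 ?poweR_ge0// lee_fin vol_nneg.
Qed.

Lemma JNsum_single p Q h : cube Q -> (vol Q)%:E * osc1 Q h `^ p <= JNsum p Q h.
Proof.
move=> cQ; apply: ereal_sup_ubound; exists [set Q].
  by split=> [P -> //|P P' /= -> ->]; split.
by rewrite esum_set1// mule_ge0 ?poweR_ge0// lee_fin vol_nneg.
Qed.

(* Truncating the oscillation at N rather than h itself leaves the means alone, so
   that the Calderon-Zygmund recursion applies to the truncated integrals. *)
Definition cutosc (N s : R) Q h : \bar R :=
  \int[mu]_(x in Q) (Num.min `|h x - mean Q h| N `^ s)%:E.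

Lemma cutosc_ge0 N s Q h : 0 <= cutosc N s Q h.
Proof. by apply: integral_ge0 => x _; rewrite lee_fin powR_ge0. Qed.

Lemma powRD_le (a b s : R) : (0 <= a)%R -> (0 <= b)%R -> (0 <= s)%R ->
  ((a + b) `^ s <= 2 `^ s * (a `^ s + b `^ s))%R.
Proof.
move=> a0 b0 s0; have := @poweRD_le R a%:E b%:E s.
by rewrite -EFinD !poweR_EFin -EFinD -EFinM !lee_fin; apply.
Qed.

Lemma integral_osc Q h : cube Q -> mu.-integrable Q (EFin \o h) ->
  \int[mu]_(x in Q) `|h x - mean Q h|%:E = (fine (osc1 Q h) * vol Q)%:E.
Proof.
move=> cQ hi; rewrite EFinM fineK ?osc1_fin// muleC.
exact: integral_avg.
Qed.

(* One Calderon-Zygmund step at the level [osc1 Q h / th]: the selected cubes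
   have total volume at most [th * vol Q]. *)
Lemma cutosc_step (N s th : R) Q h : (0 <= N)%R -> (0 < s)%R -> (0 < th <= 1)%R ->
  cube Q -> mu.-integrable Q (EFin \o h) ->
  exists F : nat -> set T, [/\
    forall k, F k = set0 \/ cube (F k) /\ F k `<=` Q,
    trivIset setT F,
    \sum_(k <oo) mu (F k) <= (th * vol Q)%:E &
    cutosc N s Q h <= (2 `^ s)%:E * \sum_(k <oo) cutosc N s (F k) h +
      ((1 + 2 `^ s * (2 ^+ n.+1) `^ s) * (fine (osc1 Q h) / th) `^ s * vol Q)%:E].
Proof.
move=> N0 s0 /andP[th0 th1] cQ hi.
have mQ := cube_measurable cQ; have mh := integrable_measurable hi.
set o := fine (osc1 Q h); pose m := mean Q h; pose lam := (o / th)%R.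
have o0 : (0 <= o)%R by apply: fine_ge0; exact: osc1_ge0.
have lam0 : (0 <= lam)%R by rewrite divr_ge0// ltW.
pose g x := `|h x - m|%R.
have mg : measurable_fun Q g by exact: measurable_dist.
have mgE : measurable_fun Q (EFin \o g) by exact/measurable_EFinP.
have g0 x : (0 <= g x)%R by exact: normr_ge0.
have gQ : \int[mu]_(y in Q) (g y)%:E = (o * vol Q)%:E by exact: integral_osc.
have olam : (o <= lam)%R by rewrite ler_pdivlMr// ler_piMr.
have gQ' : \int[mu]_(y in Q) (g y)%:E <= (lam * vol Q)%:E.
  by rewrite gQ lee_fin ler_wpM2r// vol_nneg.
have [F [FP tF F0]] := calderon_zygmund cQ mg (fun x _ => g0 x) lam0 gQ'.
have FP' k : F k = set0 \/ cube (F k) /\ F k `<=` Q.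
  by case: (FP k) => [->|[? ? _ _]]; [left|right].
have mF k : measurable (F k).
  by case: (FP' k) => [->|[/cube_measurable//]]; exact: measurable0.
have FQ k : F k `<=` Q by case: (FP' k) => [->//|[]].
have mU : measurable (\bigcup_k F k) by exact: bigcupT_measurable.
have UQ : \bigcup_k F k `<=` Q by move=> x [k _]; exact: FQ.
have lamF k : lam%:E * mu (F k) <= \int[mu]_(y in F k) (g y)%:E.
  case: (FP k) => [->|[cF _ /ltW h1 _]].
    rewrite [mu _](@measure0 _ _ _ (mu : {measure set T -> \bar R})) mule0.
    by rewrite integral_set0.
  by rewrite cube_mu// -EFinM.
have volF : \sum_(k <oo) mu (F k) <= (th * vol Q)%:E.
  have sumF : lam%:E * \sum_(k <oo) mu (F k) <= (o * vol Q)%:E.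
    rewrite -nneseriesZl; last by move=> k _; exact: lebesgue_outer_ge0.
    apply: (@le_trans _ _ (\sum_(k <oo) \int[mu]_(y in F k) (g y)%:E)).
      apply: lee_nneseries => [k _ _|k _]; last exact: lamF.
      by rewrite mule_ge0// lebesgue_outer_ge0.
    rewrite -ge0_integral_bigcup//.
    - rewrite -gQ; apply: ge0_subset_integral => //.
      by move=> x _; rewrite lee_fin.
    - exact: measurable_funS mQ UQ mgE.
    - by move=> x _; rewrite lee_fin.
  (* For o = 0 the level is 0 and cannot be divided out; but then no cube is selected, since a
     selected cube carries a positive part of a zero integral. *)
  have [oe0|oN0] := eqVneq o 0%R.
    have Fk0 k : F k = set0.
      case: (FP k) => // -[cF FkQ + _]; rewrite /lam oe0 mul0r mul0r => Ik.
      have : \int[mu]_(y in F k) (g y)%:E <= \int[mu]_(y in Q) (g y)%:E.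
        by apply: ge0_subset_integral => // x _; rewrite lee_fin.
      by rewrite gQ oe0 mul0r leNgt Ik.
    rewrite eseries0; first by rewrite lee_fin mulr_ge0 ?vol_nneg// ltW.
    by move=> k _ _; rewrite Fk0; exact: (@measure0 _ _ _ (mu : {measure set T -> \bar R})).
  have op : (0 < o)%R by rewrite lt_neqAle eq_sym oN0.
  have lamp : (0 < lam)%R by rewrite divr_gt0.
  rewrite -(@lee_pmul2l _ lam%:E)// -EFinM.
  by have -> : (lam * (th * vol Q) = o * vol Q)%R by rewrite /lam mulrA divfK ?gt_eqF.
exists F; split=> //.
pose G x := (Num.min (g x) N `^ s)%R.
have mG : measurable_fun Q (EFin \o G).
  by apply/measurable_EFinP; exact: measurable_min_powR.
have G0 x : 0 <= (G x)%:E by rewrite lee_fin powR_ge0.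
have QE : (\bigcup_k F k) `|` (Q `\` \bigcup_k F k) = Q by rewrite setDUK.
have mD : measurable (Q `\` \bigcup_k F k) by exact: measurableD.
have -> : cutosc N s Q h = \int[mu]_(x in \bigcup_k F k) (G x)%:E +
    \int[mu]_(x in Q `\` \bigcup_k F k) (G x)%:E.
  rewrite -ge0_integral_setU ?QE//.
  by apply/disj_set2P; rewrite setDE setICA setICr setI0.
apply: (@le_trans _ _ (((2 `^ s)%:E * \sum_(k <oo) cutosc N s (F k) h +
    (2 `^ s * (2 ^+ n.+1 * lam) `^ s * vol Q)%:E) + (lam `^ s * vol Q)%:E)); last first.
  rewrite -addeA -EFinD leeD2l// lee_fin powRM ?exprn_ge0// -/lam.
  by rewrite le_eqVlt; apply/orP; left; apply/eqP; ring.
apply: leeD; last first.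
  apply: (@le_trans _ _ (\int[mu]_(x in Q `\` \bigcup_k F k) (lam `^ s)%:E)).
    apply: ae_ge0_le_integral => //.
    - by apply: measurable_funS mG => // x [].
    - by move=> x _; rewrite lee_fin powR_ge0.
    - exists (Q `&` [set x | lam < g x]%R `\` \bigcup_k F k); split=> //.
        apply: measurableD => //.
        have -> : Q `&` [set x | (lam < g x)%R] = Q `&` g @^-1` `]lam, +oo[%classic.
          by apply/seteqP; split=> x [Qx] /= h'; split=> //; move: h'; rewrite in_itv/= andbT.
        exact: mg.
      move=> x /= /not_implyP[[Qx nUx]]; rewrite lee_fin => /negP.
      rewrite -ltNge => hx; split=> //; split=> //=; rewrite ltNge; apply/negP => gl.
      move: hx; rewrite ltNge => /negP; apply; apply: ge0_ler_powR.
      - exact: ltW.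
      - by rewrite nnegrE le_min g0.
      - by rewrite nnegrE.
      - by rewrite ge_min gl.
  rewrite integral_cst// EFinM; apply: lee_wpmul2l; first by rewrite lee_fin powR_ge0.
  by rewrite -cube_mu//; apply: le_lebesgue_outer => x [].
rewrite ge0_integral_bigcup//; last exact: measurable_funS mQ UQ mG.
have -> : (2 `^ s * (2 ^+ n.+1 * lam) `^ s * vol Q)%:E =
    (2 `^ s)%:E * ((2 ^+ n.+1 * lam) `^ s * vol Q)%:E by rewrite -EFinM; congr EFin; ring.
rewrite -ge0_muleDr; last 2 first.
- by apply: nneseries_ge0 => k _ _; exact: cutosc_ge0.
- by rewrite lee_fin mulr_ge0 ?powR_ge0 ?vol_nneg.
have L0 : (0 <= (2 ^+ n.+1 * lam) `^ s)%R by rewrite powR_ge0.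
have muF0 k : 0 <= ((2 ^+ n.+1 * lam) `^ s)%:E * mu (F k).
  by apply: mule_ge0; [rewrite lee_fin|exact: lebesgue_outer_ge0].
apply: (@le_trans _ _ (\sum_(k <oo) ((2 `^ s)%:E * (cutosc N s (F k) h +
    ((2 ^+ n.+1 * lam) `^ s)%:E * mu (F k))))); last first.
  rewrite nneseriesZl; last first.
    by move=> k _; rewrite adde_ge0 ?cutosc_ge0.
  apply: lee_wpmul2l; first by rewrite lee_fin powR_ge0.
  rewrite nneseriesD; last 2 first.
  - by move=> k _ _; exact: cutosc_ge0.
  - by move=> k _ _; exact: muF0.
  rewrite leeD2l// nneseriesZl; last by move=> k _; exact: lebesgue_outer_ge0.
  rewrite EFinM; apply: lee_wpmul2l; first by rewrite lee_fin.
  by apply: le_trans volF _; rewrite lee_fin ler_piMl ?vol_nneg.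
apply: lee_nneseries => [k _ _|k _]; first exact: integral_ge0.
case: (FP k) => [->|[cF FkQ _ hF]].
  rewrite integral_set0 mule_ge0 ?lee_fin ?powR_ge0// adde_ge0 ?cutosc_ge0//.
  by rewrite mule_ge0 ?lebesgue_outer_ge0// lee_fin.
have hiF : mu.-integrable (F k) (EFin \o h) by exact: integrableS mQ (mF k) FkQ hi.
have mhF := integrable_measurable hiF.
(* The upper Calderon-Zygmund bound on [F k] limits how far the mean moves. Truncation at the same N
   survives the change of centre: min(g, N) is at most the oscillation around the new mean,
   truncated at N, plus this distance. *)
have dm : (`|mean (F k) h - m| <= 2 ^+ n.+1 * lam)%R.
  rewrite -lee_fin; apply: le_trans (mean_dist m cF hiF) _.
  rewrite -(@lee_pmul2l _ (vol (F k))%:E)// ?lte_fin ?vol_gt0//.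
  by rewrite -integral_avg// -EFinM mulrC.
have mv : measurable_fun (F k) (fun x => Num.min `|h x - mean (F k) h| N `^ s)%R.
  by apply: measurable_min_powR; exact: measurable_dist.
have v0 x : (0 <= Num.min `|h x - mean (F k) h| N `^ s)%R by exact: powR_ge0.
have := ge0_integral_affine (mu : {measure set T -> \bar R}) (mF k) mv v0
  (powR_ge0 2 s) L0.
move=> <-; apply: le_integral_nneg => x _; first exact: G0.
rewrite lee_fin.
have m0 : (0 <= Num.min `|h x - mean (F k) h| N)%R by rewrite le_min normr_ge0.
have d0 : (0 <= 2 ^+ n.+1 * lam)%R by rewrite mulr_ge0 ?exprn_ge0.
apply: le_trans (powRD_le m0 d0 (ltW s0)).
apply: ge0_ler_powR; rewrite ?nnegrE ?le_min ?g0 ?addr_ge0//; first exact: ltW.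
have tri : (g x <= `|h x - mean (F k) h| + 2 ^+ n.+1 * lam)%R.
  rewrite /g (_ : h x - m = (h x - mean (F k) h) + (mean (F k) h - m))%R; last by ring.
  by apply: le_trans (ler_normD _ _) _; rewrite lerD2l.
rewrite ge_min; case: (leP `|h x - mean (F k) h|%R N) => _; first by rewrite tri.
by rewrite lerDl d0 orbT.
Qed.

End oscillation.

(** The first term suffices when o * t >= 1, the second otherwise. Multiplied by |Q|, it splits o^s
    |Q| between o^p |Q|, which [JNsum] controls, and |Q| itself. *)
Lemma powR_young (R : realType) (o t p s : R) : (0 <= o)%R -> (0 < t)%R ->
  (0 < s)%R -> (s < p)%R ->
  (o `^ s <= t `^ (p - s) * o `^ p + t `^ (- s))%R.
Proof.
move=> o0 t0 s0 sp; have ps0 : (0 < p - s)%R by rewrite subr_gt0.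
have [ot|ot] := leP 1%R (o * t)%R.
  have op : (0 < o)%R by rewrite -(pmulr_lgt0 _ t0) (lt_le_trans ltr01).
  apply: (@le_trans _ _ (t `^ (p - s) * o `^ p)%R); last by rewrite lerDl powR_ge0.
  have -> : (o `^ p = o `^ s * o `^ (p - s))%R.
    rewrite -powRD ?(gt_eqF op) ?implybT//; congr (_ `^ _)%R; ring.
  rewrite mulrCA ler_peMr ?powR_ge0// -powRM ?(ltW t0)// mulrC.
  apply: (@le_trans _ _ ((o * t) `^ 0)%R); first by rewrite powRr0.
  by apply: ler_powR => //; exact: ltW.
apply: (@le_trans _ _ (t `^ (- s))%R); last by rewrite lerDr mulr_ge0 ?powR_ge0.
rewrite powRN -(ler_pM2r (powR_gt0 s t0)) mulVf ?gt_eqF ?powR_gt0//.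
rewrite -powRM ?(ltW t0)//.
apply: (@le_trans _ _ (1 `^ s)%R); last by rewrite powR1.
apply: ge0_ler_powR; rewrite ?nnegrE ?mulr_ge0//.
- exact: ltW.
- exact: ltW.
- exact: ltW.
Qed.

Lemma integral_min_powR_le d (U : measurableType d) (R : realType)
    (m : {measure set U -> \bar R}) (D : set U) (g : U -> R) (s : R) (M : \bar R) :
  measurable D -> measurable_fun D g -> (forall x, 0 <= g x)%R -> (0 <= s)%R ->
  (forall k : nat, \int[m]_(x in D) (Num.min (g x) k%:R `^ s)%:E <= M) ->
  \int[m]_(x in D) (g x `^ s)%:E <= M.
Proof.
move=> mD mg g0 s0 H.
pose G (k : nat) x := (Num.min (g x) k%:R `^ s)%:E.
have ndG x : D x -> nondecreasing_seq (G ^~ x).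
  move=> _ i j ij; rewrite lee_fin; apply: ge0_ler_powR => //.
  - by rewrite nnegrE le_min g0/= ler0n.
  - by rewrite nnegrE le_min g0/= ler0n.
  - by rewrite le_min !ge_min lexx /= ler_nat ij orbT.
have mG k : measurable_fun D (G k).
  by apply/measurable_EFinP; exact: measurable_min_powR.
have limG x : limn (G ^~ x) = (g x `^ s)%:E.
  apply/cvg_lim => //; apply: cvg_near_cst; near=> k.
  rewrite /G min_l//; near: k.
  exists (Num.truncn (g x)).+1 => // k /= hk.
  by apply: le_trans (ltW (truncnS_gt _)) _; rewrite ?ler_nat.
have G0 k x : 0 <= G k x by rewrite lee_fin powR_ge0.
have := @cvg_monotone_convergence _ _ _ m D mD G mG (fun k x _ => G0 k x) ndG.
have -> : \int[m]_(x in D) limn (G ^~ x) = \int[m]_(x in D) (g x `^ s)%:E.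
  by apply: eq_integral => x _; exact: limG.
move=> c; rewrite -(cvg_lim _ c)//; apply: lime_le; first by apply/cvg_ex; eexists; exact: c.
by apply: nearW => k; exact: H.
Unshelve. all: by end_near. Qed.

Section john_nirenberg.
Context {R : realType} {n : nat}.
Local Notation T := (Rn R n).
Local Notation mu := (@lebesgue_Rn R n).
Implicit Types (Q P X : set T) (h : T -> R).
Variables p s : R.
Hypotheses (s0 : (0 < s)%R) (sp : (s < p)%R).

(* With t replaced by t * kap, the recursion multiplies the coefficients of both
   JNsum and vol by 1/2; this is what kap and th are chosen for. *)
Let kap : R := 2 `^ (- (s + 1) / (p - s)).
Let sig : R := kap `^ (- s).
Let th : R := (2 `^ (- (s + 1)) / sig)%R.
Let C1 : R := ((1 + 2 `^ s * (2 ^+ n.+1) `^ s) / th `^ s)%R.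

Let ps0 : (0 < p - s)%R. Proof. by rewrite subr_gt0. Qed.
Let kap0 : (0 < kap)%R. Proof. exact: powR_gt0. Qed.
Let sig0 : (0 < sig)%R. Proof. exact: powR_gt0. Qed.
Let th0 : (0 < th)%R. Proof. by rewrite divr_gt0// powR_gt0. Qed.
Let C10 : (0 < C1)%R.
Proof.
by rewrite divr_gt0 ?powR_gt0// ltr_pwDl// mulr_ge0 ?powR_ge0.
Qed.

Let sig1 : (1 <= sig)%R.
Proof.
rewrite /sig /kap -powRrM -{1}(powRr0 2); apply: ler_powR; first by rewrite ler1n.
have -> : (- (s + 1) / (p - s) * - s = (s + 1) / (p - s) * s)%R by ring.
have s10 : (0 <= s + 1)%R by have := s0; lra.
by apply: mulr_ge0; [apply: divr_ge0 => //|]; exact: ltW.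
Qed.

Let half : (2 `^ s * 2 `^ (- (s + 1)) = 2^-1 :> R)%R.
Proof.
rewrite -powRD; last by rewrite pnatr_eq0 implybT.
by rewrite (_ : s + - (s + 1) = -1)%R ?powR_inv1//; ring.
Qed.

Let kap_half : (2 `^ s * kap `^ (p - s) = 2^-1)%R.
Proof.
by rewrite /kap -powRrM divfK ?gt_eqF// half.
Qed.

Let th_half : (2 `^ s * th * sig = 2^-1)%R.
Proof. by rewrite /th mulrA divfK ?gt_eqF// half. Qed.

Let th1 : (th <= 1)%R.
Proof.
rewrite ler_pdivrMr// mul1r; apply: le_trans sig1.
apply: (@le_trans _ _ (2 `^ 0)%R); last by rewrite powRr0.
by apply: ler_powR; [rewrite ler1n|have := s0; lra].
Qed.

(** Truncation gives the trivial bound N^s |Q| at j = 0, and each step halves it. The induction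
    hypothesis is applied to the selected cubes with [t * kap] for t: their [JNsum] add up to at
    most that of Q by superadditivity, their volumes to at most th |Q|. The coefficient 2 * C1 is
    the fixed point of x |-> x / 2 + C1. *)
Lemma cutosc_JNsum (N : R) j : (0 <= N)%R ->
  forall Q h (t : R), cube Q -> mu.-integrable Q (EFin \o h) -> (0 < t)%R ->
  cutosc N s Q h <= (2 * C1 * t `^ (p - s))%:E * JNsum p Q h +
    ((2 * C1 * t `^ (- s) + N `^ s / 2 ^+ j) * vol Q)%:E.
Proof.
move=> N0; elim: j => [|j IH] Q h t cQ hi t0.
all: have C1n : (0 <= C1)%R by exact: ltW.
all: have c0 v u : (0 <= 2 * C1 * v `^ u)%R by apply: mulr_ge0; [exact: mulr_ge0|exact: powR_ge0].
  have mQ := cube_measurable cQ.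
  apply: (@le_trans _ _ (\int[mu]_(x in Q) (N `^ s)%:E)).
    apply: le_integral_nneg => x _; first by rewrite lee_fin powR_ge0.
    rewrite lee_fin; apply: ge0_ler_powR; rewrite ?nnegrE ?le_min ?normr_ge0 ?N0//.
    - exact: ltW.
    - by rewrite ge_min lexx orbT.
  rewrite (integral_cst (mu : {measure set T -> \bar R}) mQ) [X in _ * X](cube_mu cQ) -EFinM.
  rewrite -[leLHS]add0e; apply: leeD.
    by rewrite mule_ge0 ?JNsum_ge0// lee_fin.
  rewrite lee_fin ler_wpM2r ?vol_nneg// expr0 divr1 lerDr; exact: c0.
have th01 : (0 < th <= 1)%R by rewrite th0 th1.
have [F [FP tF volF cF]] := cutosc_step N0 s0 th01 cQ hi.
apply: le_trans cF _.
set b := (N `^ s / 2 ^+ j)%R.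
have b0 : (0 <= b)%R by rewrite divr_ge0 ?powR_ge0 ?exprn_ge0.
pose c1 := (2 * C1 * (t * kap) `^ (p - s))%R.
pose c2 := (2 * C1 * (t * kap) `^ (- s) + b)%R.
have c10 : (0 <= c1)%R by exact: c0.
have c20 : (0 <= c2)%R by rewrite addr_ge0.
have tk0 : (0 < t * kap)%R by rewrite mulr_gt0.
have Jk k : 0 <= c1%:E * JNsum p (F k) h by rewrite mule_ge0 ?JNsum_ge0// lee_fin.
have Mk k : 0 <= c2%:E * mu (F k) by rewrite mule_ge0 ?lebesgue_outer_ge0// lee_fin.
have sumF : \sum_(k <oo) cutosc N s (F k) h <=
    c1%:E * JNsum p Q h + (c2 * th * vol Q)%:E.
  apply: (@le_trans _ _ (\sum_(k <oo) (c1%:E * JNsum p (F k) h + c2%:E * mu (F k)))).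
    apply: lee_nneseries => [k _ _|k _]; first exact: cutosc_ge0.
    case: (FP k) => [->|[cFk FkQ]].
      rewrite /cutosc integral_set0 adde_ge0 ?mule_ge0 ?JNsum_ge0 ?lebesgue_outer_ge0//.
    rewrite cube_mu// -EFinM; apply: IH => //.
    by apply: integrableS hi => //; exact: cube_measurable.
  rewrite nneseriesD; last 2 first.
  - by move=> k _ _; exact: Jk.
  - by move=> k _ _; exact: Mk.
  apply: leeD.
    rewrite nneseriesZl; last by move=> k _; exact: JNsum_ge0.
    apply: lee_wpmul2l; first by rewrite lee_fin.
    rewrite nneseries_esumT; last by move=> k; exact: JNsum_ge0.
    apply: sup_collections_super.
    - by move=> P; rewrite mule_ge0 ?poweR_ge0// lee_fin vol_nneg.
    - by move=> k _; case: (FP k) => [->|[]].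
    - move=> i k _ _ [x [xi xk]]; apply: tF => //.
      by exists x; split; exact: interior_subset.
  rewrite nneseriesZl; last by move=> k _; exact: lebesgue_outer_ge0.
  by rewrite -mulrA EFinM; apply: lee_wpmul2l; rewrite ?lee_fin.
set o := fine (osc1 Q h).
have o0 : (0 <= o)%R by apply: fine_ge0; exact: osc1_ge0.
have oJ : (o `^ p * vol Q)%:E <= JNsum p Q h.
  apply: le_trans (JNsum_single p h cQ).
  by rewrite -(fineK (osc1_fin cQ hi)) poweR_EFin -EFinM mulrC.
have young := powR_young o0 t0 s0 sp.
have E1 : ((1 + 2 `^ s * (2 ^+ n.+1) `^ s) * (o / th) `^ s * vol Q = C1 * o `^ s * vol Q)%R.
  rewrite powRM ?invr_ge0 ?(ltW th0)// -powR_inv1 ?(ltW th0)// -powRrM mulN1r powRN /C1; ring.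
rewrite E1.
apply: (@le_trans _ _ ((2 `^ s)%:E * (c1%:E * JNsum p Q h + (c2 * th * vol Q)%:E) +
   ((C1 * t `^ (p - s))%:E * JNsum p Q h + (C1 * t `^ (- s) * vol Q)%:E))).
  apply: leeD; first by apply: lee_wpmul2l; rewrite ?lee_fin ?powR_ge0.
  apply: (@le_trans _ _ ((C1 * t `^ (p - s))%:E * (o `^ p * vol Q)%:E + (C1 * t `^ (- s) * vol Q)%:E)).
    rewrite -EFinM -EFinD lee_fin.
    have -> : (C1 * t `^ (p - s) * (o `^ p * vol Q) + C1 * t `^ (- s) * vol Q =
      C1 * (t `^ (p - s) * o `^ p + t `^ (- s)) * vol Q)%R by ring.
    by rewrite ler_wpM2r ?vol_nneg// ler_wpM2l// ltW.
  rewrite leeD2r//; apply: lee_wpmul2l => //.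
  by rewrite lee_fin mulr_ge0 ?powR_ge0// ltW.
have J0 := JNsum_ge0 p Q h.
rewrite ge0_muleDr; last 2 first.
- by rewrite mule_ge0// lee_fin.
- by rewrite lee_fin; apply: mulr_ge0; rewrite ?vol_nneg//; apply: mulr_ge0 => //; exact: ltW.
rewrite addeACA; apply: leeD.
  rewrite muleA -EFinM -ge0_muleDl; last 2 first.
  - by rewrite lee_fin mulr_ge0 ?powR_ge0.
  - by rewrite lee_fin mulr_ge0 ?powR_ge0// ltW.
  apply: lee_wpmul2r => //; rewrite -EFinD lee_fin /c1 powRM ?(ltW t0) ?(ltW kap0)//.
  have -> : (2 `^ s * (2 * C1 * (t `^ (p - s) * kap `^ (p - s))) =
     (2 `^ s * kap `^ (p - s)) * (2 * C1 * t `^ (p - s)))%R by ring.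
  rewrite kap_half; lra.
rewrite -EFinM -EFinD lee_fin.
have -> : (2 `^ s * (c2 * th * vol Q) + C1 * t `^ (- s) * vol Q =
  (2 `^ s * c2 * th + C1 * t `^ (- s)) * vol Q)%R by ring.
rewrite ler_wpM2r ?vol_nneg// /c2 powRM ?(ltW t0) ?(ltW kap0)// -/sig.
have -> : (2 `^ s * (2 * C1 * (t `^ (- s) * sig) + b) * th =
  (2 `^ s * th * sig) * (2 * C1 * t `^ (- s)) + (2 `^ s * th) * b)%R by ring.
have bE : (N `^ s / 2 ^+ j.+1 = b / 2)%R by rewrite exprSr invfM mulrA.
rewrite th_half bE.
have : (2 `^ s * th * b <= 2^-1 * b)%R.
  rewrite ler_wpM2r// -th_half ler_peMr//.
  by rewrite mulr_ge0 ?powR_ge0// ltW.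
lra.
Qed.

(** In [cutosc_JNsum] j is taken so large that the remainder is below e; then the truncation is
    removed by monotone convergence. The best t would give k(Q)^(s/p) |Q|^(1 - s/p), the bound
    implied by the embedding into weak L^p, but t is kept free because the maximal inequality has a
    scale to match. *)
Lemma john_nirenberg_local : exists2 A : R, (0 < A)%R &
  forall Q h (t : R), cube Q -> mu.-integrable Q (EFin \o h) -> (0 < t)%R ->
  \int[mu]_(x in Q) (`|h x - mean Q h| `^ s)%:E <=
  (A * t `^ (p - s))%:E * JNsum p Q h + (A * t `^ (- s) * vol Q)%:E.
Proof.
exists (2 * C1)%R; first by rewrite mulr_gt0.
move=> Q h t cQ hi t0; have mQ := cube_measurable cQ.
have mh := integrable_measurable hi.
apply: (integral_min_powR_le (m := mu) mQ (measurable_dist (mean Q h) mh)) => //.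
  exact: ltW.
move=> k; apply/lee_addgt0Pr => e e0.
pose N : R := k%:R; have N0 : (0 <= N)%R by exact: ler0n.
pose j := Num.truncn (N `^ s * vol Q / e).
apply: le_trans (cutosc_JNsum j N0 cQ hi t0) _.
rewrite -addeA; apply: leeD2l; rewrite -EFinD lee_fin mulrDl lerD2l.
have h1 : (N `^ s * vol Q / e < 2 ^+ j)%R.
  apply: lt_le_trans (truncnS_gt _) _; rewrite -natrX ler_nat.
  exact: ltn_expl.
rewrite ltr_pdivrMr// in h1.
by rewrite mulrAC ler_pdivrMr ?exprn_gt0// mulrC; apply: ltW; rewrite [ltRHS]mulrC mulrC.
Qed.

End john_nirenberg.

(** * Maximal function *)

Section integral_bigcup.
Context d (U : measurableType d) (R : realType) (m : {measure set U -> \bar R}).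
Variables (F : (set U)^nat) (D : set U) (g : U -> R).
Hypotheses (mF : forall k, measurable (F k)) (mD : measurable D).
Hypotheses (mg : measurable_fun D g) (g0 : forall x, D x -> (0 <= g x)%R).
Hypothesis FD : forall k, F k `<=` D.

Let UD : \bigcup_k F k `<=` D. Proof. by move=> x [k _]; exact: FD. Qed.

Let mgU : measurable_fun (\bigcup_k F k) (EFin \o g).
Proof. by apply/measurable_EFinP; exact: measurable_funS mD UD mg. Qed.

Lemma ge0_integral_bigcup_EFin : trivIset setT F ->
  \int[m]_(x in \bigcup_k F k) (g x)%:E = \sum_(k <oo) \int[m]_(x in F k) (g x)%:E.
Proof.
by move=> tF; apply: ge0_integral_bigcup => // x /UD /g0; rewrite lee_fin.
Qed.

End integral_bigcup.

Lemma le_integral_subset_nneg d (U : measurableType d) (R : realType)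
    (m : {measure set U -> \bar R}) (A B : set U) (F : U -> \bar R) :
  A `<=` B -> (forall x, B x -> 0 <= F x) ->
  \int[m]_(x in A) F x <= \int[m]_(x in B) F x.
Proof.
move=> AB F0; rewrite integral_mkcond [leRHS]integral_mkcond.
apply: le_integral_nneg => x _; rewrite !patchE.
  by case: ifPn => // /set_mem /AB /F0.
case: ifPn => [/set_mem /AB Bx|_]; first by rewrite mem_set.
by case: ifPn => // /set_mem /F0.
Qed.

Section weak_type.
Context {R : realType} {n : nat}.
Local Notation T := (Rn R n).
Local Notation mu := (@lebesgue_Rn R n).
Local Notation muM := (mu : {measure set T -> \bar R}).
Implicit Types (Q P : set T) (g : T -> R).

Lemma side_le (d e : @cdata R n) : (0 < side d)%R -> (0 < side e)%R ->
  (vol (cset d) <= vol (cset e))%R -> (side d <= side e)%R.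
Proof.
by move=> d0 e0; rewrite !vol_cset// ler_pXn2r// nnegrE ltW.
Qed.

Lemma cset_sub_cube d (c : R) (D : set T) : (0 < side d)%R -> (0 <= c)%R ->
  (forall y, D y -> exists2 z, cset d z & forall i, `|y ord0 i - z ord0 i| <= c)%R ->
  mu D <= ((side d + 2 * c) ^+ n.+1)%:E.
Proof.
move=> l0 c0 Dd.
have L0 : (0 < side d + 2 * c)%R by rewrite ltr_pwDl// mulr_ge0.
rewrite -(@mu_cb R n (corner d - const_mx c)%R _ (fun=> true) (fun=> false) L0).
apply: le_lebesgue_outer => y /Dd[z zd yz] i.
have := zd i; have := yz i; rewrite !mxE !in_itv/= ler_norml => h1 /andP[h2 h3].
have {}h2 : (corner d ord0 i <= z ord0 i)%R by move: h2; case: (lbd d i) => //= /ltW.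
have {}h3 : (z ord0 i <= corner d ord0 i + side d)%R by move: h3; case: (rbd d i) => //= /ltW.
lra.
Qed.

(** The concentric cube of three times the side, as in Vitali's covering lemma. *)
Lemma cube_triple C : cube C -> exists e : set T,
  [/\ measurable e, mu e = (3 ^+ n.+1 * vol C)%:E &
    forall P, cube P -> (vol P <= vol C)%R -> (P `&` C) !=set0 -> P `<=` e].
Proof.
move=> /cubeE[d l0 ->]; pose L : R := (3 * side d)%R.
have L0 : (0 < L)%R by rewrite mulr_gt0.
exists (cb (corner d - const_mx (side d))%R L (fun=> true) (fun=> false)); split.
- exact/cube_measurable/cube_cb.
- by rewrite (mu_cb _ _ _ L0) vol_cset// exprMn.
move=> _ /cubeE[e e0 ->] /(side_le e0 l0) ed [z [ze zd]] y ye i.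
have := cset_dist i ze ye; have := zd i.
rewrite !mxE !in_itv/= ler_norml => /andP[h2 h3] h1.
have {}h2 : (corner d ord0 i <= z ord0 i)%R by move: h2; case: (lbd d i) => //= /ltW.
have {}h3 : (z ord0 i <= corner d ord0 i + side d)%R by move: h3; case: (rbd d i) => //= /ltW.
rewrite /L; lra.
Qed.

Lemma dyadic_level (l r : R) : (0 < r)%R -> (r <= l)%R ->
  exists k : nat, (l / 2 ^+ k.+1 < r)%R /\ (r <= l / 2 ^+ k)%R.
Proof.
move=> r0 rl; have l0 : (0 <= l)%R by apply: le_trans rl; exact: ltW.
have ex : exists k : nat, (l / 2 ^+ k.+1 < r)%R.
  exists (Num.truncn (l / r)); rewrite ltr_pdivrMr ?exprn_gt0// mulrC -ltr_pdivrMr//.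
  apply: lt_le_trans (truncnS_gt _) _; rewrite -natrX ler_nat ltnW//.
  exact: ltn_expl.
case: (ex_minnP ex) => -[|k] hk kmin; first by exists 0%N; rewrite expr0 divr1.
exists k.+1; split=> //; rewrite leNgt; apply/negP => /kmin.
by rewrite ltnn.
Qed.

(* A cube meets only cells of its own scale inside a fivefold dilate, so one of
   these cells carries a comparable average. *)
Lemma heavy_cell d (G : T -> R) (lam : R) P :
  (0 < side d)%R -> measurable_fun (cset d) G -> (forall x, 0 <= G x)%R ->
  (0 <= lam)%R -> cube P -> P `<=` cset d ->
  (5 ^+ n.+1 * lam * vol P)%:E < \int[mu]_(y in P) (G y)%:E ->
  exists s, [/\ (vol P <= vol (cset (cell d s)))%R, (P `&` cset (cell d s)) !=set0 &
    (lam * vol (cset (cell d s)))%:E < \int[mu]_(y in cset (cell d s)) (G y)%:E].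
Proof.
move=> l0 mG G0 lam0 cP Pd IP; apply: contrapT => /forallNP nos.
have mQ := cube_measurable (cube_cset l0); have mP := cube_measurable cP.
have mGE : measurable_fun (cset d) (EFin \o G) by exact/measurable_EFinP.
have [e e0 Pe] := cubeE cP.
have ed : (side e <= side d)%R.
  by apply: side_le => //; rewrite -Pe; apply: vol_le => //; exact: cube_cset.
have [k [k1 k2]] := dyadic_level e0 ed.
pose S s := size s = k /\ (P `&` cset (cell d s)) !=set0.
have [F [FP tF cF]] := stopping_cells S l0.
have mF j : measurable (F j).
  case: (FP j) => [->|[u [_ _ ->]]]; first exact: measurable0.
  exact/cube_measurable/cube_cset/side_cell_gt0.
have mU : measurable (\bigcup_j F j) by exact: bigcupT_measurable.
have FQ j : F j `<=` cset d.
  by case: (FP j) => [->//|[u [_ _ ->]]]; exact: cell_sub0.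
have UQ : \bigcup_j F j `<=` cset d by move=> x [j _]; exact: FQ.
have GF j : \int[mu]_(y in F j) (G y)%:E <= lam%:E * muM (F j).
  case: (FP j) => [->|[u [[uk Pu] _ ->]]].
    by rewrite integral_set0 measure0 mule0.
  have lu := side_cell_gt0 u l0.
  rewrite [X in _ * X](cube_mu (cube_cset lu)) -EFinM leNgt; apply/negP => Iu.
  apply: (nos u); split=> //; rewrite Pe !vol_cset// lerXn2r// ?nnegrE ?(ltW e0) ?(ltW lu)//.
  by rewrite side_cell uk.
have PU : P `<=` \bigcup_j F j.
  move=> x Px; have [u uk xu] := cell_at k l0 (Pd x Px).
  have Su : S u by split=> //; exists x.
  by have [j xj] := cF u x Su xu; exists j.
have : \int[mu]_(y in P) (G y)%:E <= (5 ^+ n.+1 * lam * vol P)%:E.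
  apply: (@le_trans _ _ (\int[mu]_(y in \bigcup_k F k) (G y)%:E)).
    by apply: le_integral_subset_nneg PU _ => x _; rewrite lee_fin.
  rewrite (ge0_integral_bigcup_EFin muM mF mQ mG (fun x _ => G0 x) FQ tF).
  apply: (@le_trans _ _ (\sum_(k <oo) lam%:E * muM (F k))).
    by apply: lee_nneseries => [j _ _|j _]; [apply: integral_ge0 => x _; rewrite lee_fin|exact: GF].
  rewrite nneseriesZl; last by move=> j _; exact: measure_ge0.
  have UE : muM (\bigcup_k F k) = \sum_(k <oo) muM (F k) by apply: measure_semi_bigcup.
  rewrite -UE.
  rewrite mulrC mulrA mulrC EFinM; apply: lee_wpmul2l; first by rewrite lee_fin.
  (* By [k1] cells of generation k have side below 2 * side e, so those meeting P stay within that
     distance of it. They fit into a cube of side (1 + 2 * 2) side e, whence the factor 5. *)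
  have r2 : (0 <= 2 * side e)%R by rewrite mulr_ge0// ltW.
  apply: le_trans (cset_sub_cube (d := e) e0 r2 _) _.
    move=> y [j _]; case: (FP j) => [->//|[u [[uk [z [Pz zu]]] _ ->]]] yu.
    exists z; first by rewrite -Pe.
    move=> i; apply: le_trans (cset_dist i zu yu) _; rewrite side_cell uk.
    move: k1; rewrite exprSr invfM mulrA ltr_pdivrMr// => /ltW; lra.
  rewrite lee_fin Pe vol_cset// -exprMn lerXn2r ?nnegrE//; try lra.
by rewrite leNgt IP.
Qed.

(** The cubes P form an uncountable family, so the conclusion provides a measurable set E containing
    them all. It is the union of the triples of the maximal cells of average above lam / 5^(n+1): by
    [heavy_cell] P meets such a cell at least as large as itself, hence also the maximal cell around
    it, and lies in the triple of the latter. The constant is 15 = 5 * 3. *)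
Lemma weak_type_bound Q (G : T -> R) (lam : R) :
  cube Q -> measurable_fun Q G -> (forall x, 0 <= G x)%R -> (0 < lam)%R ->
  exists E : set T, [/\ measurable E,
    lam%:E * mu E <= (15 ^+ n.+1)%:E * \int[mu]_(y in Q) (G y)%:E &
    forall P, cube P -> P `<=` Q ->
      (lam * vol P)%:E < \int[mu]_(y in P) (G y)%:E -> P `<=` E].
Proof.
move=> /cubeE[d l0 ->{Q}] mG G0 lam0.
pose lam' : R := (lam / 5 ^+ n.+1)%R.
have f5 : (0 < 5 ^+ n.+1 :> R)%R by rewrite exprn_gt0.
have lam'0 : (0 < lam')%R by rewrite divr_gt0.
have mQ := cube_measurable (cube_cset l0).
have mGE : measurable_fun (cset d) (EFin \o G) by exact/measurable_EFinP.
pose S s := (lam' * vol (cset (cell d s)))%:E < \int[mu]_(y in cset (cell d s)) (G y)%:E.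
have [F [FP tF cF]] := stopping_cells S l0.
have cu u : cube (cset (cell d u)) by exact/cube_cset/side_cell_gt0.
have mF j : measurable (F j).
  case: (FP j) => [->|[u [_ _ ->]]]; first exact: measurable0.
  exact/cube_measurable.
have FQ j : F j `<=` cset d.
  by case: (FP j) => [->//|[u [_ _ ->]]]; exact: cell_sub0.
have mU : measurable (\bigcup_j F j) by exact: bigcupT_measurable.
have UQ : \bigcup_j F j `<=` cset d by move=> x [j _]; exact: FQ.
have ex j : exists e : set T, [/\ measurable e, muM e = (3 ^+ n.+1)%:E * muM (F j) &
    forall P, cube P -> (vol P <= vol (F j))%R -> (P `&` F j) !=set0 -> P `<=` e].
  case: (FP j) => [->|[u [_ _ ->]]].
    exists set0; split; [exact: measurable0|by rewrite measure0 mule0|].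
    by move=> P _ _ [x []].
  have [e [me mue he]] := cube_triple (cu u).
  by exists e; split=> //; rewrite [LHS]mue EFinM [X in _ = _ * X]cube_mu.
have [e he] := choice ex.
have me j : measurable (e j) by have [] := he j.
exists (\bigcup_j e j); split.
- exact: bigcupT_measurable.
- have sumF : lam'%:E * \sum_(j <oo) muM (F j) <= \int[mu]_(y in cset d) (G y)%:E.
    rewrite -nneseriesZl; last by move=> k _; exact: measure_ge0.
    apply: (@le_trans _ _ (\sum_(k <oo) \int[mu]_(y in F k) (G y)%:E)).
      apply: lee_nneseries => [k _ _|k _]; first by rewrite mule_ge0// lee_fin ltW.
      case: (FP k) => [->|[u [/ltW Su _ ->]]].
        by rewrite measure0 mule0 integral_set0.
      by rewrite [X in _ * X](cube_mu (cu u)) -EFinM.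
    rewrite -(ge0_integral_bigcup_EFin muM mF mQ mG (fun x _ => G0 x) FQ tF).
    apply: le_integral_subset_nneg => // x _; by rewrite lee_fin.
  apply: (@le_trans _ _ (lam%:E * ((3 ^+ n.+1)%:E * \sum_(j <oo) muM (F j)))).
    apply: lee_wpmul2l; first by rewrite lee_fin ltW.
    apply: le_trans (lebesgue_outer_sigma_subadditive _) _.
    rewrite -nneseriesZl; last by move=> k _; exact: measure_ge0.
    apply: lee_nneseries => [k _ _|k _]; first exact: lebesgue_outer_ge0.
    by have [_ h _] := he k; rewrite -h.
  have -> : lam%:E = (5 ^+ n.+1)%:E * lam'%:E.
    by rewrite -EFinM; congr EFin; rewrite /lam' mulrC divfK// gt_eqF.
  have -> : (15 ^+ n.+1)%:E = (5 ^+ n.+1)%:E * (3 ^+ n.+1)%:E :> \bar R.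
    by rewrite -EFinM -exprMn; congr EFin; congr (_ ^+ _)%R; ring.
  rewrite -!muleA; apply: lee_wpmul2l; first by rewrite lee_fin ltW.
  by rewrite muleCA; apply: lee_wpmul2l.
- move=> P cP Pd IP.
  have IP' : (5 ^+ n.+1 * lam' * vol P)%:E < \int[mu]_(y in P) (G y)%:E.
    by rewrite (_ : 5 ^+ n.+1 * lam' = lam)%R// /lam' mulrC divfK// gt_eqF.
  have [s [vs [x [Px xs]] Ss]] := heavy_cell l0 mG G0 (ltW lam'0) cP Pd IP'.
  have [j Fx] := cF s x Ss xs; have [_ _ hj] := he j.
  have Pe : P `<=` e j.
    apply: hj => //; last by exists x.
    case: (FP j) Fx => [->//|[u [Su Mu ->]]] xu.
    have us : (size u <= size s)%N.
      rewrite leqNgt; apply/negP => su.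
      have E := cell_prefix l0 (ltnW su) xs xu.
      by apply: (Mu _ su); rewrite -E.
    apply: le_trans vs _; apply: vol_le => //.
    have -> : u = take (size u) s by exact: (cell_prefix l0 us xu xs).
    exact: cell_take.
  by move=> y /Pe ye; exists j.
Qed.

End weak_type.

Lemma le_nneseries_term (R : realType) (f : (\bar R)^nat) k :
  (forall k, 0 <= f k) -> f k <= \sum_(j <oo) f j.
Proof.
move=> f0; apply: le_trans (nneseries_lim_ge k.+1 _); last by move=> *; exact: f0.
by rewrite big_nat_recr//= leeDr// sume_ge0.
Qed.

Lemma ge_all_nat_infty (R : realType) (x : \bar R) (a : R) : (0 < a)%R ->
  (forall m : nat, (m%:R * a)%:E <= x) -> x = +oo.
Proof.
move=> a0 H; case: x H => [x| |] H //; last by have := H 0%N.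
have := H (Num.truncn (x / a)).+1; rewrite lee_fin leNgt => /negP[].
by rewrite -ltr_pdivrMr// truncnS_gt.
Qed.

(** A dyadic layer-cake bound. If b fails first at 0, then y <= t; if it fails first at k + 1, then
    y <= 2^(k+1) t and the k-th term alone suffices; if it never fails, all terms are at least t^r
    and the series diverges. Only one implication links b to y, so b may test membership in
    supersets of the level sets of y. *)
Lemma layer_bound (R : realType) (y : \bar R) (t r : R) (b : nat -> bool) :
  0 <= y -> (0 < t)%R -> (0 < r)%R -> (forall k, (2 ^+ k * t)%:E < y -> b k) ->
  y `^ r <= (t `^ r)%:E + \sum_(k <oo) (((2 ^+ k.+1 * t) `^ r)%:E * (b k)%:R%:E).
Proof.
move=> y0 t0 r0 yb.
have f0 k : 0 <= ((2 ^+ k.+1 * t) `^ r)%:E * (b k)%:R%:E.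
  by rewrite -EFinM lee_fin mulr_ge0 ?powR_ge0.
have S0 : 0 <= \sum_(k <oo) (((2 ^+ k.+1 * t) `^ r)%:E * (b k)%:R%:E).
  by apply: nneseries_ge0 => k _ _; exact: f0.
have [ex|nex] := pselect (exists k, ~~ b k).
  case: (ex_minnP ex) => -[|k] bk kmin.
    have yt : y <= t%:E by rewrite leNgt; apply: contra bk => h; apply: yb; rewrite expr0 mul1r.
    apply: (@le_trans _ _ (t `^ r)%:E); last by rewrite leeDl.
    by rewrite -poweR_EFin; apply: ge0_le_poweR => //; exact: ltW.
  have yt : y <= (2 ^+ k.+1 * t)%:E by rewrite leNgt; apply: contra bk => h; exact: yb.
  have bk' : b k by apply: contraT => /kmin; rewrite ltnn.
  apply: (@le_trans _ _ (((2 ^+ k.+1 * t) `^ r)%:E * (b k)%:R%:E)).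
    by rewrite bk' mule1 -poweR_EFin; apply: ge0_le_poweR => //; exact: ltW.
  apply: le_trans (le_nneseries_term k f0) _.
  by rewrite leeDr// lee_fin powR_ge0.
have {}nex k : b k by apply: contrapT => /negP h; apply: nex; exists k.
rewrite [X in _ + X](_ : _ = +oo) ?addey ?leey//.
apply: (@ge_all_nat_infty _ _ (t `^ r)%R); first exact: powR_gt0.
move=> m; apply: le_trans (nneseries_lim_ge m _); last by move=> *; exact: f0.
elim: m => [|m IH]; first by rewrite mul0r big_geq.
rewrite big_nat_recr//= -natr1 mulrDl mul1r EFinD; apply: leeD => //.
rewrite nex mule1 lee_fin; apply: ge0_ler_powR.
- exact: ltW.
- by rewrite nnegrE ltW.
- by rewrite nnegrE mulr_ge0 ?exprn_ge0// ltW.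
- by rewrite ler_peMl ?(ltW t0)// exprn_ege1// ler1n.
Qed.

Section layers.
Context d (U : measurableType d) (R : realType) (m : {measure set U -> \bar R}).
Variables (D : set U) (E : (set U)^nat) (c : R) (a : nat -> R).
Hypotheses (mD : measurable D) (mE : forall k, measurable (E k)).
Hypotheses (c0 : (0 <= c)%R) (a0 : forall k, (0 <= a k)%R).

Definition layers (x : U) : \bar R := c%:E + \sum_(k <oo) ((a k)%:E * (\1_(E k) x)%:E).

Let me1 k : measurable_fun D (fun x => (a k)%:E * (\1_(E k) x)%:E).
Proof.
by apply: measurable_funeM; apply/measurable_EFinP; exact: measurable_indic.
Qed.

Let nn k x : 0 <= (a k)%:E * (\1_(E k) x)%:E.
Proof. by rewrite mule_ge0// lee_fin. Qed.

Let mS : measurable_fun D (fun x => \sum_(k <oo) ((a k)%:E * (\1_(E k) x)%:E)).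
Proof. exact: ge0_emeasurable_sum. Qed.

Lemma measurable_layers : measurable_fun D layers.
Proof. exact: emeasurable_funD. Qed.

Lemma integral_layers :
  \int[m]_(x in D) layers x <= c%:E * m D + \sum_(k <oo) ((a k)%:E * m (E k)).
Proof.
rewrite (@ge0_integralD _ _ _ m D mD (cst c%:E))//; last first.
  by move=> x _; apply: nneseries_ge0 => k _ _; exact: nn.
rewrite integral_cst// leeD2l// integral_nneseries//.
apply: lee_nneseries => [k _ _|k _]; first by apply: integral_ge0.
rewrite ge0_integralZl_EFin//; last by apply/measurable_EFinP; exact: measurable_indic.
apply: lee_wpmul2l; first by rewrite lee_fin.
by rewrite integral_indic//; apply: le_measure; rewrite ?inE//; exact: measurableI.
Qed.

End layers.

Lemma geometric_nneseries_le (R : realType) (c z : R) : (0 <= c)%R -> (0 < z < 1)%R ->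
  \sum_(k <oo) (c * z ^+ k)%:E <= (c / (1 - z))%:E.
Proof.
move=> c0 /andP[z0 z1]; have z1' : (0 < 1 - z)%R by rewrite subr_gt0.
apply: lime_le.
  by apply: is_cvg_nneseries => k _ _; rewrite lee_fin mulr_ge0// exprn_ge0// ltW.
apply: nearW => m; rewrite sumEFin lee_fin ler_pdivlMr//.
rewrite -mulr_sumr -mulrA ler_piMr// mulrC big_mkord.
rewrite -[(1 - z)%R]opprB mulNr -subrX1 opprB.
by rewrite gerBl exprn_ge0// ltW.
Qed.

Section maximal_strong.
Context {R : realType} {n : nat}.
Local Notation T := (Rn R n).
Local Notation mu := (@lebesgue_Rn R n).
Local Notation muM := (mu : {measure set T -> \bar R}).
Implicit Types (Q P : set T) (g : T -> R).
Variables (r s : R).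
Hypotheses (r0 : (0 < r)%R) (rs : (r < s)%R) (s1 : (1 <= s)%R).

Lemma maximal_ge0 Q g x : Q x -> cube Q -> 0 <= maximal Q g x.
Proof.
move=> Qx cQ; apply: le_ereal_sup_tmp; exists (avg Q (fun y => `|g y|%:E)).
  by exists Q => //; split=> //; split.
by apply: avg_ge0 => y _; rewrite lee_fin.
Qed.

Lemma avg_lt_integral_powR P g (lam : R) : cube P -> measurable_fun P g -> (0 < lam)%R ->
  lam%:E < avg P (fun y => `|g y|%:E) ->
  (lam `^ s * vol P)%:E < \int[mu]_(y in P) (`|g y| `^ s)%:E.
Proof.
move=> cP mg lam0 h; have s0 : (0 < s)%R by apply: lt_le_trans s1.
rewrite integral_avg// mulrC EFinM lte_pmul2l ?lte_fin ?vol_gt0//.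
apply: lt_le_trans (powR_avg_le cP s1 mg).
set A := avg _ _ in h *; case: A h => [a| |] //; last first.
  by move=> _; rewrite eqy_poweR// ltry.
rewrite lte_fin poweR_EFin lte_fin => h; apply: gt0_ltr_powR; rewrite ?nnegrE ?(ltW lam0)//.
by apply: ltW; apply: lt_trans h.
Qed.

(** By Jensen's inequality an average of |g| above u_k = 2^k t forces one of |g|^s above u_k^s, so
    the weak type bound for |g|^s gives a measurable set containing the points of Q where M_Q g >
    u_k, of measure at most a constant times u_k^(-s) times the integral of |g|^s. Weighted by (2
    u_k)^r, these measures form a geometric series of ratio z = 2^(r-s), below 1 because r < s. W is
    the resulting measurable majorant of M_Q(g)^r. *)
Lemma maximal_strong : exists2 C : R, (0 < C)%R &
  forall Q g (t : R), cube Q -> measurable_fun Q g -> (0 < t)%R ->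
  exists W : T -> \bar R, [/\ measurable_fun Q W,
    forall x, Q x -> maximal Q g x `^ r <= W x &
    \int[mu]_(x in Q) W x <= (t `^ r * vol Q)%:E +
      (C * t `^ (r - s))%:E * \int[mu]_(x in Q) (`|g x| `^ s)%:E].
Proof.
have s0 : (0 < s)%R by apply: lt_le_trans s1.
pose z : R := (2 `^ (r - s))%R.
have z0 : (0 < z)%R by exact: powR_gt0.
have z1 : (z < 1)%R.
  rewrite /z -(opprB s r) powRN invf_lt1 ?powR_gt0//.
  have sr0 : (0 < s - r)%R by rewrite subr_gt0.
  have := gt0_ltr_powR sr0 (x := 1%R) (y := 2%R); rewrite powR1; apply; rewrite ?nnegrE//.
  by rewrite ltr1n.
have z1' : (0 < 1 - z)%R by rewrite subr_gt0.
pose C : R := (15 ^+ n.+1 * 2 `^ r / (1 - z))%R.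
have C0 : (0 < C)%R by rewrite divr_gt0// mulr_gt0 ?exprn_gt0 ?powR_gt0.
exists C => // Q g t cQ mg t0; have mQ := cube_measurable cQ.
set I := \int[mu]_(x in Q) _.
have I0 : 0 <= I by apply: integral_ge0 => x _; rewrite lee_fin powR_ge0.
have C't : (0 < C * t `^ (r - s))%R by rewrite mulr_gt0 ?powR_gt0.
(* When the right-hand side is infinite, the constant +oo is an admissible majorant. *)
have [Ioo|Ifin] := eqVneq I +oo.
  exists (cst +oo); split; [exact: measurable_cst|by move=> x _; exact: leey|].
  by rewrite Ioo gt0_muley ?lte_fin// addey ?leey// gt_eqF// ltNyr.
have {Ifin}IJ : I = (fine I)%:E by rewrite fineK// ge0_fin_numE// ltey.
set J := fine I in IJ; have J0 : (0 <= J)%R by rewrite fine_ge0.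
pose u (k : nat) : R := (2 ^+ k * t)%R.
have u0 k : (0 < u k)%R by rewrite mulr_gt0// exprn_gt0.
have mgs : measurable_fun Q (fun x => `|g x| `^ s)%R.
  apply: (@measurableT_comp _ _ _ _ _ _ (fun x => x `^ s)%R); first exact: measurable_powR.
  exact: measurableT_comp.
have gs0 x : (0 <= `|g x| `^ s)%R by exact: powR_ge0.
have [E hE] := choice (fun k => weak_type_bound cQ mgs gs0 (powR_gt0 s (u0 k))).
have mE k : measurable (E k) by have [] := hE k.
have t_r0 : (0 <= t `^ r)%R by exact: powR_ge0.
have a0 k : (0 <= (2 ^+ k.+1 * t) `^ r)%R by exact: powR_ge0.
exists (layers E (t `^ r)%R (fun k => (2 ^+ k.+1 * t) `^ r)%R); split.
- exact: measurable_layers.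
- move=> x Qx.
  have := @layer_bound R (maximal Q g x) t r (fun k => x \in E k) (maximal_ge0 g Qx cQ) t0 r0.
  apply=> k; rewrite -/(u k).
  move=> /ereal_sup_gt[_ [P [[cP PQ] Px] <-] h]; rewrite inE.
  have [_ _ hP] := hE k; apply: (hP P cP PQ) => //.
  apply: avg_lt_integral_powR => //.
  exact: measurable_funS mQ PQ mg.
apply: (le_trans (integral_layers muM mQ mE t_r0 a0)).
rewrite [X in _ * X + _](cube_mu cQ) -EFinM; apply: leeD2l.
have muE k : muM (E k) <= (15 ^+ n.+1 * J / u k `^ s)%:E.
  have [_ h _] := hE k; rewrite -(@lee_pmul2l _ (u k `^ s)%:E)//; last first.
    by rewrite lte_fin powR_gt0.
  apply: le_trans h _; rewrite -/I IJ -!EFinM lee_fin [leRHS]mulrC divfK//.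
  by rewrite gt_eqF// powR_gt0.
pose c : R := (15 ^+ n.+1 * 2 `^ r * t `^ (r - s) * J)%R.
apply: (@le_trans _ _ (\sum_(k <oo) (c * z ^+ k)%:E)).
  apply: lee_nneseries => [k _ _|k _]; first by rewrite mule_ge0// lee_fin.
  apply: (@le_trans _ _ (((2 ^+ k.+1 * t) `^ r)%:E * (15 ^+ n.+1 * J / u k `^ s)%:E)).
    by apply: lee_wpmul2l; rewrite ?lee_fin.
  rewrite -EFinM lee_fin le_eqVlt; apply/orP; left; apply/eqP.
  have tn : t != 0%R by rewrite gt_eqF.
  have k2 : (0 < 2 ^+ k :> R)%R by rewrite exprn_gt0.
  rewrite /u exprS -mulrA !powRM ?mulr_ge0 ?(ltW k2) ?(ltW t0)//.
  have -> : (z ^+ k = (2 ^+ k) `^ r / (2 ^+ k) `^ s)%R.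
    rewrite -powRN -powRD; last by rewrite (gt_eqF k2) implybT.
    by rewrite -powR_mulrn ?(ltW z0)// /z -powRrM -powR_mulrn// -powRrM mulrC.
  rewrite /c; have -> : (t `^ (r - s) = t `^ r / t `^ s)%R.
    by rewrite powRD ?powRN// tn implybT.
  rewrite invfM; ring.
have c0 : (0 <= c)%R by rewrite !mulr_ge0 ?powR_ge0 ?exprn_ge0.
apply: le_trans (geometric_nneseries_le c0 _) _; first by rewrite z0 z1.
rewrite IJ -EFinM lee_fin /c /C le_eqVlt; apply/orP; left; apply/eqP; ring.
Qed.

End maximal_strong.

(** * Part (III) *)

Lemma poweR_root_le (R : realType) (a b : \bar R) (C r : R) : 0 <= a -> 0 <= b ->
  (0 < r)%R -> (0 <= C)%R -> a `^ r <= C%:E * b `^ r -> a <= (C `^ r^-1)%:E * b.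
Proof.
move=> a0 b0 r0 C0 ab.
have K (x : \bar R) : 0 <= x -> (x `^ r) `^ r^-1 = x.
  by move=> x0; rewrite -poweRrM divff ?gt_eqF// poweRe1.
rewrite -[leLHS]K// -[X in _ * X]K// -poweR_EFin -poweRM ?lee_fin ?poweR_ge0//.
by apply: ge0_le_poweR => //; [rewrite invr_ge0 ltW|exact: poweR_ge0].
Qed.

(** For 0 < k < +oo the choice t = k^(-1/p) makes both terms equal to C k^(r/p). For k = 0 no t is
    optimal and t tends to infinity; for k = +oo the bound is trivial. *)
Lemma optimize_scale (R : realType) (r p C : R) (a k J : \bar R) :
  (0 < r)%R -> (r < p)%R -> (0 < C)%R -> 0 <= a -> 0 <= k ->
  (forall t : R, (0 < t)%R ->
    J <= a + ((C * t `^ (p - r))%:E * k + (C * t `^ (- r))%:E)) ->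
  J <= a + (2 * C)%:E * k `^ (r / p).
Proof.
move=> r0 rp C0 a0 k0 H; have p0 : (0 < p)%R by apply: lt_trans rp.
have rp0 : (0 < r / p)%R by rewrite divr_gt0.
have C20 : (0 < 2 * C)%R by rewrite mulr_gt0.
case: k k0 H => [x||//]; last first.
  move=> _ _; rewrite eqy_poweR// gt0_muley ?lte_fin// addey ?leey//.
  by rewrite gt_eqF// (lt_le_trans _ a0)// ltNyr.
rewrite lee_fin le_eqVlt => /predU1P[<- H|x0 H].
  rewrite poweR0r ?gt_eqF// mule0 adde0; apply/lee_addgt0Pr => e e0.
  have Ce0 : (0 < C / e)%R by rewrite divr_gt0.
  have := H ((C / e) `^ r^-1)%R (powR_gt0 _ Ce0).
  rewrite mule0 add0e -powRrM mulrN mulVf ?gt_eqF// powRN powRr1 ?(ltW Ce0)//.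
  by rewrite invf_div mulrCA divff ?mulr1// gt_eqF.
have := H (x `^ (- p^-1))%R (powR_gt0 _ x0).
have -> : ((x `^ (- p^-1)) `^ (- r) = x `^ (r / p))%R.
  by rewrite -powRrM mulrNN mulrC.
have E : ((x `^ (- p^-1)) `^ (p - r) * x = x `^ (r / p))%R.
  rewrite -powRrM -{2}(powRr1 (ltW x0)) -powRD; last by rewrite (gt_eqF x0) implybT.
  by congr (_ `^ _)%R; field; rewrite gt_eqF.
rewrite -EFinM -mulrA E poweR_EFin -EFinD -EFinM.
by have -> : (C * x `^ (r / p) + C * x `^ (r / p) = 2 * C * x `^ (r / p))%R by ring.
Qed.

Lemma ge0_integralZD d (U : measurableType d) (R : realType)
    (m : {measure set U -> \bar R}) (D : set U) (V W : U -> \bar R) (c : R) :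
  measurable D -> measurable_fun D V -> measurable_fun D W -> (0 <= c)%R ->
  (forall x, D x -> 0 <= V x) -> (forall x, D x -> 0 <= W x) ->
  \int[m]_(x in D) (c%:E * (V x + W x)) =
  c%:E * (\int[m]_(x in D) V x + \int[m]_(x in D) W x).
Proof.
move=> mD mV mW c0 V0 W0; rewrite ge0_integralZl_EFin//.
- by rewrite ge0_integralD.
- by move=> x Dx; rewrite adde_ge0 ?V0 ?W0.
- exact: emeasurable_funD.
Qed.

Section part_III_local.
Context {R : realType} {n : nat}.
Local Notation T := (Rn R n).
Local Notation mu := (@lebesgue_Rn R n).
Local Notation muM := (mu : {measure set T -> \bar R}).
Implicit Types (Q P X : set T) (f g h : T -> R).

Definition kappa (p : R) Q h : \bar R := (((vol Q)^-1)%:E * JNsum p Q h) `^ p^-1.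

Definition osc_max (q : \bar R) Q f : \bar R :=
  avg_norm q Q (fun x => (f x)%:E - maximal Q f x).

Lemma kappa_ge0 p Q h : 0 <= kappa p Q h.
Proof. exact: poweR_ge0. Qed.

Lemma avg_mean_powR (r p : R) : (0 < r)%R -> (r < p)%R ->
  exists2 A : R, (0 < A)%R & forall Q h (t : R), cube Q -> mu.-integrable Q (EFin \o h) ->
    (0 < t)%R -> avg Q (fun x => (`|h x - mean Q h| `^ r)%:E) <=
      (A * t `^ (p - r))%:E * (((vol Q)^-1)%:E * JNsum p Q h) + (A * t `^ (- r))%:E.
Proof.
move=> r0 rp; have [A A0 H] := @john_nirenberg_local R n p r r0 rp.
exists A => // Q h t cQ hi t0; have v0 := vol_gt0 cQ.
apply: le_trans (lee_wpmul2l _ (H Q h t cQ hi t0)) _.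
  by rewrite lee_fin invr_ge0 ltW.
rewrite muleDr//; last by rewrite ge0_adde_def// inE ?mule_ge0 ?JNsum_ge0// lee_fin !mulr_ge0 ?powR_ge0 ?ltW.
rewrite muleCA -EFinM.
by have -> : ((vol Q)^-1 * (A * t `^ (- r) * vol Q) = A * t `^ (- r))%R by field; rewrite gt_eqF.
Qed.

Lemma kappaX (r p : R) Q h : (0 < p)%R ->
  (((vol Q)^-1)%:E * JNsum p Q h) `^ (r / p) = kappa p Q h `^ r.
Proof. by move=> p0; rewrite /kappa -poweRrM mulrC. Qed.

Lemma osc_JN_kappa (r p : R) : (0 < r)%R -> (r < p)%R ->
  exists2 C : R, (0 < C)%R & forall Q f, cube Q -> mu.-integrable Q (EFin \o f) ->
    osc_JN r%:E Q f <= C%:E * kappa p Q f.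
Proof.
move=> r0 rp; have [A A0 H] := avg_mean_powR r0 rp.
have p0 : (0 < p)%R by apply: lt_trans rp.
have A20 : (0 < 2 * A)%R by rewrite mulr_gt0.
exists ((2 * A) `^ r^-1)%R; first exact: powR_gt0.
move=> Q f cQ fi; have mf := integrable_measurable fi.
apply: poweR_root_le; rewrite ?kappa_ge0 ?avg_norm_ge0 ?(ltW A20)//.
have -> : osc_JN r%:E Q f = avg_norm r%:E Q (EFin \o (fun x => f x - mean Q f)%R).
  by apply: eq_avg_norm => x _ /=; rewrite EFinB meanE.
rewrite avg_normX//; last by apply/measurable_EFinP; exact: measurable_funB.
rewrite -kappaX// -[leRHS]add0e; apply: optimize_scale => //.
  by rewrite mule_ge0 ?JNsum_ge0// lee_fin vol_inv_ge0.
by move=> t t0; rewrite add0e; apply: H.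
Qed.

Lemma avg_norm_poweR_le (r : R) Q F W : (0 < r)%R -> cube Q -> measurable_fun Q W ->
  (forall x, Q x -> `|F x| `^ r <= W x) -> avg_norm r%:E Q F `^ r <= avg Q W.
Proof.
move=> r0 cQ mW FW; have W0 x : Q x -> 0 <= W x.
  by move=> /FW; apply: le_trans; exact: poweR_ge0.
rewrite avg_mscale// /avg_norm unlock -poweRrM mulVf ?gt_eqF// poweRe1; last first.
  by apply: integral_ge0 => x _; exact: poweR_ge0.
rewrite [leRHS]integral_mkcond; apply: le_integral_nneg => x _; first exact: poweR_ge0.
rewrite !patchE; case: ifPn => [/set_mem/FW//|_].
by rewrite abse0 poweR0r// gt_eqF.
Qed.

Lemma mean_abs_le_maximal Q f x : cube Q -> mu.-integrable Q (EFin \o f) -> Q x ->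
  (mean Q (fun y => `|f y|%R))%:E <= maximal Q f x.
Proof.
move=> cQ fi Qx; rewrite (meanE cQ (integrable_norm fi)).
by apply: ereal_sup_ubound; exists Q => //; split=> //; split.
Qed.

Lemma maximal_le_mean_abs Q f x : cube Q -> mu.-integrable Q (EFin \o f) -> Q x ->
  maximal Q f x <= (mean Q (fun y => `|f y|%R))%:E +
    maximal Q (fun y => `|f y| - mean Q (fun y => `|f y|))%R x.
Proof.
move=> cQ fi Qx; set m := mean _ _; apply: ge_ereal_sup => _ [P [[cP PQ] Px] <-].
have hi : mu.-integrable P (EFin \o (fun y => `|f y|%R)).
  apply: (integrableS (cube_measurable cQ) (cube_measurable cP) PQ).
  exact: integrable_norm.
apply: (@le_trans _ _ (m%:E + avg P (fun y => `| `|f y| - m |%R%:E))); last first.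
  apply: leeD2l; apply: ereal_sup_ubound; exists P => //; split=> //; split=> //.
rewrite addeC -leeBlDr//; apply: le_trans (abse_avgB_cst cP m hi).
exact: lee_abs.
Qed.

(** With m = |f|_Q, the triangle inequality through m suffices: since M_Q f >= m on Q, |m - M_Q f|
    is M_Q f - m, which [maximal_le_mean_abs] bounds. Where M_Q f is infinite, that lemma makes the
    right-hand side infinite too. *)
Lemma dist_maximal_le Q f x : cube Q -> mu.-integrable Q (EFin \o f) -> Q x ->
  `|(f x)%:E - maximal Q f x| <= `|f x - mean Q (fun y => `|f y|)|%R%:E +
    maximal Q (fun y => `|f y| - mean Q (fun y => `|f y|))%R x.
Proof.
move=> cQ fi Qx; set m := mean _ _; have := mean_abs_le_maximal cQ fi Qx.
have := maximal_le_mean_abs cQ fi Qx; rewrite -/m.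
case: (maximal Q f x) => [y| |//] h1; last first.
  move=> _; move: h1; case: (maximal Q _ x) => [z| |] //.
rewrite lee_fin => my; rewrite -EFinB abse_EFin.
apply: (@le_trans _ _ (`|f x - m|%R%:E + (y - m)%:E)).
  rewrite -EFinD lee_fin; apply: le_trans (ler_distD m (f x) y) _.
  by rewrite (distrC m) (@ger0_norm _ (y - m)%R) ?subr_ge0.
by apply: leeD2l; rewrite EFinB leeBlDl.
Qed.

Lemma osc_JNt_mean q Q f : cube Q -> mu.-integrable Q (EFin \o f) ->
  osc_JNt q Q f = avg_norm q Q (EFin \o (fun x => f x - mean Q (fun y => `|f y|))%R).
Proof.
move=> cQ fi; apply: eq_avg_norm => x _ /=.
by rewrite EFinB (meanE cQ (integrable_norm fi)).
Qed.

(** With s halfway between r and p, the maximal inequality is used at level t^-1 and the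
    John-Nirenberg inequality at t. The factor t^(s-r) of the former turns the t^(p-s) and t^(-s) of
    the latter into t^(p-r) and t^(-r), the form that [optimize_scale] expects. *)
Lemma osc_max_le (r p : R) : (1 <= r)%R -> (r < p)%R ->
  exists2 C : R, (0 < C)%R & forall Q f, cube Q -> mu.-integrable Q (EFin \o f) ->
    osc_max r%:E Q f <= C%:E * (osc_JNt r%:E Q f + kappa p Q (fun y => `|f y|%R)).
Proof.
move=> r1 rp; have r0 : (0 < r)%R by apply: lt_le_trans r1.
pose s := ((r + p) / 2)%R.
have rs : (r < s)%R by have [] := midf_lt rp.
have sp : (s < p)%R by have [] := midf_lt rp.
have s1 : (1 <= s)%R by apply: le_trans (ltW rs).
have s0 : (0 < s)%R by apply: lt_le_trans s1.
have p0 : (0 < p)%R by apply: lt_trans rp.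
have [A A0 HA] := avg_mean_powR s0 sp.
have [B B0 HB] := @maximal_strong R n r s r0 rs s1.
pose C1 : R := (2 `^ r * (1 + B * A))%R.
have BA0 : (0 < B * A)%R by rewrite mulr_gt0.
have C10 : (0 < C1)%R by rewrite mulr_gt0 ?powR_gt0// addr_gt0.
have C20 : (0 <= 2 * C1)%R by apply: mulr_ge0; [|exact: ltW].
have D0 : (0 < 2 `^ r + 2 * C1)%R by rewrite addr_gt0 ?powR_gt0// mulr_gt0.
exists ((2 `^ r + 2 * C1) `^ r^-1)%R; first exact: powR_gt0.
move=> Q f cQ fi; set h := fun y => `|f y|%R; pose m := mean Q h.
have hi : mu.-integrable Q (EFin \o h) by exact: integrable_norm.
have mf := integrable_measurable fi; have mh := integrable_measurable hi.
have J0 : 0 <= osc_JNt r%:E Q f by exact: avg_norm_ge0.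
have k0 := kappa_ge0 p Q h.
apply: poweR_root_le; rewrite ?adde_ge0 ?avg_norm_ge0 ?(ltW D0)//.
have v0 := vol_gt0 cQ.
have Jr0 := poweR_ge0 (osc_JNt r%:E Q f) r.
apply: (@le_trans _ _ ((2 `^ r)%:E * osc_JNt r%:E Q f `^ r +
    (2 * C1)%:E * kappa p Q h `^ r)); last first.
  rewrite EFinD ge0_muleDl ?lee_fin ?powR_ge0//.
  apply: leeD; apply: lee_wpmul2l.
  - by rewrite lee_fin powR_ge0.
  - by apply: ge0_le_poweR; rewrite ?(ltW r0)// leeDl.
  - by rewrite lee_fin.
  - by apply: ge0_le_poweR; rewrite ?(ltW r0)// leeDr.
rewrite -kappaX//; apply: optimize_scale => //.
- by rewrite mule_ge0// lee_fin powR_ge0.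
- by rewrite mule_ge0 ?JNsum_ge0// lee_fin vol_inv_ge0.
move=> t t0; set k := _ * JNsum _ _ _.
have K0 : 0 <= k by rewrite mule_ge0 ?JNsum_ge0// lee_fin vol_inv_ge0.
have mg : measurable_fun Q (fun y => h y - m)%R by exact: measurable_funB.
have ti0 : (0 < t^-1)%R by rewrite invr_gt0.
have [W [mW MW IW]] := HB Q _ _ cQ mg ti0.
have W0 x : Q x -> 0 <= W x by move=> /MW; apply: le_trans; exact: poweR_ge0.
pose V (x : T) : \bar R := (`|f x - m| `^ r)%:E.
have mV : measurable_fun Q V.
  apply/measurable_EFinP; apply: (@measurableT_comp _ _ _ _ _ _ (fun x => x `^ r)%R).
    exact: measurable_powR.
  exact: measurable_dist.
have V0 x : 0 <= V x by rewrite lee_fin powR_ge0.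
apply: le_trans (@avg_norm_poweR_le r Q _ (fun x => (2 `^ r)%:E * (V x + W x)) r0 cQ _ _) _.
- by apply: measurable_funeM; exact: emeasurable_funD.
- move=> x Qx; apply: (@le_trans _ _ ((`|f x - m|%R%:E + maximal Q (fun y => h y - m)%R x) `^ r)).
    by apply: ge0_le_poweR; [exact: ltW|exact: abse_ge0|exact: dist_maximal_le].
  apply: le_trans (poweRD_le _ _ (ltW r0)) _; [by rewrite lee_fin|exact: maximal_ge0|].
  apply: lee_wpmul2l; first by rewrite lee_fin powR_ge0.
  by rewrite poweR_EFin; apply: leeD => //; exact: MW.
have -> : avg Q (fun x => (2 `^ r)%:E * (V x + W x)) =
    (2 `^ r)%:E * (avg Q V + avg Q W).
  have c0 : (0 <= 2 `^ r)%R by exact: powR_ge0.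
  rewrite /avg (@ge0_integralZD _ _ _ muM _ _ _ _ (cube_measurable cQ) mV mW c0 (fun x _ => V0 x) W0).
  rewrite muleCA; congr (_ * _).
  by rewrite ge0_muleDr ?integral_ge0.
have -> : avg Q V = osc_JNt r%:E Q f `^ r.
  rewrite osc_JNt_mean// avg_normX//; apply/measurable_EFinP; exact: measurable_funB.
rewrite ge0_muleDr ?(avg_ge0 W0)//; apply: leeD2l.
have hA := HA Q h t cQ hi t0; rewrite -/k -/m in hA.
have {}IW : avg Q W <= (t `^ (- r))%:E + (B * t `^ (s - r))%:E *
    ((A * t `^ (p - s))%:E * k + (A * t `^ (- s))%:E).
  apply: le_trans (lee_wpmul2l _ IW) _; first by rewrite lee_fin invr_ge0 ltW.
  have tE u : (t^-1 `^ u = t `^ (- u))%R by rewrite -powR_inv1 ?(ltW t0)// -powRrM mulN1r.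
  rewrite !tE opprB ge0_muleDr; last 2 first.
  - by rewrite lee_fin mulr_ge0 ?powR_ge0 ?(ltW v0).
  - apply: mule_ge0; first by rewrite lee_fin mulr_ge0 ?powR_ge0 ?(ltW B0).
    by apply: integral_ge0 => x _; rewrite lee_fin powR_ge0.
  apply: leeD.
    by rewrite -EFinM mulrCA mulVf ?gt_eqF// mulr1.
  rewrite muleCA; apply: lee_wpmul2l => //.
  by rewrite lee_fin mulr_ge0 ?powR_ge0 ?(ltW B0).
apply: le_trans (lee_wpmul2l _ IW) _; first by rewrite lee_fin powR_ge0.
have tn : t != 0%R by rewrite gt_eqF.
have E1 : (t `^ (s - r) * t `^ (p - s) = t `^ (p - r))%R.
  rewrite -powRD; last by rewrite tn implybT.
  by congr (_ `^ _)%R; ring.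
have E2 : (t `^ (s - r) * t `^ (- s) = t `^ (- r))%R.
  rewrite -powRD; last by rewrite tn implybT.
  by congr (_ `^ _)%R; ring.
have C1t u : (0 < C1 * t `^ u)%R by rewrite (mulr_gt0 C10)// powR_gt0.
clear hA IW; move: K0; clearbody k; case: k => [x x0| _|//]; last first.
  by rewrite [X in _ <= X + _]gt0_muley ?lte_fin// addye ?leey.
rewrite -!(EFinM, EFinD) lee_fin -E1 -E2 /C1.
rewrite lee_fin in x0.
set a2 := (2 `^ r)%R; set a1 := (t `^ (s - r))%R; set a3 := (t `^ (p - s))%R.
set a4 := (t `^ (- s))%R.
have a0 : (0 <= a2 * a1 * a3 * x)%R by rewrite !mulr_ge0 ?powR_ge0.
rewrite -subr_ge0 (_ : (_ - _)%R = (a2 * a1 * a3 * x)%R)//; ring.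
Qed.

End part_III_local.

(** * Summation of kappa over collections *)

Section kappa.
Context {R : realType} {n : nat}.
Local Notation T := (Rn R n).
Local Notation mu := (@lebesgue_Rn R n).
Local Notation muM := (mu : {measure set T -> \bar R}).
Implicit Types (Q P X : set T) (f g h : T -> R).

(** Cubes of a collection may share boundary points, so each is replaced by a cube of the same
    volume inside its interior; finite subcollections suffice, as they define the sum. *)
Lemma sup_collections_vol Q : cube Q ->
  sup_collections Q (fun P => (vol P)%:E) <= (vol Q)%:E.
Proof.
move=> cQ; apply: ge_ereal_sup => _ [S [SQ triv] <-].
apply: ge_ereal_sup => _ [A [finA AS] <-].
have /choice[core hcore] : forall P : set T, exists P', cube P ->
    [/\ cube P', P' `<=` P° & vol P' = vol P].
  move=> P; have [cP|ncP] := pselect (cube P); last by exists P => /ncP.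
  by have [P' hP'] := cube_core cP; exists P'.
have hA P : A P -> [/\ cube (core P), core P `<=` P° & vol (core P) = vol P].
  by move=> /AS/SQ[cP _]; exact: hcore.
have -> : \sum_(P \in A) (vol P)%:E = \sum_(P \in A) muM (core P).
  by apply: eq_fsbigr => P /set_mem/hA[cP _ <-]; rewrite [RHS](cube_mu cP).
rewrite -measure_fin_bigcup//; last 2 first.
- move=> P P' AP AP' [x [Px P'x]]; apply: (triv P P' (AS _ AP) (AS _ AP')).
  by exists x; split; [have [_ + _] := hA P AP|have [_ + _] := hA P' AP']; exact.
- by move=> P /hA[cP _ _]; exact: cube_measurable.
rewrite -(cube_mu cQ); apply: le_lebesgue_outer => x [P AP Px].
have [_ + _] := hA P AP; move=> /(_ _ Px) /interior_subset.
by have [_] := SQ _ (AS _ AP); exact.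
Qed.

(** This is where alpha >= 0 enters: |P|^(alpha p) <= |Q|^(alpha p) for P inside Q. *)
Lemma JNsum_weight (p alpha : R) Q h : (0 < p)%R -> (0 <= alpha)%R -> cube Q ->
  JNsum p Q h <= (vol Q `^ (alpha * p))%:E *
    sup_collections Q (weight p alpha (osc1 ^~ h)).
Proof.
move=> p0 a0 cQ.
apply: le_trans (sup_collectionsZ _ _ _); [|exact: powR_ge0|]; last first.
  by move=> P; exact: weight_ge0.
apply: sup_collections_le => P [cP PQ].
have vP := vol_gt0 cP; have vQ := vol_gt0 cQ.
rewrite /weight poweRM ?lee_fin ?powR_ge0 ?osc1_ge0// poweR_EFin -powRrM mulNr.
rewrite powRN [leRHS]muleCA; apply: lee_wpmul2l; first by rewrite lee_fin ltW.
rewrite muleA -EFinM -[leLHS]mul1e; apply: lee_wpmul2r; first exact: poweR_ge0.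
rewrite lee_fin ler_pdivlMr ?powR_gt0// mul1r; apply: ge0_ler_powR.
- by rewrite mulr_ge0// ltW.
- by rewrite nnegrE ltW.
- by rewrite nnegrE ltW.
- exact: vol_le.
Qed.

(** The factor |Q| of the weight cancels the |Q|^-1 in kappa^p; the remaining |Q|^(-alpha p) absorbs
    the factor of [JNsum_weight], and superadditivity sums the local suprema. *)
Lemma Np_kappa_fin (p alpha : R) X h : (1 <= p)%R -> (0 <= alpha)%R ->
  Np p%:E alpha X (kappa p ^~ h) <= Np p%:E alpha X (osc1 ^~ h).
Proof.
move=> p1 a0; have p0 : (0 < p)%R by apply: lt_le_trans p1.
rewrite !Np_fin; apply: ge0_le_poweR; first by rewrite invr_ge0 ltW.
  by apply: sup_collections_ge0 => Q; exact: weight_ge0.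
apply: ge_ereal_sup => _ [S [SX triv] <-].
have w0 Q : 0 <= weight p alpha (osc1 ^~ h) Q by exact: weight_ge0.
apply: le_trans (sup_collections_super (F := id) w0 _ triv); last by move=> Q /SX[].
apply: le_esum => Q /SX[cQ _]; have vQ := vol_gt0 cQ.
have k0 : 0 <= ((vol Q)^-1)%:E * JNsum p Q h.
  by rewrite mule_ge0 ?JNsum_ge0// lee_fin vol_inv_ge0.
have va0 : 0 <= (vol Q `^ (- alpha))%:E by rewrite lee_fin powR_ge0.
have E : kappa p Q h `^ p = ((vol Q)^-1)%:E * JNsum p Q h.
  by rewrite -poweRrM mulVf ?gt_eqF// poweRe1.
have -> : weight p alpha (kappa p ^~ h) Q = ((vol Q `^ (alpha * p))^-1)%:E * JNsum p Q h.
  rewrite /weight /= (poweRM _ va0 (kappa_ge0 p Q h)) E poweR_EFin -powRrM mulNr powRN.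
  by rewrite muleCA [X in _ * X]muleA -EFinM divff ?gt_eqF// mul1e.
rewrite muleC lee_pdivrMr ?powR_gt0// muleC.
exact: JNsum_weight.
Qed.

(** If N is the right-hand side, each osc_1(P) with P inside Q is at most c = |Q|^alpha N, so that
    k(Q) <= c^p |Q| whatever the exponent p > 0. *)
Lemma Np_kappa_infty (p alpha : R) X h : (0 < p)%R -> (0 <= alpha)%R ->
  Np +oo alpha X (kappa p ^~ h) <= Np +oo alpha X (osc1 ^~ h).
Proof.
move=> p0 a0; apply: ge_ereal_sup => _ [Q [cQ QX] <-].
have vQ := vol_gt0 cQ.
have hN P : cubes X P -> (vol P `^ (- alpha))%:E * osc1 P h <= Np +oo alpha X (osc1 ^~ h).
  by move=> XP; apply: ereal_sup_ubound; exists P.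
have : 0 <= Np +oo alpha X (osc1 ^~ h).
  apply: le_trans (hN Q (conj cQ QX)).
  by rewrite mule_ge0 ?osc1_ge0// lee_fin powR_ge0.
case: (Np +oo alpha X (osc1 ^~ h)) hN => [N hN N0|_ _|//]; last exact: leey.
rewrite lee_fin in N0.
pose c := (vol Q `^ alpha * N)%R.
have c0 : (0 <= c)%R by rewrite mulr_ge0// powR_ge0.
have oP P : cubes Q P -> osc1 P h <= c%:E.
  move=> [cP PQ]; have vP := vol_gt0 cP.
  have := hN P (conj cP (subset_trans PQ QX)).
  rewrite powRN muleC lee_pdivrMr ?powR_gt0// => /le_trans; apply.
  rewrite -EFinM lee_fin mulrC; apply: ler_wpM2r => //.
  by apply: ge0_ler_powR; rewrite ?nnegrE ?(ltW vP) ?(ltW vQ)//; exact: vol_le.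
have kc : kappa p Q h <= c%:E.
  have -> : c%:E = (c%:E `^ p) `^ p^-1 by rewrite -poweRrM divff ?gt_eqF// poweRe1.
  apply: ge0_le_poweR; first by rewrite invr_ge0 ltW.
    by rewrite mule_ge0 ?JNsum_ge0// lee_fin vol_inv_ge0.
  rewrite muleC lee_pdivrMr//.
  apply: (@le_trans _ _ (sup_collections Q (fun P => c%:E `^ p * (vol P)%:E))).
    apply: sup_collections_le => P QP; rewrite muleC; apply: lee_wpmul2r.
      by rewrite lee_fin vol_nneg.
    by apply: ge0_le_poweR; [exact: ltW|exact: osc1_ge0|exact: oP].
  rewrite poweR_EFin; apply: le_trans (sup_collectionsZ _ _ _) _.
  - exact: powR_ge0.
  - by move=> P; rewrite lee_fin vol_nneg.
  - apply: lee_wpmul2l; first by rewrite lee_fin powR_ge0.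
    exact: sup_collections_vol.
rewrite powRN muleC lee_pdivrMr ?powR_gt0//; apply: le_trans kc _.
by rewrite -EFinM lee_fin /c mulrC.
Qed.

End kappa.

Section part_III.
Context {R : realType} {n : nat}.
Local Notation T := (Rn R n).
Local Notation mu := (@lebesgue_Rn R n).
Implicit Types (Q P X : set T) (f g h : T -> R).

Section per_cube.
Variables (Q : set T) (f : T -> R).
Hypotheses (cQ : cube Q) (fi : mu.-integrable Q (EFin \o f)).

Let mf : measurable_fun Q f := integrable_measurable fi.
Let mQ := cube_measurable cQ.
Let m := mean Q (fun y => `|f y|%R).

Let m0 : (0 <= m)%R.
Proof. by apply: fine_ge0; apply: avg_ge0 => x _; rewrite lee_fin. Qed.

Let mB : measurable_fun Q (fun x => f x - m)%R.
Proof. exact: measurable_funB. Qed.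

Lemma osc_JNt1E : osc_JNt 1 Q f = avg Q (fun x => `|f x - m|%:E).
Proof.
rewrite osc_JNt_mean// avg_norm1//; exact/measurable_EFinP.
Qed.

Lemma osc_JNt1_le q : 1 <= q -> osc_JNt 1 Q f <= osc_JNt q Q f.
Proof.
by move=> q1; rewrite osc_JNt1E osc_JNt_mean//; exact: avg_le_norm.
Qed.

Lemma osc1_abs_le : osc1 Q (fun y => `|f y|%R) <= osc_JNt 1 Q f.
Proof.
rewrite osc_JNt1E; apply: avg_le => x _; rewrite lee_fin// -/m.
by rewrite -{1}(ger0_norm m0); exact: ler_dist_dist.
Qed.

Lemma osc1_le : osc1 Q f <= 2%:E * osc_JNt 1 Q f.
Proof.
have -> : osc1 Q f = osc_JN 1 Q f.
  rewrite (_ : osc_JN 1 Q f = avg_norm 1 Q (EFin \o (fun x => f x - mean Q f)%R)).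
    by rewrite avg_norm1//; apply/measurable_EFinP; exact: measurable_funB.
  by apply: eq_avg_norm => x _ /=; rewrite EFinB meanE.
by rewrite osc_JNt_mean//; exact: osc_JN_le.
Qed.

Lemma avg_neg_le_JNt : avg_neg Q f <= osc_JNt 1 Q f.
Proof. by rewrite osc_JNt_mean//; exact: avg_neg_le. Qed.

(** As f_Q <= |f|_Q = m, the average of f - m is nonpositive, and |v| = v + 2 v^- with v = f - m
    gives the factor 2. The comparison with f - M_Q f comes after the passage to the L^q norm, which
    therefore concerns only the measurable function v^-. *)
Lemma osc_JNt_le_max q : 1 <= q -> osc_JNt 1 Q f <= 2%:E * osc_max q Q f.
Proof.
move=> q1; rewrite osc_JNt1E.
have Bi := integrableB_cst cQ fi m.
pose u := ((fun x => f x - m)%R^\-)%R.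
have mu_ : measurable_fun Q u by exact: measurable_funrneg.
apply: (@le_trans _ _ (2%:E * avg Q (fun x => `|u x|%:E))).
  rewrite /avg (integral_abs_funrneg mQ Bi) muleDr//; last first.
    by rewrite fin_num_adde_defr// integrable_fin_num.
  rewrite muleCA -[leRHS]add0e; apply: leeD2r.
  rewrite (_ : _ * _ = avg Q (fun x => (f x - m)%:E))// -avgB_cst//.
  rewrite leeBlDr// add0e (meanE cQ (integrable_norm fi)).
  by apply: le_trans (abse_avg cQ fi); exact: lee_abs.
apply: lee_wpmul2l => //; apply: le_trans (avg_le_norm cQ q1 mu_) _.
apply: avg_norm_le => // x Qx /=; have := mean_abs_le_maximal cQ fi Qx; rewrite -/m.
rewrite /u /funrneg; case: (maximal Q f x) => [y| |] // my; last by rewrite leey.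
rewrite -EFinB abse_EFin lee_fin (@ger0_norm _ (Num.max _ _)) ?le_max ?lexx ?orbT// ge_max normr_ge0 andbT.
rewrite lee_fin in my; rewrite opprB distrC; apply: le_trans (ler_norm _).
by rewrite lerB.
Qed.

End per_cube.

Variables (p : \bar R) (r alpha : R) (X : set T).
Hypotheses (p1 : 1 <= p) (r1 : (1 <= r)%R) (rp : r%:E < p) (alpha0 : (0 <= alpha)%R).
Hypothesis (hX : X = setT \/ cube X).
Local Notation L := (Lq_loc r%:E X).

Let q1 : 1 <= r%:E. Proof. by rewrite lee_fin. Qed.

Let fint f Q : L f -> cubes X Q -> mu.-integrable Q (EFin \o f).
Proof. by move=> Lf XQ; exact: (Lq_loc_integrable hX q1 Lf XQ). Qed.

Let J1 f := Np p alpha X (osc_JNt 1 ^~ f).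

Lemma Np_kappa : exists2 p' : R, (r < p')%R &
  forall h, Np p alpha X (kappa p' ^~ h) <= Np p alpha X (osc1 ^~ h).
Proof.
case: p p1 rp => [p' h1 h2|_ _|//].
  by exists p' => [|h]; [rewrite lte_fin in h2|exact: Np_kappa_fin].
exists (r + 1)%R => [|h]; first by rewrite ltrDl.
by apply: Np_kappa_infty => //; rewrite ltr_wpDl// (le_trans ler01).
Qed.

(** Raises the exponent of the tilde norm from 1 to r. Only the oscillation around f_Q has to be
    improved, by the John-Nirenberg inequality; the part due to f^- is already an L^1 average. *)
Lemma dominated_JNt_J1 : dominated L (norm_JNt p r%:E alpha X) J1.
Proof.
have r0 : (0 < r)%R by apply: lt_le_trans r1.
have [p' rp' Hk] := Np_kappa; have [C C0 HC] := @osc_JN_kappa R n r p' r0 rp'.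
(* The 4 comes from [NpD], C * 2 from [kappa] through [osc1_le], and the last 2 from the average of
   f^-. *)
exists (4 * (C * 2 + 2))%R; first by rewrite mulr_gt0// addr_gt0 ?mulr_gt0.
move=> f Lf; have cX := cubes_nonempty hX.
have k0 Q : 0 <= C%:E * kappa p' Q f by rewrite mule_ge0 ?kappa_ge0// lee_fin ltW.
have n0 Q : 0 <= 2%:E * avg_neg Q f by rewrite mule_ge0 ?avg_neg_ge0.
apply: (@le_trans _ _ (Np p alpha X
    (fun Q => C%:E * kappa p' Q f + 2%:E * avg_neg Q f))).
  apply: Np_le => // Q XQ; first exact: avg_norm_ge0.
  have [cQ _] := XQ; have fi := fint Lf XQ.
  by apply: le_trans (osc_JNt_le_sum q1 cQ fi) _; apply: leeD => //; exact: HC.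
apply: le_trans (NpD _ p1 cX _ _) _ => //.
rewrite EFinM -muleA; apply: lee_wpmul2l => //.
rewrite [X in _ <= X * _]EFinD ge0_muleDl ?lee_fin ?mulr_ge0 ?(ltW C0)//; apply: leeD; last first.
  apply: (@Np_leZ _ _ p alpha X _ (osc_JNt 1 ^~ f)) => // Q XQ; first exact: avg_norm_ge0.
  have [cQ _] := XQ; have fi := fint Lf XQ.
  by apply: lee_wpmul2l => //; exact: avg_neg_le_JNt.
apply: le_trans (NpZ _ p1 C0 _) _ => [Q _|]; first exact: kappa_ge0.
rewrite EFinM -muleA; apply: lee_wpmul2l; first by rewrite lee_fin ltW.
apply: le_trans (Hk f) _.
apply: Np_leZ => // Q XQ; [exact: osc1_ge0|exact: avg_norm_ge0|].
by have [cQ _] := XQ; have fi := fint Lf XQ; exact: osc1_le.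
Qed.

Lemma dominated_JNt_A :
  dominated L (norm_JNt p r%:E alpha X) (quantity_A p r%:E alpha X).
Proof.
apply: dominated_trans dominated_JNt_J1 _; exists 2%R => // f Lf.
apply: Np_leZ => // Q XQ; [exact: avg_norm_ge0|exact: avg_norm_ge0|].
by have [cQ _] := XQ; exact: osc_JNt_le_max (fint Lf XQ) _ q1.
Qed.

Lemma dominated_A_JNt :
  dominated L (quantity_A p r%:E alpha X) (norm_JNt p r%:E alpha X).
Proof.
have [p' rp' Hk] := Np_kappa; have [C C0 HC] := @osc_max_le R n r p' r1 rp'.
exists (C * 8)%R; first by rewrite mulr_gt0.
move=> f Lf; have cX := cubes_nonempty hX; have N0 := norm_JNt_ge0 r%:E alpha p1 hX f.
pose h := fun y => `|f y|%R.
have k0 Q : 0 <= kappa p' Q h by exact: kappa_ge0.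
have o0 Q : 0 <= osc_JNt r%:E Q f by exact: avg_norm_ge0.
apply: (@le_trans _ _ (C%:E * Np p alpha X
    (fun Q => osc_JNt r%:E Q f + kappa p' Q h))).
  apply: Np_leZ => // Q XQ; [exact: avg_norm_ge0|by rewrite adde_ge0|].
  by have [cQ _] := XQ; exact: HC (fint Lf XQ).
rewrite EFinM -muleA; apply: lee_wpmul2l; first by rewrite lee_fin ltW.
apply: le_trans (NpD _ p1 cX _ _) _ => //.
have -> : 8%:E = 4%:E * 2%:E :> \bar R by rewrite -EFinM; congr EFin; ring.
rewrite -muleA; apply: lee_wpmul2l => //.
rewrite (_ : 2%:E = 1 + 1)// ge0_muleDl// !mul1e; apply: leeD => //.
apply: le_trans (Hk h) _; apply: Np_le => // Q XQ; first exact: osc1_ge0.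
have [cQ _] := XQ; have fi := fint Lf XQ.
by apply: le_trans (osc1_abs_le cQ fi) _; exact: osc_JNt1_le.
Qed.

End part_III.

(** * Assembly of the equivalences *)

Definition codominated {R : realType} {n : nat} (L : set (Rn R n -> R)) G H :=
  dominated L G H /\ dominated L H G.

(** Two-sided comparison with the single reference [G0] yields all pairwise equivalences. *)
Lemma equivalent_in_seq (R : realType) (n : nat) (L : set (Rn R n -> R)) G0
    (s : seq ((Rn R n -> R) -> \bar R)) :
  (forall G, G \in s -> codominated L G G0) ->
  {in s &, forall G H, equivalent_on L G H}.
Proof.
move=> h G H /h[GG0 G0G] /h[HG0 G0H].
by apply: equivalent_dominated; [exact: dominated_trans G0H|exact: dominated_trans G0G].
Qed.

Lemma dominated_finite (R : realType) (n : nat) (L : set (Rn R n -> R)) G H f :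
  dominated L H G -> L f /\ G f < +oo -> L f /\ H f < +oo.
Proof. by move=> d [Lf Gf]; split=> //; exact: (dominated_fin d Lf Gf). Qed.

Theorem corollary3p12 (R : realType) (n : nat) (p q : \bar R) (alpha : R)
    (X : set (Rn R n)) (hp : 1 <= p) (hq : 1 <= q)
    (hX : X = setT \/ cube X) :
  let L := Lq_loc q X in
  let i := JNt p q alpha X in
  let ii := [set f | JN p q alpha X f /\ RM p alpha X (f^\-)%R] in
  let iii := [set f | L f /\ quantity_B p q alpha X f < +oo] in
  let iv := [set f | L f /\ quantity_A p q alpha X f < +oo] in
  let v := [set f | L f /\ quantity_D p q alpha X f < +oo] in
  let N1 := norm_JNt p q alpha X in
  let N2 := fun f => norm_JN p q alpha X f + norm_RM p alpha X (f^\-)%R in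
  let B := quantity_B p q alpha X in
  let A := quantity_A p q alpha X in
  let D := quantity_D p q alpha X in
  [/\ (forall f : Rn R n -> R, [<-> i f; ii f; iii f]) /\
      {in [:: N1; N2; B] &, forall G H, equivalent_on L G H},
      (forall f : Rn R n -> R, [<-> iv f; v f]) /\
      {in [:: A; D] &, forall G H, equivalent_on L G H} &
      q < p -> (0 <= alpha)%R ->
      (forall f : Rn R n -> R, [<-> i f; ii f; iii f; iv f; v f]) /\
      {in [:: N1; N2; B; A; D] &, forall G H, equivalent_on L G H}].
Proof.
have III : q < p -> (0 <= alpha)%R -> codominated (Lq_loc q X)
    (norm_JNt p q alpha X) (quantity_A p q alpha X).
  case: q hq => [r|_|//]; last by rewrite ltNge leey.
  rewrite lee_fin => r1 rp a0; split; first exact: dominated_JNt_A.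
  exact: dominated_A_JNt.
move=> L i ii iii iv v N1 N2 B A D.
have BN1 : dominated L B N1 := dominated_B_JNt alpha hp hq hX.
have N2B : dominated L N2 B := dominated_JN_B alpha hp hq hX.
have N1N2 : dominated L N1 N2 := dominated_JNt_JN alpha hp hq hX.
have N1N1 : dominated L N1 N1 := dominated_refl L N1.
have AA : dominated L A A := dominated_refl L A.
have iiP f : ii f <-> L f /\ N2 f < +oo by exact: JN_RMP.
have AD : D = A by rewrite /D -quantity_AD.
have vE : v = iv by rewrite /v -/D AD.
have BN2 := dominated_trans BN1 N1N2.
have N2N1 := dominated_trans N2B BN1.
have N1B := dominated_trans N1N2 N2B.
split.
- split=> [f|].
    tfae=> [h|/iiP h|h].
    + apply/iiP; exact: (dominated_finite N2N1 h).
    + exact: (dominated_finite BN2 h).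
    + exact: (dominated_finite N1B h).
  apply: (@equivalent_in_seq _ _ L N1) => G.
  rewrite !inE => /or3P[] /eqP->.
  + exact: (conj N1N1 N1N1).
  + exact: (conj N2N1 N1N2).
  + exact: (conj BN1 N1B).
- split=> [f|]; first by rewrite vE; split.
  apply: (@equivalent_in_seq _ _ L A) => G.
  by rewrite !inE AD orbb => /eqP->; exact: (conj AA AA).
move=> qp a0; have [N1A AN1] := III qp a0.
have AB := dominated_trans AN1 N1B.
split=> [f|].
  rewrite vE; tfae=> [h|/iiP h|h|h|h].
  + apply/iiP; exact: (dominated_finite N2N1 h).
  + exact: (dominated_finite BN2 h).
  + exact: (dominated_finite AB h).
  + exact: h.
  + exact: (dominated_finite N1A h).
apply: (@equivalent_in_seq _ _ L N1) => G.
rewrite !inE AD orbb => /or4P[] /eqP->.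
- exact: (conj N1N1 N1N1).
- exact: (conj N2N1 N1N2).
- exact: (conj BN1 N1B).
- exact: (conj AN1 N1A).
Qed.
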